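(* Let $d\geq1$ be an integer. In each of the following three cases, the bivariate kernel $\boldsymbol h\mapsto\left[\rho_{ij}\,G_d(\boldsymbol h;a_{ij},\alpha_{ij},\beta_{ij},\gamma_{ij})\right]_{i,j=1}^2$ is a valid matrix-valued covariance kernel in $\mathbb{R}^d$, where in all cases $\boldsymbol a=[a_{ij}]_{i,j=1}^2$ with $a_{11}=a_{12}=a_{21}=a_{22}=a$ for some $a>0$, and $\boldsymbol\rho=[\rho_{ij}]=\begin{bmatrix} 1 & \rho \\ \rho & 1 \end{bmatrix}$ with $\rho\in\mathbb{R}$. (i) $\boldsymbol\alpha=\begin{bmatrix} \alpha & \alpha \\ \alpha & \alpha \end{bmatrix}$, $\boldsymbol\beta=\begin{bmatrix} \beta_1 & \alpha+\frac12 \\ \alpha+\frac12 & \beta_2 \end{bmatrix}$, $\boldsymbol\gamma=\begin{bmatrix} 3\alpha+\frac12-\beta_1 & 2\alpha \\ 2\alpha & 3\alpha+\frac12-\beta_2 \end{bmatrix}$, with $\alpha>\frac d2$, $\alpha+\frac12<\beta_1\leq2\alpha$, $\alpha+\frac12<\beta_2\leq2\alpha$ and $$\rho^2\leq\frac{\Gamma^2(\alpha+\frac12)\Gamma^2(2\alpha)\Gamma(\beta_1-\frac d2)\Gamma(\beta_2-\frac d2)\Gamma(3\alpha-\beta_1+\frac{1-d}2)\Gamma(3\alpha-\beta_2+\frac{1-d}2)}{\Gamma^2(\alpha+\frac{1-d}2)\Gamma^2(2\alpha-\frac d2)\Gamma(\beta_1)\Gamma(\beta_2)\Gamma(3\alpha-\beta_1+\frac12)\Gamma(3\alpha-\beta_2+\frac12)}.$$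 (ii) $\boldsymbol\alpha=\begin{bmatrix} \alpha_1 & \beta-\frac12 \\ \beta-\frac12 & \alpha_2 \end{bmatrix}$, $\boldsymbol\beta=\begin{bmatrix} \beta & \beta \\ \beta & \beta \end{bmatrix}$, $\boldsymbol\gamma=\begin{bmatrix} \alpha_1+\beta-\frac12 & 2\beta-1 \\ 2\beta-1 & \alpha_2+\beta-\frac12 \end{bmatrix}$, with $\alpha_1>\frac d2$, $\alpha_2>\frac d2$, $\beta\geq\max\{\alpha_1,\alpha_2\}+\frac12$ and $$\rho^2\leq\frac{\Gamma(\alpha_1)\Gamma(\alpha_2)\Gamma(\alpha_1+\beta-\frac{d+1}2)\Gamma(\alpha_2+\beta-\frac{d+1}2)\Gamma^2(\beta-\frac{d+1}2)\Gamma^2(2\beta-1)}{\Gamma(\alpha_1-\frac d2)\Gamma(\alpha_2-\frac d2)\Gamma(\alpha_1+\beta-\frac12)\Gamma(\alpha_2+\beta-\frac12)\Gamma^2(\beta-\frac12)\Gamma^2(2\beta-1-\frac d2)}.$$ (iii) $\boldsymbol\alpha=\begin{bmatrix} \alpha_1 & \beta-\frac12 \\ \beta-\frac12 & \alpha_2 \end{bmatrix}$, $\boldsymbol\beta=\begin{bmatrix} \beta & \beta \\ \beta & \beta \end{bmatrix}$, $\boldsymbol\gamma=\begin{bmatrix} 2\alpha_1 & 2\beta-1 \\ 2\beta-1 & 2\alpha_2 \end{bmatrix}$, with $\alpha_1>\frac d2$, $\alpha_2>\frac d2$, $\beta\geq\max\{\alpha_1,\alpha_2\}+\frac12$ and $$\rho^2\leq\frac{\Gamma(\alpha_1)\Gamma(\alpha_2)\Gamma(2\alpha_1-\frac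 d2)\Gamma(2\alpha_2-\frac d2)\Gamma^2(\beta-\frac{d+1}2)\Gamma^2(2\beta-1)}{\Gamma(\alpha_1-\frac d2)\Gamma(\alpha_2-\frac d2)\Gamma(2\alpha_1)\Gamma(2\alpha_2)\Gamma^2(\beta-\frac12)\Gamma^2(2\beta-1-\frac d2)}.$$
   Context: For $a>0$, $\alpha>\frac d2$, $\beta>\alpha$, $\gamma>\alpha$, the Gauss hypergeometric covariance is $$G_d(\boldsymbol h;a,\alpha,\beta,\gamma)=\frac{\Gamma(\beta-\frac d2)\Gamma(\gamma-\frac d2)}{\Gamma(\beta-\alpha+\gamma-\frac d2)\Gamma(\alpha-\frac d2)}\left(1-\frac{\|\boldsymbol h\|^2}{a^2}\right)_+^{\beta-\alpha+\gamma-\frac d2-1}{}_2F_1\left(\beta-\alpha,\gamma-\alpha;\beta-\alpha+\gamma-\tfrac d2;\left(1-\tfrac{\|\boldsymbol h\|^2}{a^2}\right)_+\right),\quad\boldsymbol h\in\mathbb{R}^d,$$ where $(x)_+=\max\{x,0\}$ and ${}_2F_1$ is the Gauss hypergeometric function. The entries of $\boldsymbol\alpha,\boldsymbol\beta,\boldsymbol\gamma$ are denoted $\alpha_{ij},\beta_{ij},\gamma_{ij}$. A matrix-valued function $\boldsymbol C=[C_{ij}]_{i,j=1}^2$ on $\mathbb{R}^d$ is a valid matrix-valued covariance kernel if it is positive semidefinite: $\sum_{k,l=1}^n\boldsymbol\omega_k^\top\boldsymbol C(\boldsymbol x_k-\boldsymbol x_l)\boldsymbol\omega_l\geq0$ for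 all $n$, $\boldsymbol x_k\in\mathbb{R}^d$, $\boldsymbol\omega_k\in\mathbb{R}^2$. *)

(* Defs.v *)
From HB Require Import structures.
From mathcomp Require Import all_boot all_order all_algebra.
From mathcomp Require Import all_classical all_reals all_analysis.

Set Implicit Arguments.
Unset Strict Implicit.
Unset Printing Implicit Defensive.

Import Order.TTheory GRing.Theory Num.Theory.
Import numFieldNormedType.Exports.

Local Open Scope classical_set_scope.
Local Open Scope ring_scope.

(* Euler's integral. It is meaningful for 0 < x only (otherwise the integral
   diverges and the value is the junk value 0). *)
Definition Gamma (R : realType) (x : R) : R :=
  \int[@lebesgue_measure R]_(t in `]0, +oo[) (t `^ (x - 1) * expR (- t)).

Definition pochhammer (R : realType) (x : R) (n : nat) : R :=
  \prod_(i < n) (x + i%:R).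

(* The Gauss hypergeometric function as the sum of its power series. At
   z = 1 this series still converges when a + b < c. *)
Definition hyp2F1 (R : realType) (a b c z : R) : R :=
  limn (series (fun n : nat =>
    pochhammer a n * pochhammer b n / (pochhammer c n * n`!%:R) * z ^+ n)).

(* The canonical norm `|h| on 'rV[R]_d is the sup norm, hence this one. *)
Definition euclidean_norm (R : realType) (d : nat) (h : 'rV[R]_d) : R :=
  Num.sqrt (\sum_(i < d) h ord0 i ^+ 2).

Definition pos_part (R : realType) (x : R) : R := Num.max x 0.

(* The real power x `^ p satisfies 0 `^ p = 0 for p != 0, so the kernel vanishes
   for a <= euclidean_norm h whenever the exponent is positive. *)
Definition gauss_hypergeometric_cov (R : realType) (d : nat)
    (h : 'rV[R]_d) (a alpha beta gamma : R) : R :=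
  let hd : R := d%:R / 2 in
  let u := pos_part (1 - euclidean_norm h ^+ 2 / a ^+ 2) in
  Gamma (beta - hd) * Gamma (gamma - hd)
    / (Gamma (beta - alpha + gamma - hd) * Gamma (alpha - hd))
  * u `^ (beta - alpha + gamma - hd - 1)
  * hyp2F1 (beta - alpha) (gamma - alpha) (beta - alpha + gamma - hd) u.

Definition valid_matrix_cov (R : realType) (d p : nat)
    (C : 'rV[R]_d -> 'M[R]_p) : Prop :=
  forall (n : nat) (x : 'I_n -> 'rV[R]_d) (w : 'I_n -> 'cV[R]_p),
    0 <= \sum_(k < n) \sum_(l < n)
           ((w k)^T *m C (x k - x l) *m w l) ord0 ord0.

(* The symmetric matrix with rows (p, q) and (q, r). *)
Definition sym_mx2 (R : realType) (p q r : R) : 'M[R]_2 :=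
  \matrix_(i < 2, j < 2)
    if i != j then q else if i == ord0 then p else r.

Definition bivariate_gauss_hypergeometric (R : realType) (d : nat)
    (rho a alpha beta gamma : 'M[R]_2) (h : 'rV[R]_d) : 'M[R]_2 :=
  \matrix_(i < 2, j < 2)
    (rho i j *
     gauss_hypergeometric_cov h (a i j) (alpha i j) (beta i j) (gamma i j)).

(* Main.v *)
Require Import Defs.
From HB Require Import structures.
From mathcomp Require Import all_boot all_order all_algebra.
From mathcomp Require Import all_classical all_reals all_analysis measurable_realfun.
From mathcomp Require Import ring lra zify.

Set Implicit Arguments.
Unset Strict Implicit.
Unset Printing Implicit Defensive.

Import Order.TTheory GRing.Theory Num.Theory.
Import numFieldNormedType.Exports.

Local Open Scope classical_set_scope.
Local Open Scope ring_scope.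

(* In each case the entries of the kernel are functions of |x - y| / a whose
   radial Fourier transform is a positive constant k_ij times
   1F2(alpha_ij; beta_ij, gamma_ij; -t). The off-diagonal 1F2 has parameters of
   the form (nu + 1/2; nu + 1, 2 nu + 1), so it is the square of a Bessel
   function. Gasper's expansion of a 1F2 in squares of Bessel functions, whose
   coefficients are nonnegative by terminating well-poised summation formulas,
   starts with that square, so the off-diagonal 1F2 is bounded by both diagonal
   ones. Hence C_ii / k_ii - C_12 / k_12 has a nonnegative transform, and what
   remains is C_12 / k_12 times the matrix with rows (k_11, rho k_12) and
   (rho k_12, k_22), which is positive semidefinite by the bound on rho.

   That a radial function g(|x - y|^2) with nonnegative transform is positive
   semidefinite is obtained without Fourier inversion in R^d: a Gaussian
   smoothing of g is both a mixture of the kernels 0F1(; d/2; -t |x - y|^2)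
   (Fourier transforms of spheres) with nonnegative weights, and an average of
   the values of g that tends to g. All transforms are one-dimensional power
   series whose coefficients are the moments of g. *)

(** * Pochhammer symbols and series *)

(** Throughout, [d] in the analytic part is half the dimension, and radial functions are written in
    the squared radius s. Integration over space then becomes integration against s^(d-1) ds, and
    every transform is a plain 0F1 or 1F2. The obstacle is that a nonnegative transform yields
    positive semidefiniteness only through some inversion. Here it is replaced by evaluating one
    double series of moments in two ways: 0F1(; d; -st) times a Gaussian is integrated against the
    power series of the transform, Kummer's transformation turns each term into a polynomial times
    exp(-s/p), and regrouping by the degree in s leaves Poisson weights times averages of the
    function. The Bessel order is nu = alpha - 1/2 in case (i) and nu = beta - 1 in cases (ii) and
    (iii). The ranges of beta are what makes the parameters in Gasper's coefficients nonnegative.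
    The constants k_ij are [gauss_spectral], and the bound on rho is rho^2 <= k_11 k_22 / k_12^2
    written out. *)

Section Pochhammer.
Context {R : realType}.
Implicit Types (x y : R) (m n : nat).

Local Notation poch := (@pochhammer R).

Lemma poch0 x : poch x 0 = 1.
Proof. by rewrite /pochhammer big_ord0. Qed.

Lemma pochSr x n : poch x n.+1 = poch x n * (x + n%:R).
Proof. by rewrite /pochhammer big_ord_recr. Qed.

Lemma pochSl x n : poch x n.+1 = x * poch (x + 1) n.
Proof.
rewrite /pochhammer big_ord_recl addr0; congr (_ * _).
by apply: eq_bigr => i _; rewrite /bump /= natrD addrA.
Qed.

Lemma pochD x m n : poch x (m + n) = poch x m * poch (x + m%:R) n.
Proof.
rewrite /pochhammer big_split_ord; congr (_ * _).
by apply: eq_bigr => i _; rewrite /= natrD addrA.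
Qed.

Lemma poch_gt0 x n : 0 < x -> 0 < poch x n.
Proof. by move=> x0; apply: prodr_gt0 => i _; rewrite ltr_wpDr. Qed.

Lemma poch_ge0 x n : 0 <= x -> 0 <= poch x n.
Proof. by move=> x0; apply: prodr_ge0 => i _; rewrite addr_ge0. Qed.

Lemma poch_neq0 x n : 0 < x -> poch x n != 0.
Proof. by move=> x0; rewrite gt_eqF// poch_gt0. Qed.

Lemma ler_poch x y n : 0 <= x -> x <= y -> poch x n <= poch y n.
Proof.
by move=> x0 xy; apply: ler_prod => i _; rewrite addr_ge0//= lerD2r.
Qed.

Lemma poch1 n : poch 1 n = n`!%:R.
Proof.
elim: n => [|n IH]; first by rewrite poch0.
by rewrite pochSr IH factS natrM mulrC -natr1 addrC.
Qed.

Lemma poch_ge1 x n : 1 <= x -> 1 <= poch x n.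
Proof.
move=> x1; have : poch 1 n <= poch x n by exact: ler_poch.
by apply: le_trans; rewrite poch1 ler1n fact_gt0.
Qed.

(** The factors after the first form a Pochhammer symbol of x + 1, which is at least 1. The bound is
    uniform in n, so the 0F1 and 1F2 series get exponential majorants. *)
Lemma poch_ge_min x n : 0 < x -> Num.min 1 x <= poch x n.
Proof.
move=> x0; case: n => [|n]; first by rewrite poch0 ge_min lexx.
rewrite pochSl ge_min; apply/orP; right.
by rewrite ler_peMr ?(ltW x0)// poch_ge1// lerDr ltW.
Qed.

(** The factors read backwards with opposite signs; this produces the parameters that
    Chu-Vandermonde needs in [cvg_Kummer] and [sqr_hyp0F1]. *)
Lemma poch_rev x n : poch x n = (-1) ^+ n * poch (1 - x - n%:R) n.
Proof.
elim: n => [|n IH]; first by rewrite !poch0 expr0 mulr1.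
rewrite pochSr IH pochSl exprS -natr1.
have -> : 1 - x - (n%:R + 1) + 1 = 1 - x - n%:R :> R by ring.
ring.
Qed.

(** Chu-Vandermonde. In the induction the new factor splits as x + y + n = (x + i) + (y + (n - i)),
    and Pascal's rule recombines the two sums. *)
Lemma poch_vandermonde x y n :
  \sum_(k < n.+1) 'C(n, k)%:R * poch x k * poch y (n - k) = poch (x + y) n.
Proof.
elim: n x y => [|n IH] x y.
  by rewrite big_ord_recl big_ord0 /= !poch0 bin0 !mulr1 addr0.
rewrite pochSr -IH big_distrl /= big_ord_recl /= bin0 poch0 subn0.
under eq_bigr => i _.
  rewrite /bump /= add1n binS natrD subSS mulrDl mulrDl.
  over.
rewrite big_split /= addrA.
have -> : 1%:R * 1 * poch y n.+1 +
   \sum_(i < n.+1) 'C(n, i.+1)%:R * poch x i.+1 * poch y (n - i) =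
   \sum_(i < n.+1) 'C(n, i)%:R * poch x i * poch y (n - i).+1.
  rewrite [in RHS]big_ord_recl /= bin0 poch0 subn0; congr (_ + _).
  rewrite big_ord_recr /= bin_small// !mul0r addr0.
  apply: eq_bigr => i _; rewrite /bump /= add1n.
  by have -> : (n - i.+1).+1 = (n - i)%N by have := ltn_ord i; lia.
rewrite -big_split /=; apply: eq_bigr => i _.
have iE : n%:R = i%:R + (n - i)%:R :> R.
  by rewrite -natrD; congr (_%:R); have := ltn_ord i; lia.
rewrite !pochSr iE; ring.
Qed.

End Pochhammer.

(** * Numerical series: domination, double series, Cauchy products *)

Section SeriesTools.
Context {R : realType}.
Implicit Types (u v A B : R^nat).

Lemma eq_cvg_series u v (l : R) : u =1 v ->
  series u @ \oo --> l -> series v @ \oo --> l.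
Proof. by move=> /funext ->. Qed.

Lemma cvg_seriesZ k u (l : R) : series u @ \oo --> l ->
  series (fun n => k * u n) @ \oo --> k * l.
Proof.
move=> ul; have -> : series (fun n => k * u n) = (fun n => k * series u n).
  by apply/funext => n; rewrite /series /= big_distrr.
exact: cvgMr.
Qed.

Lemma cvg_seriesD u v (l l' : R) :
  series u @ \oo --> l -> series v @ \oo --> l' ->
  series (fun n => u n + v n) @ \oo --> l + l'.
Proof.
move=> ul vl; have -> : series (fun n => u n + v n) =
    (fun n => series u n + series v n).
  by apply/funext => n; rewrite /series /= big_split.
exact: cvgD.
Qed.

Lemma cvg_seriesB u v (l l' : R) :
  series u @ \oo --> l -> series v @ \oo --> l' ->
  series (fun n => u n - v n) @ \oo --> l - l'.
Proof.
move=> ul vl; have -> : (fun n => u n - v n) = (fun n => u n + -1 * v n).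
  by apply/funext => n; rewrite mulN1r.
by rewrite -[- l']mulN1r; apply: cvg_seriesD => //; exact: cvg_seriesZ.
Qed.

Lemma is_cvg_series_dom u B : (forall n, `|u n| <= B n) ->
  cvgn (series B) -> cvgn (series u).
Proof.
move=> uB cB; apply: normed_cvg; apply: (series_le_cvg _ _ _ cB) => n //=.
by apply: le_trans (uB n).
Qed.

Lemma series_le_lim A n (a : R) : (forall n, 0 <= A n) ->
  series A @ \oo --> a -> series A n <= a.
Proof.
move=> A0 Aa; rewrite -(cvg_lim _ Aa)//.
apply: nondecreasing_cvgn_le; last by apply/cvg_ex; exists a.
by apply: nondecreasing_series => k _ _; exact: A0.
Qed.

Lemma normr_series_lim_le u B (l b : R) : (forall n, `|u n| <= B n) ->
  series u @ \oo --> l -> series B @ \oo --> b -> `|l| <= b.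
Proof.
move=> uB ul Bb; rewrite -(cvg_lim _ (cvg_norm ul))// -(cvg_lim _ Bb)//.
apply: ler_lim; [by apply/cvg_ex; eexists; apply: cvg_norm ul|
                 by apply/cvg_ex; eexists; exact: Bb|].
near=> n; rewrite /series /=; apply: le_trans (ler_norm_sum _ _ _) _.
by apply: ler_sum.
Unshelve. all: by end_near. Qed.

Lemma sum_antidiagonal (u : nat -> nat -> R) N :
  \sum_(0 <= n < N) \sum_(k < n.+1) u k (n - k)%N =
  \sum_(0 <= k < N) \sum_(0 <= j < N - k) u k j.
Proof.
elim: N => [|N IH]; first by rewrite !big_geq.
rewrite big_nat_recr//= IH [in RHS]big_nat_recr//= subSnn big_nat1.
rewrite big_ord_recr /= subnn addrA; congr (_ + _).
rewrite -(big_mkord xpredT (fun k => u k (N - k)%N)) -big_split /=.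
apply: eq_big_nat => k /andP[_ kN].
by rewrite subSn 1?ltnW// big_nat_recr//=.
Qed.

(** Fubini for double series. The partial sums of the rows and of the antidiagonals differ by the
    row tails beyond N - k. For k < N/2 these are small through the tail of [B], for k >= N/2
    through the tail of [A]. *)
Lemma cvg_series_antidiagonal (u : nat -> nat -> R) A B (r : R^nat) (l : R) :
  (forall n, 0 <= A n) -> (forall n, 0 <= B n) ->
  (forall k j, `|u k j| <= A k * B j) ->
  cvgn (series A) -> cvgn (series B) ->
  (forall k, series (u k) @ \oo --> r k) ->
  series r @ \oo --> l ->
  series (fun n => \sum_(k < n.+1) u k (n - k)%N) @ \oo --> l.
Proof.
move=> A0 B0 uAB /cvg_ex[/= a Aa] /cvg_ex[/= b Bb] ur rl.
have SA n : series A n <= a by exact: series_le_lim.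
have SB n : series B n <= b by exact: series_le_lim.
have a0 : 0 <= a by apply: le_trans (SA 0%N); rewrite /series /= big_geq.
have b0 : 0 <= b by apply: le_trans (SB 0%N); rewrite /series /= big_geq.
have SBmono : {homo series B : m n / (m <= n)%N >-> m <= n}.
  by apply: nondecreasing_series => k _ _; exact: B0.
have tail k n : `|r k - series (u k) n| <= A k * (b - series B n).
  have h1 : (fun m => `|series (u k) (n + m)%N - series (u k) n|) @ \oo -->
      `|r k - series (u k) n|.
    apply: cvg_norm; apply: cvgB; last exact: cvg_cst.
    by have := ur k; rewrite -(cvg_shiftn n); under eq_fun do rewrite addnC.
  have h2 : (fun m => A k * (series B (n + m)%N - series B n)) @ \oo -->
      A k * (b - series B n).
    apply: cvgMr; apply: cvgB; last exact: cvg_cst.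
    by have := Bb; rewrite -(cvg_shiftn n); under eq_fun do rewrite addnC.
  rewrite -(cvg_lim _ h1)// -(cvg_lim _ h2)//; apply: ler_lim.
  - by apply/cvg_ex; eexists; exact: h1.
  - by apply/cvg_ex; eexists; exact: h2.
  near=> m; rewrite !sub_series_geq ?leq_addr// mulr_sumr.
  by apply: le_trans (ler_norm_sum _ _ _) _; exact: ler_sum.
have bound N : `|series r N - series (fun n => \sum_(k < n.+1) u k (n - k)%N) N|
    <= a * (b - series B N./2) + b * (a - series A N./2).
  rewrite /series /= sum_antidiagonal -sumrB.
  apply: le_trans (ler_norm_sum _ _ _) _.
  apply: (@le_trans _ _ (\sum_(0 <= k < N) A k * (b - series B (N - k)%N))).
    by apply: ler_sum => k _; exact: tail.
  have hN : (N./2 <= N)%N by lia.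
  rewrite (big_cat_nat (n := N./2))//=; apply: lerD.
    apply: (@le_trans _ _ (\sum_(0 <= k < N./2) A k * (b - series B N./2))).
      rewrite !big_mkord; apply: ler_sum => k _; apply: ler_wpM2l => //.
      by rewrite lerD2l lerN2; apply: SBmono; have := ltn_ord k; lia.
    by rewrite -mulr_suml ler_wpM2r// ?subr_ge0//; exact: SA.
  apply: (@le_trans _ _ (\sum_(N./2 <= k < N) A k * b)).
    apply: ler_sum => k _; apply: ler_wpM2l => //.
    by rewrite gerBl /series /= sumr_ge0.
  by rewrite -mulr_suml mulrC ler_wpM2l// -sub_series_geq// lerD2r.
have half : (fun N => N./2) @ \oo --> \oo.
  move=> P [N _ NP]; exists N.*2 => // n /= Nn; apply: NP => /=; lia.
have d0 : (fun N => series r N -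
    series (fun n => \sum_(k < n.+1) u k (n - k)%N) N) @ \oo --> 0.
  apply/norm_cvg0P; apply: (@squeeze_cvgr _ _ _ _ (cst 0)
    (fun N => a * (b - series B N./2) + b * (a - series A N./2))).
  - by near=> N; rewrite normr_ge0 /= bound.
  - exact: cvg_cst.
  have -> : 0 = a * (b - b) + b * (a - a) :> R by ring.
  apply: cvgD; apply: cvgMr; apply: cvgB; (try exact: cvg_cst);
    exact: (cvg_comp _ _ half).
rewrite -(subr0 l); set v := series _.
by rewrite (_ : v = fun N => series r N - (series r N - v N));
  [exact: cvgB|apply/funext => N; rewrite opprB addrC subrK].
Unshelve. all: by end_near. Qed.

Lemma cvg_series_Cauchy u v A B (l l' : R) :
  (forall n, `|u n| <= A n) -> (forall n, `|v n| <= B n) ->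
  cvgn (series A) -> cvgn (series B) ->
  series u @ \oo --> l -> series v @ \oo --> l' ->
  series (fun n => \sum_(k < n.+1) u k * v (n - k)%N) @ \oo --> l * l'.
Proof.
move=> uA vB cA cB ul vl.
apply: (@cvg_series_antidiagonal (fun k j => u k * v j) A B
  (fun k => u k * l')) => //.
- by move=> n; apply: le_trans (uA n).
- by move=> n; apply: le_trans (vB n).
- by move=> k j; rewrite normrM ler_pM.
- by move=> k; exact: cvg_seriesZ.
- rewrite mulrC; have := cvg_seriesZ (k := l') ul.
  by apply: eq_cvg_series => n; rewrite mulrC.
Qed.

Lemma cvg_series_expR (x : R) : series (fun n => x ^+ n / n`!%:R) @ \oo --> expR x.
Proof. by rewrite /expR; exact: is_cvg_series_exp_coeff. Qed.

End SeriesTools.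

(** * Gamma and beta integrals *)

Ltac nonneg := rewrite ?lee_fin;
  repeat first [exact: expR_ge0 | exact: powR_ge0 | exact: exprn_ge0
    | exact: ler0n | done | assumption | apply: ltW; assumption
    | apply: mulr_ge0 | apply: addr_ge0 | rewrite invr_ge0 | apply: exprn_ge0].

Section ChangeOfVariable.
Local Open Scope ereal_scope.
Context {R : realType}.
Local Notation mu := (@lebesgue_measure R).
Local Notation pos := (`]0%R, +oo[%classic : set R).

(** Uniqueness of Lebesgue measure: c times its push-forward along c x + b gives every half-open
    interval its length. *)
Lemma ge0_integral_affine (c b : R) (f : R -> \bar R) : (0 < c)%R ->
  measurable_fun [set: R] f -> (forall r, 0 <= f r) ->
  \int[mu]_x f x = c%:E * \int[mu]_x f (c * x + b)%R.
Proof.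
move=> c0 mf f0.
pose phi : measurableTypeR R -> measurableTypeR R := fun x => (c * x + b)%R.
have mphi : measurable_fun [set: measurableTypeR R] phi.
  by apply: measurable_funD => //; exact: measurable_funM.
pose cn := NngNum (ltW c0).
pose m0 : {measure set (measurableTypeR R) -> \bar R} :=
  mscale cn (pushforward mu phi).
pose m := m0 mphi.
have muE A : measurable A -> mu A = m A.
  apply: lebesgue_measure_unique => _ [[x y]] _ <-.
  have pre : phi @^-1` `]x, y]%classic = `]((x - b) / c)%R, ((y - b) / c)%R]%classic.
    apply/seteqP; split => z; rewrite /= !in_itv /= /phi ltr_pdivrMr// ler_pdivlMr//
      ltrBlDr lerBrDr [(z * c)%R]mulrC//.
  rewrite /= /mscale /= /pushforward pre !lebesgue_measure_itv/= !lte_fin.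
  rewrite ltr_pM2r ?invr_gt0// ltrD2r; case: ifPn => _; last by rewrite mule0.
  rewrite -!EFinD -EFinM; congr EFin.
  by field; rewrite gt_eqF.
rewrite (_ : \int[mu]_x f x = \int[m]_x f x); last first.
  by apply: eq_measure_integral => A mA _; exact: muE.
rewrite /m /m0 ge0_integral_mscale//=; congr (_ * _).
rewrite ge0_integral_pushforward//.
Qed.

Lemma ge0_integral_scale (c : R) (f : R -> \bar R) : (0 < c)%R ->
  measurable_fun pos f -> (forall r, (0 < r)%R -> 0 <= f r) ->
  \int[mu]_(x in pos) f x =
  c%:E * \int[mu]_(x in pos) f (c * x)%R.
Proof.
move=> c0 mf f0.
rewrite integral_mkcond (@ge0_integral_affine c 0)//; last 2 first.
- by apply/(measurable_restrictT f) => //.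
- by move=> r; rewrite erestrict_ge0// => x /=; rewrite in_itv/= andbT; exact: f0.
rewrite [in RHS]integral_mkcond; congr (_ * _); apply: eq_integral => x _.
rewrite /patch addr0; congr (if _ then _ else _).
by apply/idP/idP; rewrite !inE/= !in_itv/= !andbT pmulr_rgt0.
Qed.

End ChangeOfVariable.

(** * Gamma and beta integrals in the extended reals *)

Section GammaBeta.
Local Open Scope ereal_scope.
Context {R : realType}.
Implicit Types x y : R.
Local Notation mu := (@lebesgue_measure R).
Local Notation pos := (`]0%R, +oo[%classic : set R).

(** Extension by 0 turns the integrals into integrals over the whole line, where translations and
    dilations need no bookkeeping of domains. *)
Definition pos_powR (x t : R) : R := (t `^ (x - 1) * \1_pos t)%R.

Lemma pos_powR_ge0 x t : (0 <= pos_powR x t)%R.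
Proof. by rewrite mulr_ge0// powR_ge0. Qed.
#[local] Hint Resolve pos_powR_ge0 : core.

Lemma pos_powR_gt0E x t : (0 < t)%R -> pos_powR x t = (t `^ (x - 1))%R.
Proof.
by move=> t0; rewrite /pos_powR indicE mem_set ?mulr1//= in_itv/= andbT.
Qed.

Lemma pos_powR_le0E x t : (t <= 0)%R -> pos_powR x t = 0%R.
Proof.
move=> t0; rewrite /pos_powR indicE memNset ?mulr0//= in_itv/= andbT.
by apply/negP; rewrite -leNgt.
Qed.

Lemma measurable_pos_powR x : measurable_fun [set: R] (pos_powR x).
Proof.
apply: measurable_funM; first exact: measurable_powR.
exact: measurable_indic.
Qed.

(** Extended-real, so that Tonelli's theorem applies before finiteness is known; [egammaE] returns
    to [Gamma]. *)
Definition egamma x : \bar R := \int[mu]_(t in pos) (t `^ (x - 1) * expR (- t))%:E.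

Definition ebeta x y : \bar R := \int[mu]_t (pos_powR x t * pos_powR y (1 - t))%:E.

Lemma integral_pos_powR x (f : R -> R) :
  \int[mu]_(t in pos) (t `^ (x - 1) * f t)%:E = \int[mu]_t (pos_powR x t * f t)%:E.
Proof.
rewrite integral_mkcond; apply: eq_integral => t _.
rewrite /patch /pos_powR indicE; case: ifPn => _; last by rewrite mulr0 mul0r.
by rewrite mulr1.
Qed.

Lemma measurable_pos_powRM x (f : R -> R) : measurable_fun [set: R] f ->
  measurable_fun [set: R] (fun t => (pos_powR x t * f t)%:E).
Proof.
move=> mf; apply/measurable_EFinP; apply: measurable_funM => //.
exact: measurable_pos_powR.
Qed.

Lemma measurable_expRN : measurable_fun [set: R] (fun t : R => expR (- t)).
Proof. by apply: measurableT_comp => //; exact: measurable_expR. Qed.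

(** The double integral of s^(x-1) t^(y-1) exp(-(s + t)) is rewritten in r = s + t; the substitution
    s = r u then separates the powers of r from a beta integral in u. *)
Lemma egammaM x y : egamma x * egamma y = egamma (x + y) * ebeta x y.
Proof.
pose F (sr : R * R) : \bar R :=
  (pos_powR x sr.1 * pos_powR y (sr.2 - sr.1) * expR (- sr.2))%:E.
have F0 sr : 0 <= F sr.
  by rewrite /F; nonneg.
have mF : measurable_fun [set: R * R] F.
  apply/measurable_EFinP; apply: measurable_funM; first apply: measurable_funM.
  - by apply: measurableT_comp => //; exact: measurable_pos_powR.
  - apply: (measurableT_comp (measurable_pos_powR y)).
    by apply: measurable_funB => //; exact: measurable_snd.
  - apply: (measurableT_comp measurable_expRN); exact: measurable_snd.
have mexp := measurable_expRN.
have -> : egamma x * egamma y = \int[mu]_s \int[mu]_r F (s, r).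
  rewrite /egamma !integral_pos_powR -ge0_integralZr//; last 3 first.
  - exact: measurable_pos_powRM.
  - by move=> t _; nonneg.
  - by apply: integral_ge0 => t _; nonneg.
  apply: eq_integral => s _; rewrite -ge0_integralZl//; last 3 first.
  - exact: measurable_pos_powRM.
  - by move=> t _; nonneg.
  - by nonneg.
  under eq_integral do rewrite -EFinM.
  rewrite [LHS](@ge0_integral_affine _ 1 (- s))//; last 2 first.
  - apply/measurable_EFinP; apply: measurable_funM => //.
    by apply: measurable_funM => //; exact: measurable_pos_powR.
  - by move=> t; nonneg.
  rewrite mul1e; apply: eq_integral => r _.
  rewrite /F/= mul1r; congr EFin.
  have -> : expR (- r) = (expR (- s) * expR (- (r - s)))%R.
    by rewrite -expRD; congr expR; ring.
  ring.
rewrite (@fubini_tonelli _ _ _ _ _ mu mu F)//.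
rewrite /egamma integral_pos_powR -ge0_integralZr//; last 3 first.
- exact: measurable_pos_powRM.
- by move=> t _; nonneg.
- by apply: integral_ge0 => t _; nonneg.
apply: eq_integral => r _.
have [r0|r0] := leP r 0%R.
  rewrite (pos_powR_le0E _ r0) mul0r mul0e; apply: integral0_eq => s _.
  rewrite /F/=; have [s0|s0] := leP s 0%R; first by rewrite (pos_powR_le0E _ s0) !mul0r.
  by rewrite (pos_powR_le0E y (t := (r - s)%R)) ?mulr0 ?mul0r//; lra.
rewrite (@ge0_integral_affine _ r 0)//; last first.
  exact: (measurableT_comp mF (measurable_pair2 _)).
have pM z u : (pos_powR z (r * u) = r `^ (z - 1) * pos_powR z u)%R.
  have [u0|u0] := leP u 0%R.
    by rewrite !pos_powR_le0E ?mulr0// mulr_ge0_le0// ltW.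
  by rewrite !pos_powR_gt0E ?mulr_gt0// powRM// ltW.
transitivity (r%:E * \int[mu]_u ((r `^ (x - 1) * r `^ (y - 1) * expR (- r))%:E *
    (pos_powR x u * pos_powR y (1 - u))%:E)).
  congr (_ * _); apply: eq_integral => u _.
  rewrite /F/= addr0 -[X in (X - r * u)%R]mulr1 -mulrBr !pM -EFinM; congr EFin.
  ring.
rewrite ge0_integralZl//; last 3 first.
- apply/measurable_EFinP; apply: measurable_funM; first exact: measurable_pos_powR.
  apply: (measurableT_comp (measurable_pos_powR y)).
  exact: measurable_funB.
- by move=> t _; nonneg.
- by nonneg.
rewrite muleA -EFinM; congr (_%:E * _).
rewrite pos_powR_gt0E// mulrA mulrA; congr (_ * _)%R.
rewrite -{1}(@powRr1 _ r) ?ltW// -!powRD; last 2 first.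
- by apply/implyP => _; rewrite gt_eqF.
- by apply/implyP => _; rewrite gt_eqF.
by congr powR; ring.
Qed.

End GammaBeta.

(** * Functional equation, finiteness and positivity of Gamma *)

Section Egamma.
Local Open Scope ereal_scope.
Context {R : realType}.
Implicit Types x y : R.
Local Notation mu := (@lebesgue_measure R).
Local Notation pos := (`]0%R, +oo[%classic : set R).

Lemma egamma_ge0 x : 0 <= egamma x.
Proof. by apply: integral_ge0 => t _; nonneg. Qed.

Lemma egamma1 : egamma 1 = 1 :> \bar R.
Proof.
rewrite -(@integral_exponential_pdf R 1 ltr01) /egamma /exponential_pdf.
rewrite [RHS](_ : _ = \int[mu]_(t in `[0%R, +oo[) (1 * expR (- 1 * t))%:E); last first.
  by rewrite [RHS]integral_mkcond; apply: eq_integral => t _; rewrite /patch; case: ifP.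
rewrite -integral_itv_obnd_cbnd; last first.
  apply/measurable_EFinP; apply: measurable_funM => //.
  apply: measurableT_comp => //; exact: measurable_funM.
apply: eq_integral => t _ /=.
by rewrite subrr powRr0 !mul1r mulN1r.
Qed.

Lemma continuous_powR_gt0 x t : (0 < t)%R -> {for t, continuous (fun t : R => t `^ x)%R}.
Proof.
move=> t0; apply: differentiable_continuous; apply/derivable1_diffP.
by apply: derivable_powR; rewrite in_itv/= t0.
Qed.

Lemma integral_powR_segment x (c : R) : (0 < x)%R -> (0 < c)%R -> (c < 1)%R ->
  \int[mu]_(t in `[c, 1%R]) (t `^ (x - 1))%:E = ((1 - c `^ x) / x)%:E.
Proof.
move=> x0 c0 c1.
have xn0 : x != 0%R by rewrite gt_eqF.
have Fc t : (0 < t)%R -> {for t, continuous (fun t : R => x^-1 * t `^ x)%R}.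
  by move=> t0; apply: cvgMr; exact: continuous_powR_gt0.
rewrite (@continuous_FTC2 _ _ (fun t => x^-1 * t `^ x)%R)//.
- by rewrite powR1 -EFinB; congr EFin; field.
- apply: continuous_in_subspaceT => t; rewrite inE/= in_itv/= => /andP[ct _].
  by apply: continuous_powR_gt0; lra.
- split.
  + move=> t; rewrite in_itv/= => /andP[ct _].
    by apply: derivableM => //; apply: derivable_powR; rewrite in_itv/= andbT; lra.
  + by apply/cvg_at_right_filter; exact: Fc.
  + by apply/cvg_at_left_filter; exact: Fc.
- move=> t; rewrite in_itv/= => /andP[ct _].
  have t0 : (0 < t)%R by lra.
  rewrite derive1E deriveM//; last by apply: derivable_powR; rewrite in_itv/= t0.
  rewrite derive_cst scaler0 addr0 -derive1E powR_derive1 ?in_itv/= ?t0//.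
  by rewrite /GRing.scale/= mulrA mulVf// mul1r.
Qed.

(** With [egammaM] at y = 1 this replaces integration by parts in the functional equation. For x < 1
    the integrand is unbounded at 0, hence a cut-off and monotone convergence. *)
Lemma ebetax1 x : (0 < x)%R -> ebeta x 1 = (x^-1)%:E.
Proof.
move=> x0.
pose f t : R := (pos_powR x t * pos_powR 1 (1 - t))%R.
(* Starting at 1/2 keeps the cut-off strictly between 0 and 1, as [integral_powR_segment]
   requires. *)
pose c n : R := n.+2%:R^-1%R.
have c0 n : (0 < c n)%R by rewrite invr_gt0.
have c1 n : (c n < 1)%R by rewrite invf_lt1// ltr1n.
pose g n : R -> \bar R := (fun t => (t `^ (x - 1))%:E) \_ `[c n, 1%R[.
have gE n t : g n t = if (c n <= t < 1)%R then (t `^ (x - 1))%:E else 0.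
  rewrite /g /patch; congr (if _ then _ else _).
  by apply/idP/idP; rewrite inE/= in_itv.
have f01 t : (0 < t < 1)%R -> f t = (t `^ (x - 1))%R.
  case/andP=> t0 t1; rewrite /f !pos_powR_gt0E//; last by rewrite subr_gt0.
  by rewrite subrr powRr0 mulr1.
have fn01 t : ~~ (0 < t < 1)%R -> f t = 0%R.
  rewrite /f negb_and -!leNgt => /orP[t0|t1]; first by rewrite pos_powR_le0E ?mul0r.
  by rewrite (pos_powR_le0E 1) ?mulr0// subr_le0.
have c_cvg0 : c @ \oo --> 0%R.
  by have := @cvg_harmonic R; rewrite -(cvg_shiftn 1); under eq_fun do rewrite addn1.
have mg n : measurable_fun [set: R] (g n).
  apply/(measurable_restrictT _ _).1 => //; apply/measurable_EFinP.
  exact: measurable_funTS (measurable_powR _).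
have gcvg t : g ^~ t @ \oo --> (f t)%:E.
  have [/andP[t0 t1]|tn] := boolP (0 < t < 1)%R; last first.
    rewrite fn01//; apply: cvg_near_cst; near=> n; rewrite gE ifF//.
    apply/negP => /andP[h1 h2]; move/negP: tn; apply; rewrite h2 andbT.
    exact: lt_le_trans h1.
  apply: cvg_near_cst; near=> n; rewrite gE t1 andbT ifT ?f01 ?t0//.
  by near: n; apply: (cvgr_le _ c_cvg0).
have ig n : \int[mu]_t g n t = ((1 - c n `^ x) / x)%:E.
  rewrite -integral_mkcond integral_itv_bndo_bndc; first exact: integral_powR_segment.
  apply/measurable_EFinP; exact: measurable_funTS (measurable_powR _).
have : \int[mu]_t g n t @[n --> \oo] --> \int[mu]_t (limn (g ^~ t)).
  apply: cvg_monotone_convergence => //.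
  - by move=> n t _; rewrite gE; case: ifP => // _; nonneg.
  - move=> t _ m n mn; rewrite !gE; case: ifP => [/andP[cm t1]|_]; last first.
      by case: ifP => // _; nonneg.
    rewrite t1 andbT ifT// (le_trans _ cm)// lef_pV2 ?posrE//.
    by rewrite ler_nat.
have -> : \int[mu]_t (limn (g ^~ t)) = ebeta x 1.
  by apply: eq_integral => t _; apply/cvg_lim => //; exact: gcvg.
under eq_cvg do rewrite ig.
move=> h; apply/esym; apply: (cvg_unique _ _ h) => //.
suff cx : ((1 - c n `^ x) / x)%R @[n --> \oo] --> x^-1%R.
  by apply: cvg_EFin; [near=> n|exact: cx].
rewrite [X in _ --> X](_ : _ = (1 - 0) / x)%R; last by rewrite subr0 div1r.
apply: cvgMl; apply: cvgB; first exact: cvg_cst.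
apply: cvg_comp (powR_cvg0 x0) => A /= hA.
by have [N _ HN] := c_cvg0 _ hA; exists N => // n Nn; apply: (HN n Nn); exact: c0.
Unshelve. all: by end_near. Qed.

Lemma egammaD1 x : (0 < x)%R -> egamma (x + 1) = x%:E * egamma x.
Proof.
move=> x0; rewrite -[X in x%:E * X]mule1 -egamma1 egammaM ebetax1// muleCA -EFinM.
by rewrite divff ?mule1// gt_eqF.
Qed.

Lemma egamma_nat n : egamma n.+1%:R = n`!%:R%:E :> \bar R.
Proof.
elim: n => [|n IH]; first by rewrite egamma1.
rewrite -natr1 egammaD1// IH -EFinM factS natrM//.
Qed.

(** For y >= 1 the integrand is at most (1 + t^n) exp(-t) with an integer n >= y - 1, and the two
    parts integrate to 1 and n!. The functional equation then carries finiteness from x + 1 back to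
    x. *)
Lemma egamma_fin_num x : (0 < x)%R -> egamma x \is a fin_num.
Proof.
have ge1 y : (1 <= y)%R -> egamma y \is a fin_num.
  move=> y1; pose n := Num.truncn y.
  have yn : (y <= n.+1%:R)%R by rewrite ltW// truncnS_gt.
  rewrite ge0_fin_numE ?egamma_ge0//.
  apply: (@le_lt_trans _ _ (egamma 1 + egamma n.+1%:R)); last first.
    by rewrite egamma1 egamma_nat -EFinD ltry.
  have m z : measurable_fun pos (fun t => (t `^ (z - 1) * expR (- t))%:E : \bar R).
    apply/measurable_EFinP; apply: measurable_funTS; apply: measurable_funM.
      exact: measurable_powR.
    exact: measurable_expRN.
  rewrite /egamma -ge0_integralD//; try (by move=> t _; nonneg); try exact: m.
  apply: ge0_le_integral => //; try (by move=> t _; nonneg); try exact: m.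
    exact: emeasurable_funD (m _) (m _).
  move=> t; rewrite /= in_itv/= andbT => t0; rewrite -EFinD lee_fin -mulrDl.
  apply: ler_wpM2r; first exact: expR_ge0.
  rewrite subrr powRr0; have [t1|t1] := leP t 1%R.
    apply: ler_wpDr; first exact: powR_ge0.
    have : (t `^ (y - 1) <= t `^ 0)%R by apply: ger_powR; rewrite ?t0// subr_ge0.
    by rewrite powRr0.
  by apply: ler_wpDl => //; apply: ler_powR; rewrite ?lerD2r// ltW.
move=> x0; have := ge1 (x + 1)%R; rewrite egammaD1//.
have xn0 : (x != 0)%R by rewrite gt_eqF.
case: (egamma x) (egamma_ge0 x) => [r _ _//|_|//].
rewrite gt0_muley ?lte_fin// => h; have /h// : (1 <= x + 1)%R by lra.
Qed.

Lemma egammaE x : (0 < x)%R -> egamma x = (Gamma x)%:E.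
Proof. by move=> x0; rewrite -[LHS]fineK// egamma_fin_num. Qed.

Lemma Gamma_gt0 x : (0 < x)%R -> (0 < Gamma x)%R.
Proof.
move=> x0; rewrite -lte_fin -egammaE//.
(* On ]1, 2[ the integrand is at least t^(-1) exp(-t) >= exp(-2) / 2, since x - 1 > -1. *)
have k0 : (0 < 2^-1 * expR (- 2) :> R)%R by rewrite mulr_gt0// expR_gt0.
apply: (@lt_le_trans _ _ (\int[mu]_(t in `]1%R, 2%R[) (2^-1 * expR (- 2))%:E)).
  rewrite integral_cst//= lebesgue_measure_itv/= lte_fin ltr1n -EFinB -EFinM lte_fin.
  by rewrite mulr_gt0//; lra.
have m : measurable_fun [set: R] (fun t : R => (t `^ (x - 1) * expR (- t))%:E).
  apply/measurable_EFinP; apply: measurable_funM; first exact: measurable_powR.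
  exact: measurable_expRN.
apply: (@le_trans _ _ (\int[mu]_(t in `]1%R, 2%R[) (t `^ (x - 1) * expR (- t))%:E)).
  apply: ge0_le_integral => //; try (by move=> t _; nonneg).
    exact: measurable_funTS.
  move=> t; rewrite /= in_itv/= => /andP[t1 t2]; rewrite lee_fin.
  apply: ler_pM; [by []|exact: expR_ge0| |by rewrite ler_expR lerN2 ltW].
  apply: (@le_trans _ _ (t `^ (- 1)))%R; last by rewrite ler_powR ?ltW//; lra.
  rewrite powR_inv1; last by lra.
  by rewrite lef_pV2 ?posrE//; lra.
apply: ge0_subset_integral => //; try (by move=> t _; nonneg).
  exact: measurable_funTS.
by move=> t; rewrite /= !in_itv/= andbT => /andP[? _]; lra.
Qed.

Lemma GammaD1 x : (0 < x)%R -> (Gamma (x + 1) = x * Gamma x)%R.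
Proof.
move=> x0; apply: EFin_inj; rewrite EFinM -!egammaE ?egammaD1//; lra.
Qed.

Lemma GammaDn x n : (0 < x)%R -> (Gamma (x + n%:R) = Gamma x * pochhammer x n)%R.
Proof.
move=> x0; elim: n => [|n IH]; first by rewrite addr0 poch0 mulr1.
rewrite -natr1 addrA GammaD1 ?IH ?pochSr; last by rewrite ltr_wpDr.
ring.
Qed.

Lemma integral_Gamma_scale x (c : R) : (0 < x)%R -> (0 < c)%R ->
  \int[mu]_(t in pos) (t `^ (x - 1) * expR (- (c * t)))%:E
  = (Gamma x * c `^ (- x))%:E.
Proof.
move=> x0 c0; rewrite EFinM -egammaE// /egamma.
rewrite [X in _ = X * _](@ge0_integral_scale _ c)//; last 2 first.
- apply/measurable_EFinP; apply: measurable_funTS; apply: measurable_funM.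
    exact: measurable_powR.
  exact: measurable_expRN.
- by move=> t _; nonneg.
rewrite muleAC -EFinM -ge0_integralZl//; last 3 first.
- apply/measurable_EFinP; apply: measurable_funTS; apply: measurable_funM.
    by apply: (measurableT_comp (measurable_powR (x - 1))); exact: measurable_funM.
  apply: (measurableT_comp measurable_expRN); exact: measurable_funM.
- by move=> t _; nonneg.
- by rewrite lee_fin mulr_ge0// ?powR_ge0// ltW.
apply: eq_integral => t; rewrite inE/= in_itv/= andbT => t0.
rewrite -EFinM powRM ?ltW// powRN; congr EFin.
have -> : (c `^ (x - 1) = c `^ x / c)%R.
  have cn0 : c != 0%R by rewrite gt_eqF.
  by rewrite powRB ?cn0 ?implybT// powRr1// ltW.
by field; rewrite gt_eqF//= gt_eqF// powR_gt0.
Qed.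

Lemma integral_Beta x y : (0 < x)%R -> (0 < y)%R ->
  \int[mu]_(t in `]0%R, 1%R[) (t `^ (x - 1) * (1 - t) `^ (y - 1))%:E
  = (Gamma x * Gamma y / Gamma (x + y))%:E.
Proof.
move=> x0 y0.
have xy0 : (0 < x + y)%R by rewrite addr_gt0.
have -> : \int[mu]_(t in `]0%R, 1%R[) (t `^ (x - 1) * (1 - t) `^ (y - 1))%:E =
    ebeta x y.
  rewrite integral_mkcond; apply: eq_integral => t _; rewrite /patch.
  case: ifPn; rewrite ?notin_setE ?inE/= in_itv/=.
    by move=> /andP[t0 t1]; rewrite !pos_powR_gt0E// subr_gt0.
  move=> /negP; rewrite negb_and -!leNgt => /orP[t0|t1].
    by rewrite pos_powR_le0E ?mul0r.
  by rewrite (@pos_powR_le0E _ y) ?mulr0// subr_le0.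
have := egammaM x y; rewrite !egammaE// => h.
have G0 : (Gamma (x + y) != 0)%R by rewrite gt_eqF// Gamma_gt0.
apply/esym; rewrite EFinM EFinM h muleAC -EFinM divff// mul1e//.
Qed.

End Egamma.

(** * Termwise integration and Gauss's summation theorem *)

Section SumIntegral.
Local Open Scope ereal_scope.
Context (d : measure_display) (T : measurableType d) (R : realType).

Lemma cvgn_EFin (u : nat -> R) (l : R) :
  u @ \oo --> l -> (fun n => (u n)%:E) @ \oo --> l%:E.
Proof. by move=> ul; apply: cvg_EFin => //; near=> n. Unshelve. all: by end_near. Qed.

Lemma cvg_eseries_EFin (u : nat -> R) (l : R) :
  series u @ \oo --> l -> (fun n => \sum_(0 <= k < n) (u k)%:E) @ \oo --> l%:E.
Proof.
by move=> /cvgn_EFin; under eq_fun do rewrite /series /= -sumEFin.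
Qed.

Lemma eseries_EFin (u : nat -> R) (l : R) :
  series u @ \oo --> l -> \sum_(n <oo) (u n)%:E = l%:E.
Proof. by move=> /cvg_eseries_EFin ul; apply/cvg_lim. Qed.

Context (mu : {measure set T -> \bar R}) (D : set T) (mD : measurable D).
Context (f : nat -> T -> R) (F : T -> R) (mf : forall n, measurable_fun D (f n)).
Context (fF : forall x, D x -> series (f ^~ x) @ \oo --> F x).

Lemma cvg_series_integral_ge0 (I : nat -> R) (l : R) :
  (forall n x, D x -> (0 <= f n x)%R) ->
  (forall n, \int[mu]_(x in D) (f n x)%:E = (I n)%:E) ->
  \int[mu]_(x in D) (F x)%:E = l%:E ->
  series I @ \oo --> l.
Proof.
move=> f0 fI Fl.
have mEf n : measurable_fun D (fun x => (f n x)%:E) by exact/measurable_EFinP.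
have h : \sum_(n <oo) (I n)%:E = l%:E.
  rewrite -Fl; under [RHS]eq_integral => x /set_mem Dx
    do rewrite -(eseries_EFin (fF Dx)).
  rewrite integral_nneseries//.
  by apply: eq_eseriesr => n _; rewrite fI.
have I0 n : 0 <= (I n)%:E.
  by rewrite -fI; apply: integral_ge0 => x Dx; rewrite lee_fin f0.
have : (fun n => \sum_(0 <= k < n) (I k)%:E) @ \oo --> l%:E.
  by rewrite -h; apply: is_cvg_nneseries => n _ _; exact: I0.
move=> /fine_cvg; apply: cvg_trans; apply: near_eq_cvg.
by near=> n; rewrite /= sumEFin.
Unshelve. all: by end_near. Qed.

(** Dominated convergence for the partial sums; the majorant is the sum of the |f n|, whose integral
    is at most the sum of the B n. *)
Lemma cvg_series_integral (B : nat -> R) :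
  (forall n, \int[mu]_(x in D) (`|f n x|%R)%:E <= (B n)%:E) ->
  cvgn (series B) ->
  mu.-integrable D (EFin \o F) /\
  series (fun n => (\int[mu]_(x in D) f n x)%R) @ \oo --> (\int[mu]_(x in D) F x)%R.
Proof.
move=> fB /cvg_ex[/= b Bb].
have mEf n : measurable_fun D (fun x => (f n x)%:E) by exact/measurable_EFinP.
have mnf n : measurable_fun D (fun x => (`|f n x|%R)%:E).
  by apply/measurable_EFinP; apply: measurableT_comp.
have intf n : mu.-integrable D (EFin \o f n).
  apply/integrableP; split; first exact: mEf.
  exact: le_lt_trans (fB n) (ltry _).
pose g x := \sum_(n <oo) (`|f n x|%R)%:E.
have g0 x : 0 <= g x by apply: nneseries_ge0 => k _ _; rewrite lee_fin.
have mg : measurable_fun D g.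
  by apply: ge0_emeasurable_sum => // n x Dx _; rewrite lee_fin.
have ig : mu.-integrable D g.
  apply/integrableP; split => //.
  under eq_integral => x _ do rewrite gee0_abs//.
  rewrite integral_nneseries//.
  apply: (@le_lt_trans _ _ (\sum_(n <oo) (B n)%:E)).
    apply: lee_nneseries => [n _ _|n _]; last exact: fB.
    by apply: integral_ge0 => x _; rewrite lee_fin.
  by rewrite (eseries_EFin Bb) ltry.
pose S n x : \bar R := \sum_(0 <= k < n) (f k x)%:E.
have mS n : measurable_fun D (S n) by exact: emeasurable_sum.
have SF x : D x -> S ^~ x @ \oo --> (F x)%:E.
  by move=> Dx; exact: cvg_eseries_EFin (fF Dx).
have mF : measurable_fun D (EFin \o F) by exact: (emeasurable_fun_cvg S).
have Sg n x : `|S n x| <= g x.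
  apply: le_trans (lee_abs_sum _ _ _) _.
  by apply: nneseries_lim_ge => k _ _; rewrite lee_fin.
have [iF _ cF] := @dominated_convergence _ _ _ mu D mD S (EFin \o F) g mS mF
  (aeW _ SF) ig (aeW _ (fun x n _ => Sg n x)).
split => //.
have FE : \int[mu]_(x in D) (EFin \o F) x = (\int[mu]_(x in D) F x)%R%:E.
  by rewrite fineK//; exact: integrable_fin_num.
have := cF; rewrite FE => /fine_cvg; apply: cvg_trans; apply: near_eq_cvg.
near=> n; rewrite /= /S integral_sum// /series /= /Rintegral sum_fine// => k _.
by apply: integrable_fin_num => //; exact: intf.
Unshelve. all: by end_near. Qed.

End SumIntegral.

(** * The binomial series and Gauss's summation theorem *)

Section GaussSummation.
Context {R : realType}.
Implicit Types a b t : R.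
Local Notation mu := (@lebesgue_measure R).
Local Notation pos := (`]0%R, +oo[%classic : set R).
Local Notation unitI := (`]0%R, 1%R[%classic : set R).

Lemma measurable_powR_expR (D : set R) (x c : R) :
  measurable_fun D (fun t => t `^ x * expR (- (c * t))).
Proof.
apply: measurable_funTS; apply: measurable_funM; first exact: measurable_powR.
by apply: (measurableT_comp measurable_expRN); exact: measurable_funM.
Qed.

Lemma measurable_powR_powR1B (D : set R) (x y : R) :
  measurable_fun D (fun t => t `^ x * (1 - t) `^ y).
Proof.
apply: measurable_funTS; apply: measurable_funM; first exact: measurable_powR.
by apply: (measurableT_comp (measurable_powR y)); exact: measurable_funB.
Qed.

Lemma powRDn (x : R) t n : 0 < t -> t `^ (x + n%:R - 1) = t `^ (x - 1) * t ^+ n.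
Proof.
move=> t0; have tn0 : t != 0 by rewrite gt_eqF.
by rewrite -powR_mulrn ?ltW// -powRD ?tn0 ?implybT// addrAC.
Qed.

Lemma ge0_integralZl_fin (D : set R) (k : R) (f : R -> R) (l : R) :
  measurable D -> measurable_fun D f -> 0 <= k -> (forall t, D t -> 0 <= f t) ->
  (\int[mu]_(t in D) (f t)%:E = l%:E)%E ->
  (\int[mu]_(t in D) (k * f t)%:E = (k * l)%:E)%E.
Proof.
move=> mD mf k0 f0 fl; under eq_integral do rewrite EFinM.
rewrite ge0_integralZl//; first by rewrite fl.
exact/measurable_EFinP.
Qed.

(** Expand exp(t v) inside the gamma integral representing (1 - t)^(-a). All terms are nonnegative,
    so monotone convergence suffices. *)
Lemma cvg_binomial_series a t : 0 < a -> 0 <= t < 1 ->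
  series (fun k => pochhammer a k / k`!%:R * t ^+ k) @ \oo --> (1 - t) `^ (- a).
Proof.
move=> a0 /andP[t0 t1].
have Ga : 0 < Gamma a by exact: Gamma_gt0.
pose f k v := (Gamma a)^-1 * (t ^+ k / k`!%:R) *
  (v `^ (a + k%:R - 1) * expR (- (1 * v))).
pose F v := (Gamma a)^-1 * (v `^ (a - 1) * expR (- ((1 - t) * v))).
apply: (@cvg_series_integral_ge0 _ _ R mu pos _ f F).
- by [].
- by move=> k; apply: measurable_funM => //; exact: measurable_powR_expR.
- move=> v; rewrite /= in_itv/= andbT => v0.
  have := cvg_seriesZ (k := (Gamma a)^-1 * (v `^ (a - 1) * expR (- v)))
    (cvg_series_expR (x := t * v)).
  have -> : F v = (Gamma a)^-1 * (v `^ (a - 1) * expR (- v)) * expR (t * v).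
    rewrite /F -!mulrA -expRD; congr (_ * (_ * expR _)); ring.
  apply: eq_cvg_series => k; rewrite /f mul1r powRDn// exprMn; ring.
- by move=> k v _; rewrite /f; nonneg.
- move=> k; have ak : 0 < a + k%:R by rewrite ltr_wpDr.
  rewrite (_ : _ * t ^+ k = (Gamma a)^-1 * (t ^+ k / k`!%:R) *
    (Gamma (a + k%:R) * 1 `^ (- (a + k%:R)))).
    apply: ge0_integralZl_fin => //; last exact: integral_Gamma_scale.
    + exact: measurable_powR_expR.
    + by nonneg.
    + by move=> v _; nonneg.
  rewrite powR1 mulr1 GammaDn//; field.
  by rewrite gt_eqF//= gt_eqF// ltr0n fact_gt0.
- have Gan : Gamma a != 0 by rewrite gt_eqF.
  rewrite -[_ `^ _](mulKf Gan).
  apply: ge0_integralZl_fin => //.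
  + exact: measurable_powR_expR.
  + by rewrite invr_ge0 ltW.
  + by move=> v _; nonneg.
  + by apply: integral_Gamma_scale => //; rewrite subr_gt0.
Qed.

(* The series is that of (1 - t)^(-a) integrated against a beta density. *)
Lemma cvg_Gauss_series a b (P : R) : 0 < a -> 0 < b -> a + b < P ->
  series (fun k => pochhammer a k * pochhammer b k / (k`!%:R * Gamma (P + k%:R))) @ \oo
    --> Gamma (P - a - b) / (Gamma (P - a) * Gamma (P - b)).
Proof.
move=> a0 b0 abP.
have Pb : 0 < P - b by lra.
have Pab : 0 < P - a - b by lra.
have Pa : 0 < P - a by lra.
have P0 : 0 < P by lra.
pose C := (Gamma b * Gamma (P - b))^-1.
have C0 : 0 <= C by rewrite invr_ge0; apply/ltW/mulr_gt0; exact: Gamma_gt0.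
pose f k t := C * (pochhammer a k / k`!%:R) *
  (t `^ (b + k%:R - 1) * (1 - t) `^ (P - b - 1)).
pose F t := C * (t `^ (b - 1) * (1 - t) `^ (P - a - b - 1)).
have pa k : 0 <= pochhammer a k / k`!%:R by rewrite divr_ge0// poch_ge0// ltW.
apply: (@cvg_series_integral_ge0 _ _ R mu unitI _ f F).
- by [].
- by move=> k; apply: measurable_funM => //; exact: measurable_powR_powR1B.
- move=> t; rewrite /= in_itv/= => /andP[t0 t1].
  have := cvg_seriesZ (k := C * (t `^ (b - 1) * (1 - t) `^ (P - b - 1)))
    (@cvg_binomial_series a t a0 _); rewrite ltW// => /(_ t1).
  have -> : F t = C * (t `^ (b - 1) * (1 - t) `^ (P - b - 1)) * (1 - t) `^ (- a).
    rewrite /F -!mulrA -powRD; first by congr (_ * (_ * _ `^ _)); ring.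
    by apply/implyP => _; rewrite gt_eqF// subr_gt0.
  apply: eq_cvg_series => k; rewrite /f powRDn//; ring.
- by move=> k t _; rewrite /f; nonneg.
- move=> k; have bk : 0 < b + k%:R by rewrite ltr_wpDr.
  have Pk : 0 < P + k%:R by rewrite ltr_wpDr.
  rewrite (_ : _ / _ = C * (pochhammer a k / k`!%:R) *
      (Gamma (b + k%:R) * Gamma (P - b) / Gamma (b + k%:R + (P - b)))).
    apply: ge0_integralZl_fin => //; last exact: integral_Beta.
    + exact: measurable_powR_powR1B.
    + by rewrite mulr_ge0.
    + by move=> t _; nonneg.
  rewrite (_ : b + k%:R + (P - b) = P + k%:R); last by ring.
  rewrite (@GammaDn _ b k)// /C.
  have kn : k`!%:R != 0 :> R by rewrite pnatr_eq0 -lt0n fact_gt0.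
  move: (lt0r_neq0 (Gamma_gt0 b0)) (lt0r_neq0 (Gamma_gt0 Pb)) (lt0r_neq0 (Gamma_gt0 Pk)).
  move: (Gamma b) (Gamma (P - b)) (Gamma (P + k%:R)) => x y z h1 h2 h3.
  by field; rewrite h1 h2 h3 kn.
- rewrite (_ : _ / _ = C * (Gamma b * Gamma (P - a - b) / Gamma (b + (P - a - b)))).
    apply: ge0_integralZl_fin => //; last exact: integral_Beta.
    + exact: measurable_powR_powR1B.
    + by move=> t _; nonneg.
  rewrite (_ : b + (P - a - b) = P - a); last by ring.
  rewrite /C; move: (lt0r_neq0 (Gamma_gt0 b0)) (lt0r_neq0 (Gamma_gt0 Pb)).
  move: (lt0r_neq0 (Gamma_gt0 Pa)).
  move: (Gamma b) (Gamma (P - b)) (Gamma (P - a)) => x y z h1 h2 h3.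
  by field; rewrite h1 h2 h3.
Qed.

End GaussSummation.

(** * Hypergeometric series *)

Section EntireSeries.
Context {R : realType}.
Implicit Types (d x z : R) (m n k : nat).
Local Notation poch := (@pochhammer R).

Lemma is_cvg_exp_majorant (K z : R) :
  cvgn (series (fun n => K * (z ^+ n / n`!%:R))).
Proof.
by apply/cvg_ex; eexists; apply: cvg_seriesZ; exact: (cvg_series_expR (x := z)).
Qed.

(** The sign is built in: this is 0F1(; d; -z), so for z = r^2 with r > 0 it equals Gamma(d) r^(1-d)
    J_(d-1)(2 r). The same convention holds for [hyp1F2]. *)
Definition hyp0F1 d z : R :=
  limn (series (fun m => (- z) ^+ m / (m`!%:R * poch d m))).

Definition hyp1F2 al be ga z : R :=
  limn (series (fun m => poch al m * (- z) ^+ m / (m`!%:R * poch be m * poch ga m))).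

Lemma poch_inv_le d m : 0 < d -> (poch d m)^-1 <= (Num.min 1 d)^-1.
Proof.
move=> d0; rewrite lef_pV2 ?posrE ?poch_gt0//; first exact: poch_ge_min.
by rewrite lt_min ltr01.
Qed.

Lemma hyp0F1_term_le d z m : 0 < d ->
  `|(- z) ^+ m / (m`!%:R * poch d m)| <= (Num.min 1 d)^-1 * (`|z| ^+ m / m`!%:R).
Proof.
move=> d0; rewrite normrM normfV normrX normrN normrM (ger0_norm (x := poch d m));
  last by rewrite ltW// poch_gt0.
rewrite normr_nat invfM mulrA [leRHS]mulrC.
by apply: ler_wpM2l; [nonneg|exact: poch_inv_le].
Qed.

Lemma cvg_hyp0F1 d z : 0 < d ->
  series (fun m => (- z) ^+ m / (m`!%:R * poch d m)) @ \oo --> hyp0F1 d z.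
Proof.
move=> d0; pose u m := (- z) ^+ m / (m`!%:R * poch d m).
have cu : cvgn (series u).
  exact: (@is_cvg_series_dom _ u _ (fun m => @hyp0F1_term_le d z m d0)
    (@is_cvg_exp_majorant _ _)).
exact: cu.
Qed.

(** The hypothesis al <= be bounds (al)_m / (be)_m by 1, and what remains is a term of a 0F1. *)
Lemma hyp1F2_term_le al be ga z m : 0 < al <= be -> 0 < ga ->
  `|poch al m * (- z) ^+ m / (m`!%:R * poch be m * poch ga m)| <=
  (Num.min 1 ga)^-1 * (`|z| ^+ m / m`!%:R).
Proof.
move=> /andP[al0 albe] ga0; have be0 : 0 < be by exact: lt_le_trans albe.
rewrite normrM normfV normrM normrX normrN.
rewrite !normrM normr_nat !(ger0_norm (ltW (poch_gt0 _ _)))//.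
have -> : poch al m * `|z| ^+ m / (m`!%:R * poch be m * poch ga m) =
    (poch al m / poch be m) * ((poch ga m)^-1 * (`|z| ^+ m / m`!%:R)).
  by field; rewrite !gt_eqF ?poch_gt0// ltr0n fact_gt0.
rewrite -[leRHS]mul1r; apply: ler_pM.
- by rewrite divr_ge0// ltW// poch_gt0.
- by rewrite mulr_ge0// ?invr_ge0 ?(ltW (poch_gt0 _ _))//; nonneg.
- by rewrite ler_pdivrMr ?poch_gt0// mul1r ler_poch// ltW.
- by apply: ler_wpM2r; [nonneg|exact: poch_inv_le].
Qed.

Lemma cvg_hyp1F2 al be ga z : 0 < al <= be -> 0 < ga ->
  series (fun m => poch al m * (- z) ^+ m / (m`!%:R * poch be m * poch ga m)) @ \oo
  --> hyp1F2 al be ga z.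
Proof.
move=> ab ga0; pose u m := poch al m * (- z) ^+ m / (m`!%:R * poch be m * poch ga m).
have cu : cvgn (series u).
  exact: (@is_cvg_series_dom _ u _ (fun m => @hyp1F2_term_le al be ga z m ab ga0)
    (@is_cvg_exp_majorant _ _)).
exact: cu.
Qed.

Lemma poch_oppn n k : poch (- n%:R) k = (-1) ^+ k * (n ^_ k)%:R.
Proof.
elim: k => [|k IH]; first by rewrite poch0 expr0 mulr1.
rewrite pochSr IH ffactnSr natrM exprS.
have [nk|kn] := ltnP n k; first by rewrite ffact_small// !(mulr0, mul0r).
by rewrite natrB//; ring.
Qed.

Lemma poch_shift d k m : (k <= m)%N -> 0 < d ->
  poch d m / poch d k = (-1) ^+ (m - k) * poch (1 - d - m%:R) (m - k).
Proof.
move=> km d0; rewrite -{1}(subnKC km) pochD mulrAC divff ?mul1r ?poch_neq0//.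
rewrite poch_rev; congr (_ * poch _ _).
rewrite natrB//; ring.
Qed.

(** Kummer's transformation 1F1(d + n; d; x) = exp(x) 1F1(-n; d; -x), whose last factor is a
    polynomial. The Cauchy product matches by Chu-Vandermonde, because (d + n)_m is up to sign the
    symbol of -n + (1 - d - m). *)
Lemma cvg_Kummer d x n : 0 < d ->
  series (fun m => x ^+ m * poch (d + n%:R) m / (m`!%:R * poch d m)) @ \oo -->
  (\sum_(k < n.+1) 'C(n, k)%:R * x ^+ k / poch d k) * expR x.
Proof.
move=> d0; pose u k : R := 'C(n, k)%:R * x ^+ k / poch d k.
have ufin (f : nat -> R) : (forall k, (n < k)%N -> f k = 0) ->
    series f @ \oo --> \sum_(k < n.+1) f k.
  move=> f0; apply: cvg_near_cst; near=> N.
  have nN : (n.+1 <= N)%N by near: N; exact: nbhs_infty_ge.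
  rewrite /series /= (big_cat_nat (n := n.+1))//= big_mkord.
  rewrite [X in _ + X]big_nat [X in _ + X]big1 ?addr0// => k /andP[nk _].
  exact: f0.
have u0 k : (n < k)%N -> u k = 0 by move=> nk; rewrite /u bin_small// !mul0r.
have cu : cvgn (series (fun k => `|u k|)).
  apply/cvg_ex; eexists; apply: (ufin (fun k => `|u k|)) => k nk.
  by rewrite u0// normr0.
have cv := @is_cvg_exp_majorant 1 `|x|.
have vle k : `|x ^+ k / k`!%:R| <= 1 * (`|x| ^+ k / k`!%:R).
  by rewrite mul1r normrM normfV normrX normr_nat.
have := cvg_series_Cauchy (fun n => lexx _) vle cu cv (ufin u u0)
  (cvg_series_expR (x := x)).
apply: eq_cvg_series => m.
have -> : x ^+ m * poch (d + n%:R) m / (m`!%:R * poch d m) =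
    x ^+ m / (m`!%:R * poch d m) * poch (d + n%:R) m by ring.
rewrite (poch_rev (d + n%:R) m).
have -> : 1 - (d + n%:R) - m%:R = - n%:R + (1 - d - m%:R) by ring.
rewrite -poch_vandermonde !mulr_sumr; apply: eq_bigr => k _.
have km : (k <= m)%N by rewrite -ltnS.
have := poch_shift km d0; set p := poch _ (m - k) => pE.
have pk0 := poch_neq0 k d0; have pm0 := poch_neq0 m d0.
have -> : p = (-1) ^+ (m - k) * (poch d m / poch d k).
  by rewrite pE mulrA -exprD addnn -signr_odd odd_double mul1r.
rewrite poch_oppn /u.
have s1 i : (-1) ^+ i * (-1) ^+ i = 1 :> R.
  by rewrite -exprD addnn -signr_odd odd_double.
have sm : (-1) ^+ m = (-1) ^+ k * (-1) ^+ (m - k) :> R by rewrite -exprD subnKC.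
have xm : x ^+ m = x ^+ k * x ^+ (m - k) by rewrite -exprD subnKC.
have mf : m`!%:R = 'C(m, k)%:R * (k`!%:R * (m - k)`!%:R) :> R.
  by rewrite -!natrM bin_fact.
have nk : (n ^_ k)%:R = 'C(n, k)%:R * k`!%:R :> R by rewrite -natrM bin_ffact.
have f1 : 'C(m, k)%:R != 0 :> R by rewrite pnatr_eq0 -lt0n bin_gt0.
have f2 : k`!%:R != 0 :> R by rewrite pnatr_eq0 -lt0n fact_gt0.
have f3 : (m - k)`!%:R != 0 :> R by rewrite pnatr_eq0 -lt0n fact_gt0.
rewrite sm xm mf nk.
move: (s1 k) (s1 (m - k)%N); set a := (-1) ^+ k; set b := (-1) ^+ (m - k) => a1 b1.
transitivity ((a * a) * (b * b) * ('C(n, k)%:R * x ^+ k / poch d k *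
  (x ^+ (m - k) / (m - k)`!%:R))); first by rewrite a1 b1 !mul1r.
by field; rewrite f1 f2 f3 pk0 pm0.
Unshelve. all: by end_near. Qed.

End EntireSeries.

(** * Comparison of 1F2 with a square of a Bessel function *)

Section WellPoisedSums.
Context {R : realType}.
Implicit Types (a b c nu : R) (m n k : nat).
Local Notation poch := (@pochhammer R).

Lemma ffact_natr n k : (n ^_ k.+1)%:R = (n ^_ k)%:R * (n%:R - k%:R) :> R.
Proof.
rewrite ffactnSr natrM; have [nk|kn] := ltnP n k; last by rewrite natrB.
by rewrite ffact_small// !mul0r.
Qed.

Lemma ffactSS_natr n k : (n.+1 ^_ k.+1)%:R = (n%:R + 1) * (n ^_ k)%:R :> R.
Proof. by rewrite ffactSS natrM natr1. Qed.

(* The terminating 5F4 summation of Dougall, by the Wilf-Zeilberger method: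
   [H] is the certificate, it telescopes the recurrence in [m]. *)
Lemma sum_5F4 a b c m : 0 < a -> b < 1 + a -> c < 1 + a ->
  \sum_(n < m.+1) (-1) ^+ n * (m ^_ n)%:R / n`!%:R * (a + 2 * n%:R) *
    (poch a n * poch b n * poch c n /
      (poch (1 + a - b) n * poch (1 + a - c) n * poch a (m + n).+1))
  = poch (1 + a - b - c) m / (poch (1 + a - b) m * poch (1 + a - c) m).
Proof.
move=> a0 ba ca.
pose T m n : R := (-1) ^+ n * (m ^_ n)%:R / n`!%:R * (a + 2 * n%:R) *
    (poch a n * poch b n * poch c n /
      (poch (1 + a - b) n * poch (1 + a - c) n * poch a (m + n).+1)).
pose H m n : R := (-1) ^+ n * (m ^_ n)%:R / n`!%:R *
    (poch a n.+1 * poch b n.+1 * poch c n.+1 /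
      (poch (1 + a - b) n * poch (1 + a - c) n * poch a (m + n).+2)).
have ab0 : 0 < 1 + a - b by rewrite subr_gt0.
have ac0 : 0 < 1 + a - c by rewrite subr_gt0.
have pa k : poch a k != 0 by exact: poch_neq0.
have pab k : poch (1 + a - b) k != 0 by exact: poch_neq0.
have pac k : poch (1 + a - c) k != 0 by exact: poch_neq0.
have nz (x : R) k : 0 < x -> x + k%:R != 0 by move=> x0; rewrite gt_eqF// ltr_wpDr.
have fn k : k`!%:R != 0 :> R by rewrite pnatr_eq0 -lt0n fact_gt0.
have tele k N : \sum_(n < N.+1) ((1 + a - b + k%:R) * (1 + a - c + k%:R) * T k.+1 n
    - (1 + a - b - c + k%:R) * T k n) = H k N.
  elim: N => [|N IH].
    rewrite big_ord1 /= /T /H !expr0 !ffactn0 fact0 !addn0 !(pochSr a k.+1).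
    rewrite !poch0 (pochSr a 0) (pochSr b 0) (pochSr c 0) !poch0.
    have := pa k.+1; have := nz a k.+1 a0; rewrite -natr1.
    by move=> h1 h2; field; rewrite h1 h2.
  rewrite big_ord_recr /= IH /T /H !ffactSS_natr !ffact_natr !addSn !addnS !exprS.
  rewrite (pochSr a (k + N).+2) (pochSr a N.+1) (pochSr b N.+1) (pochSr c N.+1).
  rewrite (pochSr (1 + a - b) N) (pochSr (1 + a - c) N) factS natrM.
  have := (pa (k + N).+2, pab N, pac N, fn N, nz _ N ab0, nz _ N ac0,
    nz a (k + N).+2 a0, nz 1 N ltr01).
  rewrite -![_.+2%:R]natr1 -![_.+1%:R]natr1 natrD.
  move: (poch a (k + N).+2) (poch (1 + a - b) N) (poch (1 + a - c) N) => D q r.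
  move: (N`!%:R) ((-1) ^+ N) (k ^_ N)%:R (poch a N.+1) (poch b N.+1) (poch c N.+1).
  move=> F S X A B C [[[[[[[h1 h2] h3] h4] h5] h6] h7] h8].
  by field; rewrite h1 h2 h3 h4 h5 h6 h7 addrC h8.
elim: m => [|m IH].
  by rewrite big_ord1 /= ffactn0 expr0 fact0 !poch0 addn0 (pochSr a 0) !poch0; field; rewrite gt_eqF.
(* The term of index m + 1 vanishes, so the sum for m may run over the range of the sum for m + 1
   and the telescoped recurrence compares the two. *)
have Tz : T m m.+1 = 0 by rewrite /T ffact_small// !(mulr0, mul0r).
have := tele m m.+1; rewrite sumrB -!mulr_sumr.
have -> : H m m.+1 = 0 by rewrite /H ffact_small// !(mulr0, mul0r).
rewrite [X in _ - _ * X]big_ord_recr /= Tz addr0 IH => /eqP; rewrite subr_eq0 => /eqP h.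
rewrite !pochSr.
have h1 := nz _ m ab0; have h2 := nz _ m ac0.
apply: (mulfI h2); apply: (mulfI h1); rewrite mulrA h.
by field; rewrite h1 h2 pab pac.
Qed.

(* Wilf-Zeilberger again; the sum advances in steps of two. *)
Lemma sum_well_poised2 nu b m : 0 < nu -> b < nu + 1 / 2 ->
  \sum_(k < m.+1) (m ^_ k.*2)%:R / k`!%:R * (2 * nu + 4 * k%:R) *
    (poch nu k * poch b k / (poch (1 + nu - b) k * poch (2 * nu) (m + k.*2).+1))
  = poch (nu + 1 / 2 - b) m /
    (poch (2 * (nu + 1 / 2 - b)) m * poch (nu + 1 / 2) m).
Proof.
move=> nu0 bnu; set al := nu + 1 / 2 - b.
have al0 : 0 < al by rewrite subr_gt0.
have nub0 : 0 < 1 + nu - b by move: al0; rewrite /al; lra.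
pose T m k : R := (m ^_ k.*2)%:R / k`!%:R * (2 * nu + 4 * k%:R) *
    (poch nu k * poch b k / (poch (1 + nu - b) k * poch (2 * nu) (m + k.*2).+1)).
pose H m k : R := - 2 * (m ^_ k.*2.+1)%:R / k`!%:R *
    (poch nu k.+1 * poch b k.+1 / (poch (1 + nu - b) k * poch (2 * nu) (m + k.*2).+2)).
have nu20 : 0 < 2 * nu by lra.
have p2 k : poch (2 * nu) k != 0 by exact: poch_neq0.
have pb k : poch (1 + nu - b) k != 0 by exact: poch_neq0.
have nz (x : R) k : 0 < x -> x + k%:R != 0 by move=> x0; rewrite gt_eqF// ltr_wpDr.
have fn k : k`!%:R != 0 :> R by rewrite pnatr_eq0 -lt0n fact_gt0.
have tele k N : \sum_(n < N.+1) ((2 * al + k%:R) * (nu + 1 / 2 + k%:R) * T k.+1 n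
    - (al + k%:R) * T k n) = H k N.
  elim: N => [|N IH].
    rewrite big_ord1 /= /T /H double0 ffactnS !ffactn0 fact0 !addn0 !(pochSr (2 * nu) k.+1).
    rewrite !poch0 (pochSr nu 0) (pochSr b 0) !poch0 muln1.
    have := p2 k.+1; have := nz (2 * nu) k.+1 nu20; rewrite -[k.+1%:R]natr1.
    move=> h1 h2; rewrite /al; field; rewrite h1 h2//.
  rewrite big_ord_recr /= IH /T /H doubleS !ffactSS_natr !ffact_natr !addSn !addnS.
  rewrite (pochSr _ (k + N.*2).+3) (pochSr _ (k + N.*2).+2).
  rewrite (pochSr nu N.+1) (pochSr b N.+1) (pochSr (1 + nu - b) N) factS natrM.
  have := (p2 (k + N.*2).+2, pb N, fn N, nz _ N nub0, nz (2 * nu) (k + N.*2).+2 nu20,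
    nz (2 * nu) (k + N.*2).+3 nu20, nz 1 N ltr01).
  rewrite -![(k + N.*2).+3%:R]natr1.
  rewrite -![(k + N.*2).+2%:R]natr1 -![(k + N.*2).+1%:R]natr1.
  rewrite -![N.*2.+2%:R]natr1 -![N.*2.+1%:R]natr1 -![N.+1%:R]natr1 natrD -muln2 natrM.
  move: (poch (2 * nu) (k + N * 2).+2) (poch (1 + nu - b) N) => D q.
  move: (N`!%:R) (k ^_ (N * 2))%:R (poch nu N.+1) (poch b N.+1).
  move=> F X A B [[[[[[h1 h2] h3] h4] h5] h6] h7].
  by rewrite /al; field; rewrite h1 h2 h3 h4 h5 h6 addrC h7.
elim: m => [|m IH].
  rewrite big_ord1 /= ffactn0 fact0 !poch0 double0 addn0 (pochSr _ 0) !poch0 mulr0 !addr0.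
  by field; rewrite gt_eqF.
have Tz : T m m.+1 = 0 by rewrite /T ffact_small ?mul0r//; lia.
have := tele m m.+1; rewrite sumrB -!mulr_sumr.
have -> : H m m.+1 = 0 by rewrite /H ffact_small ?(mulr0, mul0r)//; lia.
rewrite [X in _ - _ * X]big_ord_recr /= Tz addr0 IH => /eqP; rewrite subr_eq0 => /eqP h.
rewrite !pochSr.
have al20 : 0 < 2 * al by lra.
have n20 : 0 < nu + 1 / 2 by lra.
have h1 := nz _ m al20; have h2 := nz _ m n20.
have h3 := poch_neq0 m al20; have h4 := poch_neq0 m n20.
apply: (mulfI h2); apply: (mulfI h1); rewrite mulrA h.
move: h1 h2 h3 h4; move: (2 * al + m%:R) (nu + 1 / 2 + m%:R) => p q.
move: (poch (2 * al) m) (poch (nu + 1 / 2) m) => r t h1 h2 h3 h4.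
by field; rewrite h1 h2 h3 h4.
Qed.

End WellPoisedSums.

(** * Squares of Bessel functions and Gasper's expansion *)

Section BesselSquares.
Context {R : realType}.
Implicit Types (x nu : R) (m n k : nat).
Local Notation poch := (@pochhammer R).

Lemma fact_neq0 n : n`!%:R != 0 :> R.
Proof. by rewrite pnatr_eq0 -lt0n fact_gt0. Qed.

Lemma poch_double x n : poch (2 * x) n.*2 = 4 ^+ n * poch x n * poch (x + 1 / 2) n.
Proof.
elim: n => [|n IH]; first by rewrite !poch0 expr0 !mulr1.
rewrite doubleS !pochSr IH exprS -[n.*2.+1%:R]natr1 -muln2 natrM.
by field.
Qed.

Lemma sqr_signr k : (-1) ^+ k * (-1) ^+ k = 1 :> R.
Proof. by rewrite -exprD addnn -signr_odd odd_double. Qed.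

(** The coefficients of the Cauchy square are Chu-Vandermonde sums with both parameters equal to -nu
    - m. They yield (2 nu + 1)_(2m), which the duplication formula splits. *)
Lemma sqr_hyp0F1 nu x : 0 < nu ->
  hyp0F1 (nu + 1) (x / 4) * hyp0F1 (nu + 1) (x / 4) =
  hyp1F2 (nu + 1 / 2) (nu + 1) (2 * nu + 1) x.
Proof.
move=> nu0; have c0 : 0 < nu + 1 by lra.
have le1 m := @hyp0F1_term_le R (nu + 1) (x / 4) m c0.
have cv := @is_cvg_exp_majorant R (Num.min 1 (nu + 1))^-1 `|x / 4|.
have h := cvg_series_Cauchy le1 le1 cv cv (cvg_hyp0F1 (z := x / 4) c0)
  (cvg_hyp0F1 (z := x / 4) c0).
have n12 : 0 < nu + 1 / 2 <= nu + 1 by apply/andP; split; lra.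
have n21 : 0 < 2 * nu + 1 by lra.
have h' := cvg_hyp1F2 (z := x) n12 n21.
apply: (cvg_unique _ _ h') => //; apply: eq_cvg_series h => m.
have pm0 := poch_neq0 m c0.
have pm1 := poch_neq0 m n21.
have key : \sum_(k < m.+1) 'C(m, k)%:R * (poch (nu + 1) m / poch (nu + 1) k) *
    (poch (nu + 1) m / poch (nu + 1) (m - k)) =
    4 ^+ m * poch (nu + 1 / 2) m * poch (nu + 1) m / poch (2 * nu + 1) m.
  have -> : 4 ^+ m * poch (nu + 1 / 2) m * poch (nu + 1) m =
      poch (2 * nu + 1) m * poch (2 * nu + 1 + m%:R) m.
    rewrite -pochD addnn (_ : 2 * nu + 1 = 2 * (nu + 1 / 2)); last by field.
    by rewrite poch_double; congr (_ * poch _ _); field.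
  rewrite mulrAC divff// mul1r (poch_rev (2 * nu + 1 + m%:R) m).
  pose e := 1 - (nu + 1) - m%:R.
  rewrite (_ : 1 - (2 * nu + 1 + m%:R) - m%:R = e + e); last by rewrite /e; ring.
  rewrite -(poch_vandermonde e e m) mulr_sumr; apply: eq_bigr => k _.
  have km : (k <= m)%N by rewrite -ltnS.
  rewrite poch_shift// poch_shift ?leq_subr// subKn// -/e.
  have -> : (-1) ^+ m = (-1) ^+ k * (-1) ^+ (m - k) :> R by rewrite -exprD subnKC.
  ring.
have -> : poch (nu + 1 / 2) m * (- x) ^+ m /
    (m`!%:R * poch (nu + 1) m * poch (2 * nu + 1) m) =
    (- (x / 4)) ^+ m / (m`!%:R * (poch (nu + 1) m * poch (nu + 1) m)) *
    (4 ^+ m * poch (nu + 1 / 2) m * poch (nu + 1) m / poch (2 * nu + 1) m).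
  rewrite (_ : - x = - (x / 4) * 4); last by field.
  by rewrite exprMn; field; rewrite fact_neq0 pm0 pm1.
rewrite -key mulr_sumr; apply: eq_bigr => k _.
have km : (k <= m)%N by rewrite -ltnS.
have -> : (- (x / 4)) ^+ m = (- (x / 4)) ^+ k * (- (x / 4)) ^+ (m - k).
  by rewrite -exprD subnKC.
rewrite -(bin_fact km) !natrM.
have pk0 := poch_neq0 k c0; have pmk0 := poch_neq0 (m - k) c0.
have b0 : 'C(m, k)%:R != 0 :> R by rewrite pnatr_eq0 -lt0n bin_gt0.
have k0 := fact_neq0 k; have mk0 := fact_neq0 (m - k).
move: (poch (nu + 1) k) (poch (nu + 1) (m - k)) (poch (nu + 1) m) pm0 pk0 pmk0.
move=> p q r r0 p0 q0; by field; rewrite r0 p0 q0 b0 k0 mk0.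
Qed.

Lemma hyp1F2_sqr_ge0 nu x : 0 < nu -> 0 <= hyp1F2 (nu + 1 / 2) (nu + 1) (2 * nu + 1) x.
Proof. by move=> nu0; rewrite -sqr_hyp0F1// -expr2 sqr_ge0. Qed.

Lemma poch_ratio x n m : (n <= m)%N -> 0 < x ->
  poch (x + n%:R) (m - n) = poch x m / poch x n.
Proof.
move=> nm x0; rewrite -{2}(subnKC nm) pochD mulrAC divff ?mul1r ?poch_neq0//.
Qed.

(* Gasper's expansion of a 1F2 into a series of squares of Bessel functions with
   coefficients [q n >= 0]; dropping all but the first square gives the bound. *)
Lemma hyp1F2_sqr_le nu x (q c : nat -> R) (F : R) :
  0 < nu -> 0 <= x -> (forall n, 0 <= q n <= 1) -> q 0 = 1 ->
  (forall m, c m * poch (nu + 1) m / poch (nu + 1 / 2) m =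
    \sum_(n < m.+1) (-1) ^+ n * (m ^_ n)%:R / n`!%:R * (2 * nu + 2 * n%:R) *
      (poch (2 * nu) n * q n / poch (2 * nu) (m + n).+1)) ->
  series (fun m => c m * (- x) ^+ m / m`!%:R) @ \oo --> F ->
  hyp1F2 (nu + 1 / 2) (nu + 1) (2 * nu + 1) x <= F.
Proof.
move=> nu0 x0 q01 q0 cE cF.
have nu1 : 0 < nu + 1 by lra.
have nu12 : 0 < nu + 1 / 2 by lra.
have nu2 : 0 < 2 * nu by lra.
have [qge0 qle1] : (forall n, 0 <= q n) /\ (forall n, q n <= 1).
  by split => n; have /andP[] := q01 n.
(* The expansion is the sum of a n x^n S n, where S n is the 1F2 equal to the squared Bessel
   function of order nu + n. The hypothesis on [c] is the comparison of the coefficients of x^m. *)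
pose a n := (nu + n%:R) * poch (2 * nu) n * q n /
  (nu * n`!%:R * 4 ^+ n * (poch (nu + 1) n * poch (nu + 1) n)).
have n0 n : 0 < nu + n%:R by rewrite ltr_wpDr.
have p1 n := poch_gt0 n nu1; have p2 n := poch_gt0 n nu2; have p3 n := poch_gt0 n nu12.
have fg n : 0 < n`!%:R :> R by rewrite ltr0n fact_gt0.
have a0 n : 0 <= a n.
  rewrite divr_ge0//; first by rewrite !mulr_ge0// ltW.
  by rewrite !mulr_ge0// ?exprn_ge0// ltW.
have a1 : a 0%N = 1.
  by rewrite /a q0 !poch0 fact0 expr0 addr0 !mulr1 divff// gt_eqF.
(* Factor by factor 2 nu + i <= 4 (nu + 1 + i), and q n <= 1, so only 1 / (nu)_n and 1 / n!
   remain. *)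
have ale n : a n <= (Num.min 1 nu)^-1 * (1 / n`!%:R).
  have -> : a n = (poch nu n)^-1 * ((poch (2 * nu) n / (4 ^+ n * poch (nu + 1) n)) *
      q n / n`!%:R).
    have : nu * poch (nu + 1) n = poch nu n * (nu + n%:R) by rewrite -pochSl pochSr.
    rewrite /a; have := poch_gt0 n nu0; move: (p1 n) (n0 n) (fg n).
    have h4 : (4 : R) ^+ n != 0 by rewrite expf_neq0.
    move: (poch (nu + 1) n) (poch nu n) (poch (2 * nu) n) (4 ^+ n) h4 (n`!%:R).
    move=> p r s t t0 f p0 nn0 f0 r0 e.
    have -> : p = r * (nu + n%:R) / nu by rewrite -e mulrAC divff ?mul1r// gt_eqF.
    by field; rewrite t0 !gt_eqF.
  apply: ler_pM; [by rewrite invr_ge0 ltW// poch_gt0| |exact: poch_inv_le|].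
    by rewrite !mulr_ge0 ?invr_ge0 ?mulr_ge0 ?exprn_ge0// ltW.
  apply: ler_wpM2r; first by rewrite invr_ge0 ltW.
  rewrite -[leRHS]mulr1; apply: ler_pM => //.
    by rewrite !mulr_ge0 ?invr_ge0 ?mulr_ge0 ?exprn_ge0// ltW.
  rewrite ler_pdivrMr ?mulr_gt0 ?exprn_gt0// mul1r /pochhammer.
  have -> : (4 : R) ^+ n = \prod_(i < n) 4 by rewrite prodr_const card_ord.
  rewrite -big_split /=; apply: ler_prod => i _.
  have i0 : 0 <= i%:R :> R by [].
  by apply/andP; split; lra.
pose s n j := poch (nu + n%:R + 1 / 2) j * (- x) ^+ j /
  (j`!%:R * poch (nu + n%:R + 1) j * poch (2 * (nu + n%:R) + 1) j).
pose S n := hyp1F2 (nu + n%:R + 1 / 2) (nu + n%:R + 1) (2 * (nu + n%:R) + 1) x.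
have h12 n : 0 < nu + n%:R + 1 / 2 <= nu + n%:R + 1.
  by have := n0 n => h; apply/andP; split; lra.
have h21 n : 0 < 2 * (nu + n%:R) + 1 by have := n0 n => h; lra.
have sS n : series (s n) @ \oo --> S n by exact: cvg_hyp1F2.
have sle n j : `|s n j| <= 1 * (x ^+ j / j`!%:R).
  apply: le_trans (hyp1F2_term_le _ _ (h12 n) (h21 n)) _.
  have : 1 <= 2 * (nu + n%:R) + 1 by have := n0 n => h; lra.
  by move=> h; rewrite (min_idPl h) invr1 (ger0_norm x0).
pose A n := (Num.min 1 nu)^-1 * (x ^+ n / n`!%:R).
pose B j := 1 * (x ^+ j / j`!%:R).
have m0 : 0 <= (Num.min 1 nu)^-1 by rewrite invr_ge0 le_min ler01 ltW.
have A0 n : 0 <= A n by rewrite /A; nonneg.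
have B0 n : 0 <= B n by rewrite /B; nonneg.
have cA : cvgn (series A) by exact: is_cvg_exp_majorant.
have cB : cvgn (series B) by exact: is_cvg_exp_majorant.
have S0 n : 0 <= S n by exact: hyp1F2_sqr_ge0.
have axA n : a n * x ^+ n <= A n.
  rewrite /A mulrCA [leRHS]mulrC; apply: ler_wpM2r; first exact: exprn_ge0.
  by rewrite -[n`!%:R^-1]div1r.
pose r n := a n * x ^+ n * S n.
have ax0 n : 0 <= a n * x ^+ n by rewrite mulr_ge0// exprn_ge0.
have r0 n : 0 <= r n by exact: mulr_ge0.
have Sle n : S n <= expR x.
  rewrite -[S n]ger0_norm// -[expR x]mul1r.
  exact: normr_series_lim_le (sle n) (sS n) (cvg_seriesZ (k := 1) (cvg_series_expR (x := x))).
have cr : cvgn (series r).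
  have cAe : cvgn (series (fun n => expR x * A n)).
    by have /cvg_ex[/= l Al] := cA; apply/cvg_ex; exists (expR x * l); exact: cvg_seriesZ.
  apply: is_cvg_series_dom cAe => n.
  by rewrite ger0_norm// [leRHS]mulrC; apply: ler_pM.
have /cvg_ex[/= l rl] := cr.
have dom k j : `|a k * x ^+ k * s k j| <= A k * B j.
  by rewrite normrM; apply: ler_pM => //; rewrite ger0_norm.
have tri := @cvg_series_antidiagonal R (fun n j => a n * x ^+ n * s n j) A B r l A0 B0
  dom cA cB (fun n => cvg_seriesZ (k := a n * x ^+ n) (sS n)) rl.
have -> : F = l.
  apply: (cvg_unique _ cF) => //; apply: eq_cvg_series tri => m.
  have -> : c m * (- x) ^+ m / m`!%:R = (- x) ^+ m / m`!%:R *
      (poch (nu + 1 / 2) m / poch (nu + 1) m) *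
      (c m * poch (nu + 1) m / poch (nu + 1 / 2) m).
    by field; rewrite fact_neq0 !poch_neq0.
  rewrite cE mulr_sumr; apply: eq_bigr => n _.
  have nm : (n <= m)%N by rewrite -ltnS.
  rewrite /s; have -> : nu + n%:R + 1 / 2 = nu + 1 / 2 + n%:R by ring.
  have -> : nu + n%:R + 1 = nu + 1 + n%:R by ring.
  have -> : 2 * (nu + n%:R) + 1 = 2 * nu + (n.*2.+1)%:R.
    by rewrite -[n.*2.+1%:R]natr1 -muln2 natrM; ring.
  have -> : poch (2 * nu + n.*2.+1%:R) (m - n) =
      poch (2 * nu) (m + n).+1 / poch (2 * nu) n.*2.+1.
    by rewrite -poch_ratio//; [congr (pochhammer _ _); lia|lia].
  rewrite !poch_ratio// [poch (2 * nu) n.*2.+1]pochSl.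
  have -> : poch (2 * nu + 1) n.*2 = 4 ^+ n * poch (nu + 1 / 2) n * poch (nu + 1) n.
    rewrite (_ : 2 * nu + 1 = 2 * (nu + 1 / 2)); last by field.
    by rewrite poch_double; congr (_ * poch _ _); field.
  have -> : (- x) ^+ m = (-1) ^+ n * x ^+ n * (- x) ^+ (m - n).
    by rewrite -[(-1) ^+ n * _]exprMn mulN1r -exprD subnKC.
  rewrite /a -(ffact_fact nm) natrM.
  have h4 : (4 : R) ^+ n != 0 by rewrite expf_neq0.
  have ffn0 : (m ^_ n)%:R != 0 :> R by rewrite pnatr_eq0 -lt0n ffact_gt0.
  have := (fact_neq0 n, fact_neq0 (m - n), poch_neq0 m nu1, poch_neq0 n nu1,
    poch_neq0 m nu12, poch_neq0 n nu12, poch_neq0 (m + n).+1 nu2, gt_eqF nu0).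
  move: (n`!%:R) ((m - n)`!%:R) (poch (nu + 1) m) (poch (nu + 1) n) (poch (nu + 1 / 2) m)
    (poch (nu + 1 / 2) n) (poch (2 * nu) (m + n).+1) (4 ^+ n) h4 (m ^_ n)%:R ffn0.
  move=> f1 f2 u1 u2 u3 u4 u5 t t0 ff ff0 [[[[[[[e1 e2] e3] e4] e5] e6] e7] e8].
  move: (sqr_signr n); set e := (-1) ^+ n => ee.
  rewrite -[LHS]mul1r -ee.
  have en0 : e != 0 by rewrite expf_neq0// oppr_eq0 oner_neq0.
  by field; rewrite e1 e2 e3 e4 e6 e7 t0 ff0 e8 en0.
have -> : hyp1F2 (nu + 1 / 2) (nu + 1) (2 * nu + 1) x = series r 1%N.
  by rewrite /series /= big_nat1 /r a1 expr0 /S !addr0 !mul1r.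
exact: series_le_lim.
Qed.

End BesselSquares.

(** * The three comparisons of 1F2 functions *)

Section HypergeometricBounds.
Context {R : realType}.
Implicit Types (x nu al be b c : R) (m n k : nat).
Local Notation poch := (@pochhammer R).

(** [sum_5F4] with a = 2 nu supplies the coefficients. They are nonnegative since b and c are, and
    at most 1 since b + c <= 1 + 2 nu gives b <= 1 + 2 nu - c and c <= 1 + 2 nu - b. The series is a
    2F3, which each use reduces to a 1F2 by cancelling a parameter. *)
Lemma hyp1F2_sqr_le_Saalschuetz nu b c x (F : R) :
  0 < nu -> 0 <= x -> 0 <= b -> 0 <= c -> b + c <= 1 + 2 * nu ->
  b < 1 + 2 * nu -> c < 1 + 2 * nu ->
  series (fun m => poch (1 + 2 * nu - b - c) m * poch (nu + 1 / 2) m /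
    (poch (nu + 1) m * poch (1 + 2 * nu - b) m * poch (1 + 2 * nu - c) m) *
    (- x) ^+ m / m`!%:R) @ \oo --> F ->
  hyp1F2 (nu + 1 / 2) (nu + 1) (2 * nu + 1) x <= F.
Proof.
move=> nu0 x0 b0 c0 bc bn cn.
have nu1 : 0 < nu + 1 by lra.
have nu12 : 0 < nu + 1 / 2 by lra.
have nu2 : 0 < 2 * nu by lra.
have bp : 0 < 1 + 2 * nu - b by rewrite subr_gt0.
have cp : 0 < 1 + 2 * nu - c by rewrite subr_gt0.
pose q n := poch b n * poch c n / (poch (1 + 2 * nu - b) n * poch (1 + 2 * nu - c) n).
apply: (@hyp1F2_sqr_le R nu x q) => //.
- move=> n; rewrite divr_ge0 ?mulr_ge0 ?poch_ge0// ?(ltW bp) ?(ltW cp)//=.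
  rewrite ler_pdivrMr ?mulr_gt0 ?poch_gt0// mul1r mulrC.
  by apply: ler_pM; rewrite ?poch_ge0// ler_poch//; lra.
- by rewrite /q !poch0 !mulr1 divff.
- move=> m; have := @sum_5F4 R (2 * nu) b c m nu2 bn cn => h.
  transitivity (poch (1 + 2 * nu - b - c) m / (poch (1 + 2 * nu - b) m * poch (1 + 2 * nu - c) m)).
    by field; rewrite !poch_neq0.
  rewrite -h; apply: eq_bigr => n _; congr (_ * _); rewrite /q.
  by field; rewrite !poch_neq0.
Qed.

(** Here b and c are chosen with 1 + 2 nu - b - c = nu + 1, which cancels that denominator
    parameter. Their nonnegativity comes from al + 1/2 < be <= 2 al. *)
Lemma hyp1F2_le_case1 al be x : 1 / 2 < al -> al + 1 / 2 < be -> be <= 2 * al -> 0 <= x ->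
  hyp1F2 al (al + 1 / 2) (2 * al) x <= hyp1F2 al be (3 * al + 1 / 2 - be) x.
Proof.
move=> al0 albe be2 x0; pose nu := al - 1 / 2.
have nuE : (nu + 1 / 2 = al) * (nu + 1 = al + 1 / 2) * (2 * nu + 1 = 2 * al).
  by rewrite /nu; split; [split|]; field.
rewrite -[X in hyp1F2 X (al + _)]nuE -[X in hyp1F2 _ X _ _ <= _]nuE -[X in hyp1F2 _ _ X _ <= _]nuE.
have albe' : 0 < al <= be by apply/andP; split; lra.
have ga0 : 0 < 3 * al + 1 / 2 - be by lra.
apply: (@hyp1F2_sqr_le_Saalschuetz nu (be - al - 1 / 2) (2 * al - be));
  rewrite ?/nu; try lra.
have := cvg_hyp1F2 (z := x) albe' ga0; apply: eq_cvg_series => m.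
have -> : 1 + 2 * (al - 1 / 2) - (be - al - 1 / 2) - (2 * al - be) = al - 1 / 2 + 1 by field.
have -> : 1 + 2 * (al - 1 / 2) - (be - al - 1 / 2) = 3 * al + 1 / 2 - be by field.
have -> : 1 + 2 * (al - 1 / 2) - (2 * al - be) = be by field.
rewrite subrK; have h1 : 0 < al - 1 / 2 + 1 by lra.
have h2 : 0 < be by lra.
have := (poch_neq0 m h1, poch_neq0 m h2, poch_neq0 m ga0, @fact_neq0 R m).
move: (poch (al - 1 / 2 + 1) m) (poch be m) (poch (3 * al + 1 / 2 - be) m).
by move=> p q r [[[e1 e2] e3] e4]; field; rewrite e1 e2 e3 e4.
Qed.

(** The choice c = nu + 1/2 makes 1 + 2 nu - c cancel the numerator parameter nu + 1/2; b = be - 1/2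
    - al is nonnegative by the hypothesis on be. *)
Lemma hyp1F2_le_case2 al be x : 1 / 2 < al -> al + 1 / 2 <= be -> 0 <= x ->
  hyp1F2 (be - 1 / 2) be (2 * be - 1) x <= hyp1F2 al be (al + be - 1 / 2) x.
Proof.
move=> al0 albe x0; pose nu := be - 1.
have nuE : (nu + 1 / 2 = be - 1 / 2) * (nu + 1 = be) * (2 * nu + 1 = 2 * be - 1).
  by rewrite /nu; split; [split|]; field.
rewrite -[X in hyp1F2 X be]nuE -[X in hyp1F2 _ X _ _ <= _]nuE -[X in hyp1F2 _ _ X _ <= _]nuE.
have albe' : 0 < al <= be by apply/andP; split; lra.
have ga0 : 0 < al + be - 1 / 2 by lra.
apply: (@hyp1F2_sqr_le_Saalschuetz nu (be - 1 / 2 - al) (be - 1 / 2));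
  rewrite ?/nu; try lra.
have := cvg_hyp1F2 (z := x) albe' ga0; apply: eq_cvg_series => m.
have -> : 1 + 2 * (be - 1) - (be - 1 / 2 - al) - (be - 1 / 2) = al by field.
have -> : 1 + 2 * (be - 1) - (be - 1 / 2 - al) = al + be - 1 / 2 by field.
have -> : 1 + 2 * (be - 1) - (be - 1 / 2) = be - 1 / 2 by field.
have -> : be - 1 + 1 / 2 = be - 1 / 2 by field.
rewrite subrK; have h1 : 0 < be - 1 / 2 by lra.
have h2 : 0 < be by lra.
have := (poch_neq0 m h1, poch_neq0 m h2, poch_neq0 m ga0, @fact_neq0 R m).
move: (poch (be - 1 / 2) m) (poch be m) (poch (al + be - 1 / 2) m).
by move=> p q r [[[e1 e2] e3] e4]; field; rewrite e1 e2 e3 e4.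
Qed.

Lemma sum_even (f : nat -> R) m : (forall k, f k.*2.+1 = 0) ->
  (forall n, (m < n)%N -> f n = 0) ->
  \sum_(n < m.+1) f n = \sum_(k < m.+1) f k.*2.
Proof.
move=> fodd fbig.
have dbl N : \sum_(0 <= n < N.*2) f n = \sum_(0 <= k < N) f k.*2.
  elim: N => [|N IH]; first by rewrite !big_geq.
  by rewrite doubleS !big_nat_recr//= IH fodd addr0.
rewrite -!(big_mkord xpredT) -(big_mkord xpredT (fun k => f k.*2)) -dbl.
rewrite [RHS](big_cat_nat (n := m.+1))//=; last by lia.
rewrite [X in _ + X]big_nat [X in _ + X]big1 ?addr0// => n /andP[mn _].
exact: fbig.
Qed.

(** Now only the squares of orders nu + 2k occur: [q] vanishes at odd indices, and its even values
    come from [sum_well_poised2] with b = nu + 1/2 - al. *)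
Lemma hyp1F2_le_case3 al be x : 1 / 2 < al -> al + 1 / 2 <= be -> 0 <= x ->
  hyp1F2 (be - 1 / 2) be (2 * be - 1) x <= hyp1F2 al be (2 * al) x.
Proof.
move=> al0 albe x0; pose nu := be - 1.
have nuE : (nu + 1 / 2 = be - 1 / 2) * (nu + 1 = be) * (2 * nu + 1 = 2 * be - 1).
  by rewrite /nu; split; [split|]; field.
rewrite -[X in hyp1F2 X be]nuE -[X in hyp1F2 _ X _ _ <= _]nuE -[X in hyp1F2 _ _ X _ <= _]nuE.
have albe' : 0 < al <= be by apply/andP; split; lra.
have ga0 : 0 < 2 * al by lra.
have nu0 : 0 < nu by rewrite /nu; lra.
have nu12 : 0 < nu + 1 / 2 by lra.
have a12 : 0 < al + 1 / 2 by lra.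
have h12 : 0 < 1 / 2 :> R by lra.
pose b := nu + 1 / 2 - al.
have b0 : 0 <= b by rewrite /b nuE; lra.
pose q n : R := if odd n then 0 else poch (1 / 2) n./2 * poch b n./2 /
  (poch (nu + 1 / 2) n./2 * poch (al + 1 / 2) n./2).
apply: (@hyp1F2_sqr_le R nu x q (fun m => poch al m / (poch be m * poch (2 * al) m))) => //.
- move=> n; rewrite /q; case: ifP => _; first by rewrite lexx ler01.
  rewrite divr_ge0 ?mulr_ge0 ?poch_ge0// ?(ltW h12) ?(ltW nu12) ?(ltW a12)//=.
  rewrite ler_pdivrMr ?mulr_gt0 ?poch_gt0// [leRHS]mul1r [leLHS]mulrC.
  by apply: ler_pM; rewrite ?poch_ge0// ?ler_poch// ?/b; lra.
- by rewrite /q /= !poch0 !mulr1 divff.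
- move=> m; have bn : b < nu + 1 / 2 by rewrite /b; lra.
  have := sum_well_poised2 m nu0 bn.
  have -> : nu + 1 / 2 - b = al by rewrite /b; ring.
  have -> : 1 + nu - b = al + 1 / 2 by rewrite /b; field.
  move=> h; transitivity (poch al m / (poch (2 * al) m * poch (nu + 1 / 2) m)).
    have bee : nu + 1 = be by rewrite nuE.
    rewrite bee; field; rewrite !poch_neq0//; lra.
  pose g n := (-1) ^+ n * (m ^_ n)%:R / n`!%:R * (2 * nu + 2 * n%:R) *
      (poch (2 * nu) n * q n / poch (2 * nu) (m + n).+1).
  rewrite -h [RHS](@sum_even g); last 2 first.
  + by move=> k; rewrite /g /q /= odd_double /= !(mulr0, mul0r).
  + by move=> n mn; rewrite /g ffact_small// !(mulr0, mul0r).
  apply: eq_bigr => k _; rewrite /g /q odd_double /= doubleK.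
  have -> : (-1) ^+ k.*2 = 1 :> R by rewrite -signr_odd odd_double.
  (* By duplication, (2k)! and (2 nu)_(2k) contain (1/2)_k and (nu + 1/2)_k, which [q] is built to
     cancel. *)
  have -> : (k.*2)`!%:R = 4 ^+ k * poch (1 / 2) k * k`!%:R :> R.
    rewrite -!poch1 -[X in poch X k.*2](_ : 2 * (1 / 2) = 1); last by field.
    by rewrite poch_double; congr (_ * poch _ _); field.
  rewrite poch_double -muln2 natrM.
  have h4 : (4 : R) ^+ k != 0 by rewrite expf_neq0.
  have h2 : 0 < 2 * nu by lra.
  have := (@fact_neq0 R k, poch_neq0 k h12, poch_neq0 k nu12, poch_neq0 k a12,
    poch_neq0 (m + k * 2).+1 h2).
  move: (k`!%:R) (poch (1 / 2) k) (poch (nu + 1 / 2) k) (poch (al + 1 / 2) k)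
    (poch (2 * nu) (m + k * 2).+1) (4 ^+ k) h4.
  move=> f p u v w t t0 [[[[e1 e2] e3] e4] e5].
  by field; rewrite e1 e2 e3 e4 e5 t0.
- have := cvg_hyp1F2 (z := x) albe' ga0; apply: eq_cvg_series => m.
  have be0 : 0 < be by lra.
  by field; rewrite fact_neq0 !poch_neq0.
Qed.

End HypergeometricBounds.

(** * Real-valued integrals *)

Section HasIntegral.
Context {R : realType}.
Local Notation mu := (@lebesgue_measure R).
Implicit Types (D : set R) (f g F : R -> R) (l : R).

(** Integrability is part of the predicate because a real-valued integral takes the default value 0
    when the extended one is infinite. *)
Definition has_integral D f l :=
  mu.-integrable D (EFin \o f) /\ \int[mu]_(t in D) f t = l.

Lemma has_integral_ge0E D f l : measurable D -> measurable_fun D f ->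
  (forall t, D t -> 0 <= f t) -> (\int[mu]_(t in D) (f t)%:E = l%:E)%E ->
  has_integral D f l.
Proof.
move=> mD mf f0 fl; split; last by rewrite /Rintegral fl.
apply/integrableP; split; first exact/measurable_EFinP.
under eq_integral => t /set_mem Dt do rewrite /= ger0_norm ?f0//.
by rewrite fl ltry.
Qed.

Lemma has_integral_EFin D f l : measurable D -> has_integral D f l ->
  (\int[mu]_(t in D) (f t)%:E = l%:E)%E.
Proof. by move=> mD [fi <-]; rewrite fineK//; exact: integrable_fin_num. Qed.

Lemma has_integral_measurable D f l : has_integral D f l -> measurable_fun D f.
Proof. by move=> [/measurable_int /measurable_EFinP]. Qed.

Lemma has_integralZ D k f l : measurable D -> has_integral D f l ->
  has_integral D (fun t => k * f t) (k * l).
Proof.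
move=> mD [fi <-]; split; last by rewrite RintegralZl.
have : mu.-integrable D (fun t => k%:E * (EFin \o f) t)%E by exact: integrableZl.
by apply: eq_integrable.
Qed.

Lemma has_integralD D f g l l' : measurable D -> has_integral D f l ->
  has_integral D g l' -> has_integral D (fun t => f t + g t) (l + l').
Proof.
move=> mD [fi <-] [gi <-]; split; last by rewrite RintegralD.
have : mu.-integrable D ((EFin \o f) \+ (EFin \o g))%E by exact: integrableD.
by apply: eq_integrable.
Qed.

Lemma has_integral0 D : measurable D -> has_integral D (fun=> 0) 0.
Proof.
move=> mD; apply: has_integral_ge0E => //.
by rewrite integral0.
Qed.

Lemma has_integral_sum (I : Type) (r : seq I) D (f : I -> R -> R) (l : I -> R) :
  measurable D -> (forall i, has_integral D (f i) (l i)) ->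
  has_integral D (fun t => \sum_(i <- r) f i t) (\sum_(i <- r) l i).
Proof.
move=> mD fl; elim: r => [|i r IH].
  rewrite big_nil; under eq_fun do rewrite big_nil.
  exact: has_integral0.
rewrite big_cons; under eq_fun do rewrite big_cons.
exact: has_integralD.
Qed.

Lemma eq_has_integral D f g l : measurable D -> (forall t, D t -> f t = g t) ->
  has_integral D f l -> has_integral D g l.
Proof.
move=> mD fg [fi <-]; split; last first.
  by apply: eq_Rintegral => t /set_mem Dt; rewrite fg.
by apply: eq_integrable fi => // t /set_mem Dt; rewrite /= fg.
Qed.

Lemma has_integral_unique D f l l' : has_integral D f l -> has_integral D f l' -> l = l'.
Proof. by move=> [_ <-] [_ <-]. Qed.

Lemma has_integral_ge0 D f l : has_integral D f l -> (forall t, D t -> 0 <= f t) -> 0 <= l.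
Proof. by move=> [_ <-] f0; apply: Rintegral_ge0. Qed.

Lemma has_integral_le D f g l l' : measurable D ->
  has_integral D f l -> has_integral D g l' ->
  (forall t, D t -> f t <= g t) -> l <= l'.
Proof.
move=> mD fl gl fg; rewrite -subr_ge0.
have gfl : has_integral D (fun t => g t + -1 * f t) (l' + -1 * l).
  by apply: has_integralD => //; exact: has_integralZ.
rewrite -[- l]mulN1r; apply: has_integral_ge0 gfl _ => t Dt.
by rewrite mulN1r subr_ge0 fg.
Qed.

Lemma has_integral_dom D f g l : measurable D -> measurable_fun D f ->
  has_integral D g l -> (forall t, D t -> `|f t| <= g t) ->
  exists2 l', has_integral D f l' & `|l'| <= l.
Proof.
move=> mD mf gl fg; exists (\int[mu]_(t in D) f t).
  split => //; case: gl => gi _; apply: le_integrable gi => //; first exact/measurable_EFinP.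
  move=> t Dt; rewrite /= lee_fin; apply: le_trans (fg _ Dt) _.
  exact: ler_norm.
have fi : mu.-integrable D (EFin \o f).
  case: gl => gi _; apply: le_integrable gi => //; first exact/measurable_EFinP.
  by move=> t Dt; rewrite /= lee_fin; apply: le_trans (fg _ Dt) (ler_norm _).
have [h1 h2] : has_integral D (fun t => `|f t|) (\int[mu]_(t in D) `|f t|).
  split => //; have : mu.-integrable D (abse \o (EFin \o f)) by exact: integrable_abse.
  by apply: eq_integrable.
have : `|\int[mu]_(t in D) f t| <= \int[mu]_(t in D) `|f t| by exact: le_normr_Rintegral.
move=> /le_trans; apply.
by apply: (has_integral_le mD _ gl fg); split.
Qed.

Lemma has_integral_series D (f : nat -> R -> R) (I B : nat -> R) F :
  measurable D -> (forall n, has_integral D (f n) (I n)) ->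
  (forall n, exists g, has_integral D g (B n) /\ forall t, D t -> `|f n t| <= g t) ->
  cvgn (series B) -> (forall t, D t -> series (f ^~ t) @ \oo --> F t) ->
  exists2 l, has_integral D F l & series I @ \oo --> l.
Proof.
move=> mD fI fB cB fF.
have mf n : measurable_fun D (f n) := has_integral_measurable (fI n).
have fB' n : (\int[mu]_(t in D) (`|f n t|%R)%:E <= (B n)%:E)%E.
  have [g [gB fg]] := fB n; rewrite -(has_integral_EFin mD gB).
  apply: ge0_le_integral => //.
  - by apply/measurable_EFinP; apply: measurableT_comp => //; exact: mf.
  - apply/measurable_EFinP; exact: has_integral_measurable gB.
have [Fi cF] := @cvg_series_integral _ _ R mu D mD f F mf fF B fB' cB.
exists (\int[mu]_(t in D) F t); first by split.
by apply: eq_cvg_series cF => n; case: (fI n).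
Qed.

End HasIntegral.

(** * Positive semidefinite kernels *)

Section PositiveSemidefinite.
Context {R : realType}.
Local Notation unitI := (`]0%R, 1%R[%classic : set R).
Local Notation poch := (@pochhammer R).

Definition psd_kernel (T : Type) (K : T -> T -> R) := forall n (x : 'I_n -> T) (w : 'I_n -> R),
  0 <= \sum_(k < n) \sum_(l < n) w k * w l * K (x k) (x l).

Section Closure.
Context (T : Type).
Implicit Types K L : T -> T -> R.

Lemma eq_psd_kernel K L : (forall x y, K x y = L x y) -> psd_kernel K -> psd_kernel L.
Proof.
move=> KL hK n x w; have := hK n x w.
by under eq_bigr do under eq_bigr do rewrite KL.
Qed.

Lemma psd_kernelZ c K : 0 <= c -> psd_kernel K -> psd_kernel (fun x y => c * K x y).
Proof.
move=> c0 hK n x w.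
rewrite (_ : \sum_(k < n) _ = c * \sum_(k < n) \sum_(l < n) w k * w l * K (x k) (x l)).
  by rewrite mulr_ge0.
rewrite mulr_sumr; apply: eq_bigr => k _; rewrite mulr_sumr.
by apply: eq_bigr => l _; rewrite mulrCA.
Qed.

Lemma psd_kernel_integral (D : set R) (K : R -> T -> T -> R) L : measurable D ->
  (forall t, D t -> psd_kernel (K t)) ->
  (forall x y, has_integral D (fun t => K t x y) (L x y)) -> psd_kernel L.
Proof.
move=> mD hK KL n x w.
apply: (@has_integral_ge0 _ D
  (fun t => \sum_(k < n) \sum_(l < n) w k * w l * K t (x k) (x l))); last first.
  by move=> t Dt; exact: hK.
apply: has_integral_sum => // k; apply: has_integral_sum => // l.
exact: has_integralZ.
Qed.

Lemma psd_kernel_cvg (K : nat -> T -> T -> R) L :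
  (\forall n \near \oo, psd_kernel (K n)) ->
  (forall x y, (fun n => K n x y) @ \oo --> L x y) -> psd_kernel L.
Proof.
move=> hK KL n x w.
have h : (fun m => \sum_(k < n) \sum_(l < n) w k * w l * K m (x k) (x l)) @ \oo -->
    \sum_(k < n) \sum_(l < n) w k * w l * L (x k) (x l).
  apply: cvg_big; [exact: add_continuous|move=> k _].
  apply: cvg_big; [exact: add_continuous|move=> l _].
  exact: cvgMr.
rewrite -(cvg_lim _ h)//; apply: limr_ge; first by apply/cvg_ex; eexists; exact: h.
by near=> m; have : psd_kernel (K m) by near: m; [].
Unshelve. all: by end_near. Qed.

(* cos(u - v) = cos u cos v + sin u sin v splits the form into two instances of [K]. *)
Lemma psd_kernel_cos K (th : T -> R) : psd_kernel K ->
  psd_kernel (fun x y => K x y * cos (th x - th y)).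
Proof.
move=> hK n x w.
have := addr_ge0 (hK n x (fun k => w k * cos (th (x k))))
  (hK n x (fun k => w k * sin (th (x k)))).
rewrite -big_split /=; under eq_bigr do rewrite -big_split /=.
congr (0 <= _); apply: eq_bigr => k _; apply: eq_bigr => l _.
by rewrite cosB; ring.
Qed.

End Closure.

Lemma psd_kernel_comp (T U : Type) (f : T -> U) (K : U -> U -> R) :
  psd_kernel K -> psd_kernel (fun x y => K (f x) (f y)).
Proof. by move=> hK n x w; exact: (hK n (f \o x) w). Qed.

Lemma fact_double k : (k.*2)`!%:R = 4 ^+ k * poch (1 / 2) k * k`!%:R :> R.
Proof.
rewrite -!poch1 -[X in poch X k.*2](_ : 2 * (1 / 2) = 1); last by field.
by rewrite poch_double; congr (_ * poch _ _); field.
Qed.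

(** The sphere in dimension one is a pair of points, with a cosine as Fourier transform; the power
    series agree through (2m)! = 4^m (1/2)_m m!. *)
Lemma hyp0F1_cos (v : R) : hyp0F1 (1 / 2) (v ^+ 2) = cos (2 * v).
Proof.
have h12 : 0 < 1 / 2 :> R by lra.
suff h : series (fun m => (- v ^+ 2) ^+ m / (m`!%:R * poch (1 / 2) m)) @ \oo -->
    cos (2 * v) by exact: (cvg_unique _ (cvg_hyp0F1 (z := v ^+ 2) h12) h).
have := cvg_cos_coeff' (x := 2 * v); apply: eq_cvg_series => m.
rewrite /cos_coeff' -exprnP fact_double.
have -> : (2 * v) ^+ m.*2 = 4 ^+ m * (v ^+ 2) ^+ m.
  by rewrite -muln2 [(m * 2)%N]mulnC exprM -exprMn; congr (_ ^+ m); ring.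
have h4 : (4 : R) ^+ m != 0 by rewrite expf_neq0.
rewrite [(- v ^+ 2) ^+ m]exprNn.
by field; rewrite fact_neq0 poch_neq0// h4.
Qed.

Lemma cvg_expD_antidiagonal (p q : R) n :
  \sum_(k < n.+1) (p ^+ k / k`!%:R) * (q ^+ (n - k) / (n - k)`!%:R) = (p + q) ^+ n / n`!%:R.
Proof.
rewrite addrC exprDn mulr_suml; apply: eq_bigr => k _.
have kn : (k <= n)%N by rewrite -ltnS.
rewrite -mulr_natl -(bin_fact kn) !natrM; field.
by rewrite !fact_neq0 pnatr_eq0 -lt0n bin_gt0.
Qed.

(** In the Cauchy product of the two series the beta integrals cancel (d)_k and (e)_(n-k), and the
    binomial theorem leaves (s + s')^n. This builds the transform of a sphere from those of spheres
    in complementary coordinates. *)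
Lemma hyp0F1_Beta d e s s' : 0 < d -> 0 < e ->
  has_integral unitI
    (fun u => hyp0F1 d (s * u) * hyp0F1 e (s' * (1 - u)) * (u `^ (d - 1) * (1 - u) `^ (e - 1)))
    (Gamma d * Gamma e / Gamma (d + e) * hyp0F1 (d + e) (s + s')).
Proof.
move=> d0 e0; have de0 : 0 < d + e by rewrite addr_gt0.
pose xc i := (- s) ^+ i / (i`!%:R * poch d i).
pose yc j := (- s') ^+ j / (j`!%:R * poch e j).
pose f n u := \sum_(k < n.+1) (xc k * yc (n - k)%N) *
  (u `^ (d + k%:R - 1) * (1 - u) `^ (e + (n - k)%:R - 1)).
pose B0 := Gamma d * Gamma e / Gamma (d + e).
pose K := (Num.min 1 d)^-1 * (Num.min 1 e)^-1.
have K0 : 0 <= K by rewrite mulr_ge0// invr_ge0 le_min ler01 ltW.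
have beta x y : 0 < x -> 0 < y -> has_integral unitI
    (fun t => t `^ (x - 1) * (1 - t) `^ (y - 1)) (Gamma x * Gamma y / Gamma (x + y)).
  move=> x0 y0; apply: has_integral_ge0E => //; last exact: integral_Beta.
  - exact: measurable_powR_powR1B.
  - by move=> t _; nonneg.
have pow k n t : (k <= n)%N -> unitI t ->
    t `^ (d + k%:R - 1) * (1 - t) `^ (e + (n - k)%:R - 1) =
    (t ^+ k * (1 - t) ^+ (n - k)) * (t `^ (d - 1) * (1 - t) `^ (e - 1)).
  move=> kn; rewrite /= in_itv/= => /andP[t0 t1].
  by rewrite !powRDn ?subr_gt0//; ring.
have [l Fl Il] : exists2 l, has_integral unitI (fun u => hyp0F1 d (s * u) *
      hyp0F1 e (s' * (1 - u)) * (u `^ (d - 1) * (1 - u) `^ (e - 1))) l &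
    series (fun n => \sum_(k < n.+1) (xc k * yc (n - k)%N) *
      (Gamma (d + k%:R) * Gamma (e + (n - k)%:R) / Gamma (d + k%:R + (e + (n - k)%:R))))
      @ \oo --> l.
  apply: (@has_integral_series _ unitI f _
    (fun n => K * ((`|s| + `|s'|) ^+ n / n`!%:R) * B0)) => //.
  - move=> n; apply: has_integral_sum => // k; apply: has_integralZ => //.
    by apply: beta; rewrite ltr_wpDr.
  - move=> n; exists (fun u => K * ((`|s| + `|s'|) ^+ n / n`!%:R) *
        (u `^ (d - 1) * (1 - u) `^ (e - 1))); split.
      by apply: has_integralZ => //; exact: beta.
    move=> t tI; have /andP[t0 t1] : 0 < t < 1 by move: tI; rewrite /= in_itv.
    apply: le_trans (ler_norm_sum _ _ _) _.
    rewrite -cvg_expD_antidiagonal mulr_sumr mulr_suml; apply: ler_sum => k _.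
    have kn : (k <= n)%N by rewrite -ltnS.
    have w0 : 0 <= t `^ (d - 1) * (1 - t) `^ (e - 1) by nonneg.
    rewrite pow// [xc k * _ * _]mulrA normrM (ger0_norm w0); apply: ler_wpM2r => //.
    rewrite normrM -[leRHS]mulr1; apply: ler_pM => //.
      rewrite normrM /K mulrACA; by apply: ler_pM => //; [exact: (hyp0F1_term_le s k d0)|exact: (hyp0F1_term_le s' _ e0)].
    rewrite ger0_norm; last by rewrite mulr_ge0// exprn_ge0// ?subr_ge0 ltW.
    by rewrite mulr_ile1 ?exprn_ge0 ?exprn_ile1 ?subr_ge0 ?gerBl ?ltW.
  - apply/cvg_ex; have /cvg_ex[/= b Bb] := @is_cvg_exp_majorant R K (`|s| + `|s'|).
    exists (B0 * b); have := cvg_seriesZ (k := B0) Bb.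
    by apply: eq_cvg_series => n; rewrite mulrC.
  - move=> t tI; have /andP[t0 t1] : 0 < t < 1 by move: tI; rewrite /= in_itv.
    have := cvg_series_Cauchy (fun m => @hyp0F1_term_le R d (s * t) m d0)
      (fun m => @hyp0F1_term_le R e (s' * (1 - t)) m e0)
      (@is_cvg_exp_majorant R _ _) (@is_cvg_exp_majorant R _ _)
      (cvg_hyp0F1 (z := s * t) d0) (cvg_hyp0F1 (z := s' * (1 - t)) e0).
    move=> /(cvg_seriesZ (k := t `^ (d - 1) * (1 - t) `^ (e - 1))).
    rewrite [X in _ --> X]mulrC; apply: eq_cvg_series => n.
    rewrite mulr_sumr; apply: eq_bigr => k _.
    have kn : (k <= n)%N by rewrite -ltnS.
    rewrite pow// /xc /yc -!mulNr !exprMn; ring.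
have <- // : l = Gamma d * Gamma e / Gamma (d + e) * hyp0F1 (d + e) (s + s').
have := cvg_seriesZ (k := B0) (cvg_hyp0F1 (z := s + s') de0).
move=> h; apply: (cvg_unique _ Il) => //; apply: eq_cvg_series h => n.
have -> : B0 * ((- (s + s')) ^+ n / (n`!%:R * poch (d + e) n)) =
    B0 / poch (d + e) n * ((- s + - s') ^+ n / n`!%:R).
  by rewrite opprD; field; rewrite fact_neq0 poch_neq0.
rewrite -cvg_expD_antidiagonal mulr_sumr; apply: eq_bigr => k _.
have kn : (k <= n)%N by rewrite -ltnS.
have -> : d + k%:R + (e + (n - k)%:R) = d + e + n%:R by rewrite natrB//; ring.
rewrite !GammaDn// /xc /yc /B0.
move: (lt0r_neq0 (Gamma_gt0 de0)).
move: (@fact_neq0 R k) (@fact_neq0 R (n - k)) (poch_neq0 k d0) (poch_neq0 (n - k) e0) (poch_neq0 n de0).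
move: (Gamma (d + e)) (Gamma d) (Gamma e) (poch d k) (poch e (n - k)) (poch (d + e) n).
move=> x y z u v w h1 h2 h3 h4 h5 h6.
by field; rewrite h1 h2 h3 h4 h5 h6.
Qed.

(** Points are sequences of which the first d coordinates count, so that all dimensions share one
    type in the induction on d. *)
Definition sqdist d (x y : nat -> R) : R := \sum_(i < d) (x i - y i) ^+ 2.

Lemma sqdist_ge0 d x y : 0 <= sqdist d x y.
Proof. by apply: sumr_ge0 => i _; rewrite sqr_ge0. Qed.

(* Induction on the dimension: splitting off one coordinate amounts to a beta
   mixture of products with a cosine. *)
Lemma psd_hyp0F1 d : (0 < d)%N ->
  psd_kernel (fun x y : nat -> R => hyp0F1 (d%:R / 2) (sqdist d x y)).
Proof.
have cst1 : psd_kernel (fun _ _ : nat -> R => 1).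
  move=> n x w; rewrite (_ : \sum_(k < n) _ = (\sum_(k < n) w k) ^+ 2) ?sqr_ge0//.
  rewrite expr2 mulr_suml; apply: eq_bigr => k _; rewrite mulr_sumr.
  by apply: eq_bigr => l _; rewrite mulr1.
case: d => // d _; elim: d => [|d IH].
  apply: eq_psd_kernel (psd_kernel_cos (fun x => 2 * x 0%N) cst1) => x y.
  by rewrite /sqdist big_ord1 mul1r -mulrBr -hyp0F1_cos.
have d0 : 0 < d.+1%:R / 2 :> R by rewrite divr_gt0.
have h12 : 0 < 1 / 2 :> R by lra.
pose C : R := Gamma (d.+1%:R / 2) * Gamma (1 / 2) / Gamma (d.+1%:R / 2 + 1 / 2).
have C0 : 0 < C by rewrite divr_gt0 ?mulr_gt0 ?Gamma_gt0 ?addr_gt0.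
have CL : psd_kernel (fun x y => C * hyp0F1 (d.+2%:R / 2) (sqdist d.+2 x y)).
  apply: (@psd_kernel_integral _ unitI (fun u x y =>
    hyp0F1 (d.+1%:R / 2) (sqdist d.+1 x y * u) *
    hyp0F1 (1 / 2) ((x d.+1 - y d.+1) ^+ 2 * (1 - u)) *
    (u `^ (d.+1%:R / 2 - 1) * (1 - u) `^ (1 / 2 - 1)))) => //; last first.
    move=> x y.
    have -> : sqdist d.+2 x y = sqdist d.+1 x y + (x d.+1 - y d.+1) ^+ 2.
      by rewrite /sqdist big_ord_recr.
    have -> : d.+2%:R / 2 = d.+1%:R / 2 + 1 / 2 :> R.
      by rewrite -[d.+2%:R]natr1; field.
    exact: hyp0F1_Beta.
  move=> u; rewrite /= in_itv/= => /andP[u0 u1].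
  (* The mixing variable acts by dilation: sqrt(u) on the first coordinates, which allows the
     induction hypothesis, and sqrt(1 - u) in the phase of the cosine. *)
  pose sc (x : nat -> R) i := Num.sqrt u * x i.
  have h1 := psd_kernel_comp sc IH.
  have h2 := psd_kernel_cos (fun x => 2 * (Num.sqrt (1 - u) * x d.+1)) h1.
  have w0 : 0 <= u `^ (d.+1%:R / 2 - 1) * (1 - u) `^ (1 / 2 - 1) by nonneg.
  apply: eq_psd_kernel (psd_kernelZ w0 h2) => x y.
  rewrite [LHS]mulrC; congr (_ * _ * _).
    congr hyp0F1; rewrite /sqdist mulr_suml; apply: eq_bigr => i _.
    by rewrite /sc -mulrBr exprMn sqr_sqrtr 1?mulrC// ltW.
  rewrite -!mulrBr -hyp0F1_cos exprMn sqr_sqrtr ?subr_ge0 ?(ltW u1)//.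
  by rewrite [X in _ = hyp0F1 _ X]mulrC.
have Ci : 0 <= C^-1 by rewrite invr_ge0 ltW.
apply: eq_psd_kernel (psd_kernelZ Ci CL) => x y.
by rewrite mulKf// gt_eqF.
Qed.

Lemma hyp0F1_0 (d : R) : hyp0F1 d 0 = 1.
Proof.
apply/cvg_lim => //; apply: cvg_near_cst; near=> n.
have n0 : (1 <= n)%N by near: n; exact: nbhs_infty_ge.
rewrite /series /= -(prednK n0) big_nat_recl// oppr0 expr0 fact0 poch0 mulr1 divff//.
by rewrite big1 ?addr0// => i _; rewrite expr0n /= mul0r.
Unshelve. all: by end_near. Qed.

(** Positive semidefiniteness at two points of squared distance z, with weights (1, 1) and (1,
    -1). *)
Lemma normr_hyp0F1_le1 d (z : R) : (0 < d)%N -> 0 <= z -> `|hyp0F1 (d%:R / 2) z| <= 1.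
Proof.
case: d => // d d0 z0.
pose c (k : 'I_2) : R := if k == ord0 then 0 else Num.sqrt z.
pose x (k : 'I_2) (i : nat) : R := if i == 0%N then c k else 0.
have xE k l : sqdist d.+1 (x k) (x l) = (c k - c l) ^+ 2.
  by rewrite /sqdist big_ord_recl big1 ?addr0// => i _; rewrite /x /= subrr expr0n.
have key (e : R) : e ^+ 2 = 1 -> 0 <= 2 + 2 * (e * hyp0F1 (d.+1%:R / 2) z).
  move=> e2; have := psd_hyp0F1 d0 x (fun k => if k == ord0 then 1 else e).
  rewrite !big_ord_recl !big_ord0 !xE /c /= !subrr expr0n /= hyp0F1_0 subr0 sub0r sqrrN.
  rewrite sqr_sqrtr//; congr (0 <= _).
  transitivity (1 + e ^+ 2 + 2 * (e * hyp0F1 (d.+1%:R / 2) z)); first by ring.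
  by rewrite e2; ring.
have h1 := key 1 (expr1n _ _); have h2 := key (-1) (sqrr_sign _ 1).
by rewrite ler_norml; apply/andP; split; lra.
Qed.

End PositiveSemidefinite.

(** * Radial functions with nonnegative transform *)

Section LaplaceTransforms.
Context {R : realType}.
Implicit Types (D E : set R) (f g : R -> R) (l p s t d : R).
Local Notation pos := (`]0%R, +oo[%classic : set R).
Local Notation unitI := (`]0%R, 1%R[%classic : set R).
Local Notation poch := (@pochhammer R).

Lemma has_integral_Gamma x p : 0 < x -> 0 < p ->
  has_integral pos (fun t => t `^ (x - 1) * expR (- (t / p))) (Gamma x * p `^ x).
Proof.
move=> x0 p0; have -> : p `^ x = p^-1 `^ (- x).
  by rewrite -powR_inv1 ?ltW// -powRrM mulN1r opprK.
apply: (@eq_has_integral _ _ (fun t => t `^ (x - 1) * expR (- (p^-1 * t)))) => //.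
  by move=> t _; rewrite [t / p]mulrC.
apply: has_integral_ge0E => //.
- exact: measurable_powR_expR.
- by move=> t _; nonneg.
- by apply: integral_Gamma_scale => //; rewrite invr_gt0.
Qed.

Lemma has_integral_powR x : 0 < x ->
  has_integral unitI (fun t => t `^ (x - 1)) x^-1.
Proof.
move=> x0.
have e : x^-1 = Gamma x * Gamma 1 / Gamma (x + 1).
  have G1 : Gamma 1 = 1 :> R.
    by apply: EFin_inj; rewrite -egammaE ?ltr01// egamma1.
  rewrite G1 GammaD1//; field.
  by rewrite !gt_eqF// Gamma_gt0.
rewrite e; apply: has_integral_ge0E => //.
- exact: measurable_funTS (measurable_powR _).
- by move=> t _; nonneg.
- rewrite -integral_Beta//; apply: eq_integral => t _.
  by rewrite subrr powRr0 mulr1.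
Qed.

Lemma has_integral_extend D E f l : measurable D -> measurable E -> D `<=` E ->
  (forall t, E t -> ~ D t -> f t = 0) -> has_integral D f l -> has_integral E f l.
Proof.
move=> mD mE DE f0 [fi <-].
have eqE : (EFin \o f) \_ E = (EFin \o f) \_ D.
  apply/funext => t; rewrite /patch; have [Dt|Dt] := pselect (D t).
    by rewrite !mem_set//; exact: DE.
  rewrite [t \in D]memNset//; case: ifPn => // /set_mem Et /=.
  by rewrite f0.
split; last first.
  rewrite /Rintegral; congr fine.
  by rewrite integral_mkcond [RHS]integral_mkcond -[X in integral _ _ X]/(_ \_ _) eqE.
apply/integrable_mkcond => //; rewrite eqE.
by move/integrable_mkcond: fi; apply.
Qed.

Lemma powR_Dn x p n : 0 < p -> p `^ (x + n%:R) = p `^ x * p ^+ n.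
Proof.
move=> p0; have pn0 : p != 0 by rewrite gt_eqF.
by rewrite powRD ?pn0 ?implybT// powR_mulrn// ltW.
Qed.

(** Termwise integration gives 1F1(d + n; d; -sp), and Kummer's transformation exhibits its
    exponential decay. The majorant is the series at |s| without signs, summable by the same
    formula. *)
Lemma has_integral_hyp0F1_Gamma d s p n : 0 < d -> 0 < p ->
  has_integral pos (fun t => hyp0F1 d (s * t) * (t `^ (d + n%:R - 1) * expR (- (t / p))))
    (Gamma (d + n%:R) * p `^ (d + n%:R) *
      ((\sum_(k < n.+1) 'C(n, k)%:R * (- (s * p)) ^+ k / poch d k) * expR (- (s * p)))).
Proof.
move=> d0 p0; have dn0 : 0 < d + n%:R by rewrite ltr_wpDr.
pose c (y : R) m := y ^+ m / (m`!%:R * poch d m).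
pose f m t := c (- s) m * (t `^ (d + n%:R + m%:R - 1) * expR (- (t / p))).
pose J y m := c y m * (Gamma (d + n%:R + m%:R) * p `^ (d + n%:R + m%:R)).
have fI y m : has_integral pos (fun t =>
    c y m * (t `^ (d + n%:R + m%:R - 1) * expR (- (t / p)))) (J y m).
  by apply: has_integralZ => //; apply: has_integral_Gamma => //; rewrite ltr_wpDr.
have sJ y : series (J y) @ \oo --> Gamma (d + n%:R) * p `^ (d + n%:R) *
      ((\sum_(k < n.+1) 'C(n, k)%:R * (y * p) ^+ k / poch d k) * expR (y * p)).
  have := cvg_seriesZ (k := Gamma (d + n%:R) * p `^ (d + n%:R))
    (cvg_Kummer (x := y * p) (n := n) d0).
  apply: eq_cvg_series => m; rewrite /J /c (@GammaDn _ (d + n%:R) m)//.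
  rewrite (@powR_Dn (d + n%:R) p m)// exprMn.
  by field; rewrite fact_neq0 poch_neq0.
have [l Fl Jl] : exists2 l, has_integral pos (fun t => hyp0F1 d (s * t) *
    (t `^ (d + n%:R - 1) * expR (- (t / p)))) l & series (J (- s)) @ \oo --> l.
  apply: (@has_integral_series _ _ f _ (J `|s|)) => //.
  - by move=> m; exact: fI.
  - move=> m; exists (fun t => c `|s| m * (t `^ (d + n%:R + m%:R - 1) * expR (- (t / p)))).
    split; first exact: fI.
    move=> t _; have w0 : 0 <= t `^ (d + n%:R + m%:R - 1) * expR (- (t / p)) by nonneg.
    rewrite /f normrM (ger0_norm w0); apply: ler_wpM2r => //.
    have q0 : 0 <= m`!%:R * poch d m by rewrite mulr_ge0// ltW// poch_gt0.
    by rewrite /c normrM normrX normrN normfV (ger0_norm q0).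
  - by apply/cvg_ex; eexists; exact: sJ.
  - move=> t; rewrite /= in_itv/= andbT => t0.
    have := cvg_seriesZ (k := t `^ (d + n%:R - 1) * expR (- (t / p)))
      (cvg_hyp0F1 (z := s * t) d0).
    rewrite [X in _ --> X]mulrC; apply: eq_cvg_series => m.
    by rewrite /f /c (@powRDn _ (d + n%:R) t m)// -[- (s * t)]mulNr exprMn; ring.
have := sJ (- s); rewrite mulNr => h.
by rewrite -(cvg_unique _ Jl h).
Qed.

Lemma cvg_series_shift (u v : nat -> R) l : u 0%N = 0 -> (forall n, u n.+1 = v n) ->
  series v @ \oo --> l -> series u @ \oo --> l.
Proof.
move=> u0 uv vl; rewrite -(cvg_shiftn 1).
suff -> : (fun n => series u (n + 1)%N) = series v by [].
apply/funext => n; rewrite addn1 /series /= big_nat_recl// u0 add0r.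
by apply: eq_bigr => i _; rewrite uv.
Qed.

(** This and the next lemma are the factorial moments of a Poisson law up to the factor exp(-x),
    used for the variance in [gauss_smoothing_approx]. *)
Lemma cvg_series_poisson1 (x : R) :
  series (fun k => k%:R * (x ^+ k / k`!%:R)) @ \oo --> x * expR x.
Proof.
apply: (@cvg_series_shift _ (fun k => x * (x ^+ k / k`!%:R))); first by rewrite mul0r.
  move=> k; rewrite factS natrM exprS -[k.+1%:R]natr1; field.
  by rewrite fact_neq0 natr1 pnatr_eq0.
by apply: cvg_seriesZ; exact: cvg_series_expR.
Qed.

Lemma cvg_series_poisson2 (x : R) :
  series (fun k => k%:R * (k%:R - 1) * (x ^+ k / k`!%:R)) @ \oo --> x ^+ 2 * expR x.
Proof.
apply: (@cvg_series_shift _ (fun k => x * (k%:R * (x ^+ k / k`!%:R)))).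
- by rewrite !mul0r.
- move=> k; rewrite factS natrM exprS -![k.+1%:R]natr1 addrK; field.
  by rewrite fact_neq0 natr1 pnatr_eq0.
- by rewrite expr2 -mulrA; apply: cvg_seriesZ; exact: cvg_series_poisson1.
Qed.

End LaplaceTransforms.

(** * From a nonnegative radial transform to positive semidefiniteness *)

Section RadialTransform.
Context {R : realType}.
Local Notation mu := (@lebesgue_measure R).
Local Notation pos := (`]0%R, +oo[%classic : set R).
Local Notation unitI := (`]0%R, 1%R[%classic : set R).
Local Notation poch := (@pochhammer R).
(** [g] is a function of the squared radius. Up to scaling, [gh] is its radial Fourier transform,
    the integral of g(s) 0F1(; d; -ts) s^(d-1) ds, given only as the power series with the moments
    [c]. *)
Context (dim : nat) (g gh : R -> R) (M : R) (c : nat -> R) (dim0 : (0 < dim)%N).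
Let d : R := dim%:R / 2.
Context (gM : forall t, `|g t| <= M) (cg : continuous g) (g1 : forall t, 1 <= t -> g t = 0).
Context (cE : forall n, has_integral unitI (fun s => g s * s `^ (d + n%:R - 1)) (c n)).
Context (ghE : forall t : R, 0 < t ->
  series (fun n => c n * (- t) ^+ n / (n`!%:R * poch d n)) @ \oo --> gh t).
Context (gh0 : forall t : R, 0 < t -> 0 <= gh t).

Let d0 : 0 < d. Proof. by rewrite divr_gt0// ltr0n. Qed.
Let M0 : 0 <= M. Proof. exact: le_trans (normr_ge0 _) (gM 0). Qed.
Let mg : measurable_fun [set: R] g. Proof. exact: continuous_measurable_fun. Qed.
Let dn0 n : 0 < d + n%:R. Proof. by rewrite ltr_wpDr. Qed.

Let unit_bound n t : unitI t -> `|g t * t `^ (d + n%:R - 1)| <= M * t `^ (d - 1).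
Proof.
rewrite /= in_itv/= => /andP[t0 t1].
rewrite powRDn// normrM; apply: ler_pM => //.
rewrite ger0_norm; last by nonneg.
by rewrite ler_piMr ?powR_ge0// exprn_ile1// ltW.
Qed.

Let Mint : has_integral unitI (fun t => M * t `^ (d - 1)) (M * d^-1).
Proof. by apply: has_integralZ => //; exact: has_integral_powR. Qed.

Lemma moment_le n : `|c n| <= M * d^-1.
Proof.
have [l' h1 h2] := has_integral_dom (measurable_itv _)
  (has_integral_measurable (cE n)) Mint (unit_bound n).
by rewrite (has_integral_unique (cE n) h1).
Qed.

Let w k p t : R := t `^ (d + k%:R - 1) * expR (- (t / p)).

Let smooth k p := \int[mu]_(t in pos) (g t * w k p t).

(** [g] vanishes beyond 1, so the integral lives on the unit interval, where expanding exp(-t/p)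
    involves nothing but moments of [g]. *)
Lemma smooth_series k p : 0 < p ->
  has_integral pos (fun t => g t * w k p t) (smooth k p) /\
  series (fun j => (- p^-1) ^+ j / j`!%:R * c (k + j)%N) @ \oo --> smooth k p.
Proof.
move=> p0.
pose f j t := (- p^-1) ^+ j / j`!%:R * (g t * t `^ (d + (k + j)%:R - 1)).
pose e j := `|p^-1| ^+ j / j`!%:R.
have [l Fl Il] : exists2 l, has_integral unitI (fun t => g t * w k p t) l &
    series (fun j => (- p^-1) ^+ j / j`!%:R * c (k + j)%N) @ \oo --> l.
  apply: (@has_integral_series _ unitI f _ (fun j => e j * (M * d^-1))) => //.
  - by move=> j; apply: has_integralZ => //; exact: cE.
  - move=> j; exists (fun t => e j * (M * t `^ (d - 1))); split.
      exact: has_integralZ.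
    move=> t tI; rewrite /f normrM; apply: ler_pM => //.
      by rewrite normrM normrX normrN [`|_`!%:R^-1|]ger0_norm.
    exact: unit_bound.
  - have := @is_cvg_exp_majorant R (M * d^-1) `|p^-1|.
    by under eq_fun do rewrite mulrC.
  - move=> t; rewrite /= in_itv/= => /andP[t0 t1].
    have := cvg_seriesZ (k := g t * t `^ (d + k%:R - 1))
      (cvg_series_expR (x := - (t / p))).
    rewrite -mulrA; apply: eq_cvg_series => j.
    rewrite /f natrD addrA (@powRDn _ (d + k%:R) t j)// -[- (t / p)]mulrN exprMn.
    ring.
have Fl' : has_integral pos (fun t => g t * w k p t) l.
  apply: has_integral_extend Fl => //.
    by move=> t; rewrite /= !in_itv/= andbT => /andP[].
  move=> t; rewrite /= !in_itv/= andbT => t0 /negP; rewrite t0 /= -leNgt => t1.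
  by rewrite g1// mul0r.
have lE : smooth k p = l by case: Fl'.
by rewrite lE.
Qed.

(* [mean k p] averages [g] against the gamma law of shape [d + k] and scale [p];
   mixing over a Poisson index [k] of parameter [s / p] is Gaussian smoothing. *)
Let mean k p := smooth k p / (Gamma (d + k%:R) * p `^ (d + k%:R)).
Let lam p s : R := s / p.

(** The pivot: both sides are the same double series. On the transform side n indexes the moments
    and k <= n the polynomial from Kummer's transformation. With j = n - k, the sum over j gives
    [smooth k p], and the sum over k carries the weights (s/p)^k / k!. *)
Lemma smoothing_transform p s : 0 < p -> 0 <= s ->
  exists2 l, series (fun k => lam p s ^+ k / k`!%:R * mean k p) @ \oo --> l &
  has_integral pos (fun t => hyp0F1 d (s * t) * (gh t * (t `^ (d - 1) * expR (- (t / p^-1)))))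
    (Gamma d ^+ 2 * (expR (- lam p s) * l)).
Proof.
move=> p0 s0; set L := lam p s; set q := p^-1.
have q0 : 0 < q by rewrite invr_gt0.
have L0 : 0 <= L by rewrite divr_ge0// ltW.
have Mc n := moment_le n; set K := M * d^-1 in Mc.
have K0 : 0 <= K by rewrite mulr_ge0// invr_ge0 ltW.
pose J n := Gamma (d + n%:R) * q `^ (d + n%:R) *
  ((\sum_(k < n.+1) 'C(n, k)%:R * (- (s * q)) ^+ k / poch d k) * expR (- (s * q))).
pose f n t := (-1) ^+ n * c n / (n`!%:R * poch d n) *
  (hyp0F1 d (s * t) * (t `^ (d + n%:R - 1) * expR (- (t / q)))).
have [A FA IA] : exists2 A,
    has_integral pos (fun t => hyp0F1 d (s * t) * (gh t * (t `^ (d - 1) * expR (- (t / q))))) A &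
    series (fun n => (-1) ^+ n * c n / (n`!%:R * poch d n) * J n) @ \oo --> A.
  (* Since |0F1| <= 1, the majorants are plain gamma integrals, with sum K Gamma(d) q^d exp(q). *)
  apply: (@has_integral_series _ pos f _
    (fun n => K / (n`!%:R * poch d n) * (Gamma (d + n%:R) * q `^ (d + n%:R)))) => //.
  - by move=> n; apply: has_integralZ => //; exact: has_integral_hyp0F1_Gamma.
  - move=> n; exists (fun t => K / (n`!%:R * poch d n) *
      (t `^ (d + n%:R - 1) * expR (- (t / q)))); split.
      by apply: has_integralZ => //; exact: has_integral_Gamma.
    move=> t; rewrite /= in_itv/= andbT => t0.
    have qp : 0 <= n`!%:R * poch d n by rewrite mulr_ge0// ltW// poch_gt0.
    have w0 : 0 <= t `^ (d + n%:R - 1) * expR (- (t / q)) by nonneg.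
    rewrite /f normrM; apply: ler_pM => //.
      rewrite !normrM normrX normrN1 expr1n mul1r normfV (ger0_norm qp).
      by apply: ler_wpM2r => //; rewrite invr_ge0.
    rewrite normrM (ger0_norm w0) -[leRHS]mul1r; apply: ler_wpM2r => //.
    by apply: normr_hyp0F1_le1 => //; rewrite mulr_ge0// ltW.
  - apply/cvg_ex; eexists.
    have := cvg_seriesZ (k := K * Gamma d * q `^ d) (cvg_series_expR (x := q)).
    apply: eq_cvg_series => n; rewrite GammaDn// powR_Dn//.
    by field; rewrite fact_neq0 poch_neq0.
  - move=> t; rewrite /= in_itv/= andbT => t0.
    have := cvg_seriesZ (k := hyp0F1 d (s * t) * (t `^ (d - 1) * expR (- (t / q)))) (ghE t0).
    have -> : hyp0F1 d (s * t) * (gh t * (t `^ (d - 1) * expR (- (t / q)))) =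
      hyp0F1 d (s * t) * (t `^ (d - 1) * expR (- (t / q))) * gh t by ring.
    apply: eq_cvg_series => n; rewrite /f powRDn// [(- t) ^+ n]exprNn; ring.
(* For n = k + j one has C(n, k) / n! = 1 / (k! j!), and Gamma(d + n) / (d)_n = Gamma(d) leaves
   (d)_k as the only Pochhammer symbol. *)
pose u k j := (- q) ^+ (k + j) * c (k + j)%N * (- L) ^+ k / (k`!%:R * j`!%:R * poch d k).
pose r k := (- q) ^+ k * (- L) ^+ k / (k`!%:R * poch d k) * smooth k p.
pose C := Num.min 1 d.
have C0 : 0 <= C^-1 by rewrite invr_ge0 le_min ler01 ltW.
pose Au k := C^-1 * ((q * L) ^+ k / k`!%:R).
pose Bu j := K * (q ^+ j / j`!%:R).
have Au0 k : 0 <= Au k by rewrite /Au; nonneg; exact: mulr_ge0 (ltW q0) L0.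
have Bu0 k : 0 <= Bu k by rewrite /Bu; nonneg.
have coef_le k : `|(- q) ^+ k * (- L) ^+ k / (k`!%:R * poch d k)| <= Au k.
  rewrite normrM normfV normrM !normrX !normrN (ger0_norm (ltW q0)) (ger0_norm L0) -exprMn.
  rewrite normrM normr_nat (ger0_norm (ltW (poch_gt0 k d0))) invfM mulrA [leRHS]mulrC.
  by apply: ler_wpM2l; [nonneg; exact: mulr_ge0 (ltW q0) L0|exact: poch_inv_le].
have uAB k j : `|u k j| <= Au k * Bu j.
  have -> : u k j = (- q) ^+ k * (- L) ^+ k / (k`!%:R * poch d k) *
      ((- q) ^+ j / j`!%:R * c (k + j)%N).
    by rewrite /u exprD; field; rewrite !fact_neq0 poch_neq0.
  rewrite normrM; apply: ler_pM => //.
  rewrite normrM /Bu [leRHS]mulrC; apply: ler_pM => //.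
  by rewrite normrM normrX normrN (ger0_norm (ltW q0)) [`|_`!%:R^-1|]ger0_norm.
have ur k : series (u k) @ \oo --> r k.
  have [_ h] := smooth_series k p0.
  have := cvg_seriesZ (k := (- q) ^+ k * (- L) ^+ k / (k`!%:R * poch d k)) h.
  apply: eq_cvg_series => j; rewrite /u exprD /q.
  by field; rewrite !fact_neq0 poch_neq0// gt_eqF.
have cA : cvgn (series Au) by exact: is_cvg_exp_majorant.
have cB : cvgn (series Bu) by exact: is_cvg_exp_majorant.
have [l rl] : exists l : R, series r @ \oo --> l.
  apply/cvg_ex; have /cvg_ex[/= b Bb] := cB.
  have cAb : cvgn (series (fun k => b * Au k)).
    by have /cvg_ex[/= a Aa] := cA; apply/cvg_ex; exists (b * a); exact: cvg_seriesZ.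
  apply: is_cvg_series_dom cAb => k; rewrite [leRHS]mulrC normrM; apply: ler_pM => //.
  have [_ h] := smooth_series k p0.
  apply: normr_series_lim_le _ h Bb => j.
  rewrite normrM /Bu [leRHS]mulrC; apply: ler_pM => //.
  by rewrite normrM normrX normrN (ger0_norm (ltW q0)) [`|_`!%:R^-1|]ger0_norm.
have tri := cvg_series_antidiagonal Au0 Bu0 uAB cA cB ur rl.
have G0 := Gamma_gt0 d0.
have pd0 : 0 < p `^ d by exact: powR_gt0.
have AE : A = Gamma d * q `^ d * expR (- L) * l.
  apply: (cvg_unique _ IA) => //.
  have := cvg_seriesZ (k := Gamma d * q `^ d * expR (- L)) tri.
  apply: eq_cvg_series => n; rewrite /J GammaDn// powR_Dn//.
  rewrite mulr_sumr mulr_suml !mulr_sumr; apply: eq_bigr => k _.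
  have kn : (k <= n)%N by rewrite -ltnS.
  rewrite /u subnKC// -(bin_fact kn) !natrM -/L [(- q) ^+ n]exprNn.
  field; rewrite !fact_neq0 !poch_neq0//=.
  by rewrite pnatr_eq0 -lt0n bin_gt0.
exists ((Gamma d * p `^ d)^-1 * l).
  have := cvg_seriesZ (k := (Gamma d * p `^ d)^-1) rl.
  apply: eq_cvg_series => k; rewrite /r /mean GammaDn// powR_Dn//.
  rewrite -exprMn mulrNN exprMn /q exprVn.
  have pk0 : p ^+ k != 0 by rewrite expf_neq0// gt_eqF.
  by field; rewrite pk0 fact_neq0 poch_neq0// !gt_eqF.
have -> : Gamma d ^+ 2 * (expR (- L) * ((Gamma d * p `^ d)^-1 * l)) = A => //.
have qd : q `^ d = (p `^ d)^-1.
  apply: (mulfI (lt0r_neq0 pd0)); rewrite -powRM ?ltW// mulfV ?gt_eqF// powR1.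
  by rewrite mulfV// gt_eqF.
rewrite AE qd.
by field; rewrite !gt_eqF.
Qed.

(** The averaging law is a scaled noncentral chi-square law: that of |x + N|^2 with |x|^2 = s and N
    Gaussian of variance p/2 in each coordinate. *)
Definition gauss_smoothing p s :=
  expR (- lam p s) * limn (series (fun k => lam p s ^+ k / k`!%:R * mean k p)).

Lemma psd_gauss_smoothing p : 0 < p ->
  psd_kernel (fun x y : nat -> R => gauss_smoothing p (sqdist dim x y)).
Proof.
move=> p0; have G2 : 0 < Gamma d ^+ 2 by rewrite exprn_gt0// Gamma_gt0.
have G2i : 0 <= (Gamma d ^+ 2)^-1 by rewrite invr_ge0 ltW.
have h : psd_kernel (fun x y : nat -> R => Gamma d ^+ 2 * gauss_smoothing p (sqdist dim x y)).
  apply: (@psd_kernel_integral _ _ pos (fun t x y => hyp0F1 d (sqdist dim x y * t) *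
    (gh t * (t `^ (d - 1) * expR (- (t / p^-1)))))) => //; last first.
    move=> x y; have [l sl hl] := smoothing_transform p0 (sqdist_ge0 dim x y).
    by rewrite /gauss_smoothing (cvg_lim _ sl).
  move=> t; rewrite /= in_itv/= andbT => t0.
  pose sc (x : nat -> R) i := Num.sqrt t * x i.
  have w0 : 0 <= gh t * (t `^ (d - 1) * expR (- (t / p^-1))).
    by rewrite mulr_ge0 ?gh0//; nonneg.
  apply: eq_psd_kernel (psd_kernelZ w0 (psd_kernel_comp sc (psd_hyp0F1 dim0))) => x y.
  rewrite [LHS]mulrC; congr (hyp0F1 _ _ * _).
  rewrite /sqdist mulr_suml; apply: eq_bigr => i _.
  by rewrite /sc -mulrBr exprMn sqr_sqrtr 1?mulrC// ltW.
by apply: eq_psd_kernel (psd_kernelZ G2i h) => x y; rewrite mulKf// gt_eqF.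
Qed.

(* Chebyshev's argument: the variance of the smoothing law about [s] is
   [2 s p + d (d + 1) p^2]. *)
Lemma gauss_smoothing_approx (s e : R) : 0 <= s -> 0 < e ->
  exists2 C, 0 <= C & forall p, 0 < p ->
    `|gauss_smoothing p s - g s| <= e + C * (2 * s * p + d * (d + 1) * p ^+ 2).
Proof.
move=> s0 e0.
have [r /= r0 gr] : exists2 r, 0 < r & forall t, `|s - t| < r -> `|g t - g s| <= e.
  have gs : g @ s --> g s by exact: cg.
  have /cvgrPdist_le/(_ _ e0) := gs; rewrite near_simpl => -[r r0 hr].
  by exists r => // t tr; rewrite distrC; exact: hr.
(* At distance at least r from s, the trivial bound 2 M on |g t - g s| is at most C (t - s)^2. *)
pose C := 2 * M / r ^+ 2.
have C0 : 0 <= C by apply: divr_ge0; [apply: mulr_ge0|exact: sqr_ge0].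
have gC t : `|g t - g s| <= e + C * (t - s) ^+ 2.
  have [tr|tr] := ltP `|s - t| r.
    by apply: le_trans (gr _ tr) _; rewrite lerDl; apply: mulr_ge0 => //; exact: sqr_ge0.
  apply: (@le_trans _ _ (2 * M)).
    apply: le_trans (ler_normB _ _) _.
    by have := gM t; have := gM s; lra.
  apply: ler_wpDl; first exact: ltW.
  rewrite /C -[leLHS]mulr1 -!mulrA; apply: ler_wpM2l => //; apply: ler_wpM2l => //.
  rewrite mulrC ler_pdivlMr ?exprn_gt0// mul1r -[(t - s) ^+ 2]real_normK ?num_real// distrC.
  by rewrite ler_sqr ?nnegrE ?normr_ge0//; exact: ltW.
exists C => // p p0.
(* Second moment about s of the gamma law of shape d + k and scale p. *)
pose P k := p ^+ 2 * ((d + k%:R) * (d + k%:R + 1)) - 2 * s * p * (d + k%:R) + s ^+ 2.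
have pw0 k : 0 < Gamma (d + k%:R) * p `^ (d + k%:R).
  by rewrite mulr_gt0 ?Gamma_gt0 ?powR_gt0.
have meanP k : `|mean k p - g s| <= e + C * P k.
  set W := Gamma (d + k%:R) * p `^ (d + k%:R).
  have W0 : 0 < W by exact: pw0.
  have [gw _] := smooth_series k p0.
  have hw : has_integral pos (w k p) W by exact: has_integral_Gamma.
  have hw1 : has_integral pos (fun t => t * w k p t) (W * ((d + k%:R) * p)).
    have h := has_integral_Gamma (dn0 k.+1) p0.
    have -> : W * ((d + k%:R) * p) = Gamma (d + k.+1%:R) * p `^ (d + k.+1%:R).
      by rewrite -natr1 addrA GammaD1// (@powR_Dn _ (d + k%:R) p 1)// expr1 /W; ring.
    apply: eq_has_integral h => // t; rewrite /= in_itv/= andbT => t0.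
    by rewrite /w !powRDn// exprS; ring.
  have hw2 : has_integral pos (fun t => t ^+ 2 * w k p t)
      (W * ((d + k%:R) * (d + k%:R + 1) * p ^+ 2)).
    have h := has_integral_Gamma (dn0 k.+2) p0.
    have -> : W * ((d + k%:R) * (d + k%:R + 1) * p ^+ 2) =
        Gamma (d + k.+2%:R) * p `^ (d + k.+2%:R).
      have -> : d + k.+2%:R = d + k%:R + 2%:R by rewrite -addrA -natrD addn2.
      rewrite (@GammaDn _ (d + k%:R) 2)// (@powR_Dn _ (d + k%:R) p 2)//.
      by rewrite !pochSr poch0 /W; ring.
    apply: eq_has_integral h => // t; rewrite /= in_itv/= andbT => t0.
    by rewrite /w !powRDn// !exprS expr0; ring.
  have hd : has_integral pos (fun t => g t * w k p t + - g s * w k p t)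
      (smooth k p + - g s * W).
    by apply: has_integralD => //; exact: has_integralZ.
  have hP : has_integral pos
      (fun t => (e + C * s ^+ 2) * w k p t + (- (2 * C * s) * (t * w k p t) +
        C * (t ^+ 2 * w k p t)))
      ((e + C * s ^+ 2) * W + (- (2 * C * s) * (W * ((d + k%:R) * p)) +
        C * (W * ((d + k%:R) * (d + k%:R + 1) * p ^+ 2)))).
    by do 2?[apply: has_integralD => //]; exact: has_integralZ.
  have [|l' h1 h2] := has_integral_dom (measurable_itv _) (has_integral_measurable hd) hP.
    move=> t _; have w0 : 0 <= w k p t by rewrite /w; nonneg.
    rewrite (_ : g t * _ + _ = (g t - g s) * w k p t); last by ring.
    rewrite [leRHS](_ : _ = (e + C * (t - s) ^+ 2) * w k p t); last by ring.
    by rewrite normrM (ger0_norm w0); apply: ler_wpM2r.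
  rewrite -(has_integral_unique hd h1) in h2.
  have -> : mean k p - g s = (smooth k p + - g s * W) / W.
    by rewrite /mean -/W; field; rewrite gt_eqF.
  rewrite normrM normfV (gtr0_norm W0) ler_pdivrMr//; apply: le_trans h2 _.
  by rewrite le_eqVlt; apply/orP; left; apply/eqP; rewrite /P; ring.
have [l sl _] := smoothing_transform p0 s0.
rewrite /gauss_smoothing (cvg_lim _ sl)//; set L := lam p s in sl *.
have L0 : 0 <= L by rewrite divr_ge0// ltW.
have h1 : series (fun k => L ^+ k / k`!%:R * mean k p - g s * (L ^+ k / k`!%:R)) @ \oo -->
    l - g s * expR L.
  apply: cvg_seriesB => //; apply: cvg_seriesZ; exact: cvg_series_expR.
have h2 : series (fun k => (e + C * P k) * (L ^+ k / k`!%:R)) @ \oo -->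
    (e + C * (2 * s * p + d * (d + 1) * p ^+ 2)) * expR L.
  have e1 := cvg_series_expR (x := L).
  (* P k is expanded in the factorial powers k (k - 1), k and 1. *)
  have := cvg_seriesD (cvg_seriesZ (k := C * p ^+ 2) (cvg_series_poisson2 (x := L)))
    (cvg_seriesD (cvg_seriesZ (k := C * (p ^+ 2 * (2 * d + 2) - 2 * s * p))
        (cvg_series_poisson1 (x := L)))
      (cvg_seriesZ (k := e + C * (p ^+ 2 * (d * (d + 1)) - 2 * s * p * d + s ^+ 2)) e1)).
  have sE : s = L * p by rewrite /L /lam divfK// gt_eqF.
  rewrite [X in _ --> X](_ : _ = (e + C * (2 * s * p + d * (d + 1) * p ^+ 2)) * expR L).
    by apply: eq_cvg_series => k; rewrite /P; ring.
  by rewrite sE; ring.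
have h3 : `|l - g s * expR L| <= (e + C * (2 * s * p + d * (d + 1) * p ^+ 2)) * expR L.
  apply: normr_series_lim_le h1 h2 => k.
  have Lk : 0 <= L ^+ k / k`!%:R by nonneg.
  rewrite (_ : _ - _ = (mean k p - g s) * (L ^+ k / k`!%:R)); last by ring.
  by rewrite normrM (ger0_norm Lk); apply: ler_wpM2r.
have -> : expR (- L) * l - g s = expR (- L) * (l - g s * expR L).
  by rewrite mulrBr mulrCA -expRD addNr expR0 mulr1.
rewrite normrM (ger0_norm (expR_ge0 _)) expRN mulrC ler_pdivrMr ?expR_gt0//.
Qed.

Theorem psd_radial : psd_kernel (fun x y : nat -> R => g (sqdist dim x y)).
Proof.
pose p n : R := n.+1%:R^-1.
have p0 n : 0 < p n by rewrite invr_gt0.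
apply: (@psd_kernel_cvg _ _ (fun n x y => gauss_smoothing (p n) (sqdist dim x y))).
  by near=> n; exact: psd_gauss_smoothing.
move=> x y; set s := sqdist dim x y.
have s0 : 0 <= s by exact: sqdist_ge0.
apply/cvgrPdist_le => e e0.
have e20 : 0 < e / 2 by rewrite divr_gt0.
(* C depends on s and e but not on p, so the second part of the error vanishes as p tends to 0. *)
have [C C0 hC] := gauss_smoothing_approx s0 e20.
have pc : p @ \oo --> (0 : R) by exact: cvg_harmonic.
have qc : (fun n => C * (2 * s * p n + d * (d + 1) * p n ^+ 2)) @ \oo --> (0 : R).
  rewrite [X in _ --> X](_ : 0 = C * (2 * s * 0 + d * (d + 1) * 0 ^+ 2)); last by ring.
  apply: cvgMr; apply: cvgD; apply: cvgMr => //.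
  by rewrite expr2; under eq_fun do rewrite expr2; exact: cvgM.
near=> n; rewrite distrC; apply: le_trans (hC _ (p0 n)) _.
have : C * (2 * s * p n + d * (d + 1) * p n ^+ 2) <= e / 2.
  by near: n; exact: (cvgr_le _ qc).
by move=> h; rewrite [leRHS](splitr e) lerD2l.
Unshelve. all: by end_near. Qed.

End RadialTransform.

(** * The Gauss hypergeometric covariance *)

Section ContinuousSeries.
Context {R : realType}.

(** Weierstrass's test: the tails of [B] bound the remainders uniformly, and an e/3 argument
    concludes. *)
Lemma continuous_series (f : nat -> R -> R) (B : nat -> R) (F : R -> R) :
  (forall n, continuous (f n)) -> (forall n t, `|f n t| <= B n) ->
  cvgn (series B) -> (forall t, series (f ^~ t) @ \oo --> F t) -> continuous F.
Proof.
move=> cf fB /cvg_ex[/= b Bb] fF s; apply/cvgrPdist_le => e e0.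
have B0 n : 0 <= B n by apply: le_trans (normr_ge0 _) (fB n 0).
have tail N t : `|F t - series (f ^~ t) N| <= b - series B N.
  pose cut (u : nat -> R) n := if (n < N)%N then 0 else u n.
  have cutE (u : nat -> R) l : series u @ \oo --> l ->
      series (cut u) @ \oo --> l - series u N.
    move=> ul; rewrite -(cvg_shiftn N).
    suff -> : (fun n => series (cut u) (n + N)%N) = (fun n => series u (n + N)%N - series u N).
      by apply: cvgB; [rewrite cvg_shiftn|exact: cvg_cst].
    apply/funext => n; have Nn : (N <= n + N)%N by rewrite leq_addl.
    rewrite /series /= [LHS](big_cat_nat (leq0n N) Nn)/= [X in _ = X - _](big_cat_nat (leq0n N) Nn)/=.
    rewrite [RHS]addrAC subrr add0r.
    rewrite [X in X + _]big_nat big1 ?add0r; last first.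
      by move=> i /andP[_ iN]; rewrite /cut iN.
    by rewrite big_nat [RHS]big_nat; apply: eq_bigr => i /andP[Ni _]; rewrite /cut ltnNge Ni.
  apply: normr_series_lim_le (cutE _ _ (fF t)) (cutE _ _ Bb) => n.
  by rewrite /cut; case: ifP; rewrite ?normr0.
have [N hN] : exists N, b - series B N <= e / 3.
  have e3 : 0 < e / 3 by rewrite divr_gt0.
  have /cvgrPdist_le/(_ _ e3)[N _ hN] := Bb.
  by exists N; apply: le_trans (ler_norm _) _; exact: (hN N (leqnn N)).
have cS : continuous (fun t => series (f ^~ t) N).
  rewrite /series /=; elim: N {hN} => [|N IH].
    rewrite (_ : (fun _ => _) = cst 0); first exact: cst_continuous.
    by apply/funext => t; rewrite big_geq.
  rewrite (_ : (fun _ => _) = (fun t => \sum_(0 <= k < N) f k t + f N t)).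
    by move=> t; apply: continuousD; [exact: IH|exact: cf].
  by apply/funext => t; rewrite big_nat_recr.
have e3 : 0 < e / 3 by rewrite divr_gt0.
have /cvgrPdist_le/(_ _ e3) := cS s.
apply: filterS => t st.
have -> : F s - F t = (F s - series (f ^~ s) N) + (series (f ^~ s) N - series (f ^~ t) N)
    - (F t - series (f ^~ t) N) by ring.
apply: le_trans (ler_normB _ _) _.
have := ler_normD (F s - series (f ^~ s) N) (series (f ^~ s) N - series (f ^~ t) N).
have := tail N s; have := tail N t; lra.
Unshelve. all: by end_near. Qed.

Lemma continuous_powR_pos_part (r : R) : 0 < r -> continuous (fun t : R => Num.max t 0 `^ r).
Proof.
move=> r0 s; have r0n : r != 0 by rewrite gt_eqF.
rewrite /continuous_at /=.
have [s0|s0] := ltP 0 s.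
  have -> : s `^ r = expR (r * ln s) by rewrite /powR gt_eqF.
  have cs : expR (r * ln t) @[t --> s] --> expR (r * ln s).
    apply: continuous_cvg; first exact: continuous_expR.
    by apply: cvgMr; exact: continuous_ln.
  apply: cvg_trans cs; apply: near_eq_cvg; near=> t.
  have t0 : 0 < t by near: t; exact: lt_nbhsr.
  by rewrite max_l ?ltW// /powR gt_eqF.
rewrite powR0//; apply/cvgrPdist_le => e e0.
have er : 0 < e `^ r^-1 by exact: powR_gt0.
near=> t; rewrite sub0r normrN ger0_norm ?powR_ge0//.
have te : t < e `^ r^-1.
  near: t; apply: lt_nbhsl; exact: le_lt_trans s0 er.
rewrite [leRHS](_ : e = (e `^ r^-1) `^ r); last by rewrite -powRrM mulVf// powRr1// ltW.
by apply: ge0_ler_powR; rewrite ?nnegrE ?le_max ?lexx ?orbT ?ge_max ?ltW.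
Unshelve. all: by end_near. Qed.

End ContinuousSeries.

(** * The covariance profile, its moments and its transform *)

Section GaussCovariance.
Context {R : realType}.
Local Notation unitI := (`]0%R, 1%R[%classic : set R).
Local Notation poch := (@pochhammer R).
Context (d al be ga : R) (d0 : 0 < d) (dal : d < al) (albe : al < be) (alga : al < ga).
Let p := be - al + ga - d.
Context (p1 : 1 < be - al + ga - d).

(** By Gauss's summation theorem this constant makes the covariance equal to 1 at the origin. *)
Definition gauss_weight : R :=
  Gamma (be - d) * Gamma (ga - d) / (Gamma (be - al + ga - d) * Gamma (al - d)).

(* The profile of the covariance in the variable s = |h|^2 / a^2, with 1 - s
   clipped to [0, 1] so that it is continuous and bounded on the whole line. *)
Definition gauss_clip (s : R) : R := Num.max (Num.min (1 - s) 1) 0.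

Definition gauss_profile (s : R) : R :=
  gauss_weight * gauss_clip s `^ (be - al + ga - d - 1) *
  hyp2F1 (be - al) (ga - al) (be - al + ga - d) (gauss_clip s).

(* The value at 0 of the radial Fourier transform of the profile. *)
Definition gauss_spectral : R :=
  Gamma (be - d) * Gamma (ga - d) * Gamma d * Gamma al /
  (Gamma (al - d) * Gamma be * Gamma ga).

Let q k : R := poch (be - al) k * poch (ga - al) k / (poch p k * k`!%:R).

Let p0 : 0 < p. Proof. by have := p1; rewrite /p; lra. Qed.
Let be0 : 0 < be. Proof. by have := d0; have := dal; have := albe; lra. Qed.
Let ga0 : 0 < ga. Proof. by have := d0; have := dal; have := alga; lra. Qed.
Let al0 : 0 < al. Proof. by have := d0; have := dal; lra. Qed.
Let a0 : 0 < be - al. Proof. by rewrite subr_gt0. Qed.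
Let b0 : 0 < ga - al. Proof. by rewrite subr_gt0. Qed.
Let dbe0 : 0 < be - d. Proof. by have := dal; have := albe; lra. Qed.
Let dga0 : 0 < ga - d. Proof. by have := dal; have := alga; lra. Qed.
Let dal0 : 0 < al - d. Proof. by rewrite subr_gt0. Qed.

Lemma gauss_weight_gt0 : 0 < gauss_weight.
Proof. by rewrite divr_gt0// mulr_gt0// Gamma_gt0. Qed.

Lemma gauss_spectral_gt0 : 0 < gauss_spectral.
Proof. by rewrite divr_gt0// ?mulr_gt0// Gamma_gt0. Qed.

Let q0 k : 0 <= q k.
Proof. by rewrite divr_ge0// mulr_ge0// ltW// poch_gt0. Qed.

(** The Gauss series at the end point 1. It converges because p - (be - al) - (ga - al) = al - d >
    0, and it dominates the series at every clipped argument. *)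
Let cvg_q : cvgn (series q).
Proof.
apply/cvg_ex; eexists.
have abp : be - al + (ga - al) < p by have := dal; rewrite /p; lra.
have := cvg_seriesZ (k := Gamma p) (cvg_Gauss_series a0 b0 abp).
apply: eq_cvg_series => k; rewrite GammaDn// /q.
by field; rewrite fact_neq0 poch_neq0// gt_eqF// Gamma_gt0.
Qed.

Lemma gauss_clip_ge0 s : 0 <= gauss_clip s.
Proof. by rewrite le_max lexx orbT. Qed.

Lemma gauss_clip_le1 s : gauss_clip s <= 1.
Proof. by rewrite ge_max ler01 andbT ge_min lexx orbT. Qed.

Let term k s : R := gauss_weight * q k * (gauss_clip s `^ (p - 1) * gauss_clip s ^+ k).

Let term_ge0 k s : 0 <= term k s.
Proof.
have c0 := gauss_clip_ge0 s; have w0 := ltW gauss_weight_gt0; have qk := q0 k.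
by rewrite /term; nonneg.
Qed.

Let term_le k s : `|term k s| <= gauss_weight * q k.
Proof.
have c0 := gauss_clip_ge0 s; have c1 := gauss_clip_le1 s.
rewrite ger0_norm// -[leRHS]mulr1; apply: ler_wpM2l.
  by rewrite mulr_ge0// ltW// gauss_weight_gt0.
rewrite -[leRHS]mulr1; apply: ler_pM; nonneg; last exact: exprn_ile1.
rewrite -[leRHS](congr1 (@^~ (p - 1)) (@powR1 R)); apply: ge0_ler_powR => //; rewrite ?nnegrE//.
by rewrite subr_ge0 ltW.
Qed.

Let cvg_term s : series (term ^~ s) @ \oo --> gauss_profile s.
Proof.
have c0 := gauss_clip_ge0 s; have c1 := gauss_clip_le1 s.
have qc : cvgn (series (fun k => q k * gauss_clip s ^+ k)).
  apply: is_cvg_series_dom cvg_q => k; rewrite normrM ger0_norm// ger0_norm; last by nonneg.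
  by rewrite ler_piMr// exprn_ile1.
have := cvg_seriesZ (k := gauss_weight * gauss_clip s `^ (p - 1)) qc.
by apply: eq_cvg_series => k; rewrite /term; ring.
Qed.

Let cvg_term_bound : cvgn (series (fun k => gauss_weight * q k)).
Proof.
by have /cvg_ex[/= l hl] := cvg_q; apply/cvg_ex; exists (gauss_weight * l); exact: cvg_seriesZ.
Qed.

Lemma continuous_gauss_profile : continuous gauss_profile.
Proof.
apply: (continuous_series _ term_le cvg_term_bound cvg_term) => k.
have cc : continuous gauss_clip.
  have cm : continuous (fun s : R => Num.min (1 - s) 1).
    apply: (@min_fun_continuous _ _ R (fun s : R => 1 - s) (cst 1)).
      by move=> s; apply: cvgB; [exact: cvg_cst|exact: cvg_id].
    exact: cst_continuous.
  apply: (@max_fun_continuous _ _ R _ (cst 0)) cm _.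
  exact: cst_continuous.
move=> s; apply: cvgMr; apply: cvgM; last first.
  by apply: (@continuous_comp _ _ _ gauss_clip (fun t => t ^+ k)); [exact: cc|exact: exprn_continuous].
have cE : (fun s => gauss_clip s `^ (p - 1)) =
    (fun t : R => Num.max t 0 `^ (p - 1)) \o gauss_clip.
  by apply/funext => t /=; rewrite max_l ?gauss_clip_ge0.
have -> : gauss_clip s `^ (p - 1) =
    ((fun t : R => Num.max t 0 `^ (p - 1)) \o gauss_clip) s by rewrite -cE.
rewrite cE; apply: continuous_comp; first exact: cc.
by apply: continuous_powR_pos_part; rewrite subr_gt0.
Qed.

Lemma gauss_profile_bound : exists M : R, forall s, `|gauss_profile s| <= M.
Proof.
have /cvg_ex[/= M hM] := cvg_term_bound; exists M => s.
have tl k : `|(term ^~ s) k| <= gauss_weight * q k by exact: term_le.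
exact: normr_series_lim_le tl (@cvg_term s) hM.
Qed.

Lemma gauss_profile_out s : 1 <= s -> gauss_profile s = 0.
Proof.
move=> s1; have pn : p - 1 != 0 by rewrite gt_eqF// subr_gt0.
have -> : gauss_profile s = gauss_weight * 0 `^ (p - 1) * hyp2F1 (be - al) (ga - al) p 0.
  by rewrite /gauss_profile /gauss_clip max_r// ge_min subr_le0 s1.
by rewrite powR0// mulr0 mul0r.
Qed.

Definition gauss_moment n : R := gauss_weight * Gamma p * (Gamma (d + n%:R) * Gamma (al + n%:R) /
  (Gamma (be + n%:R) * Gamma (ga + n%:R))).

Let clipE t : unitI t -> gauss_clip t = 1 - t.
Proof.
rewrite /= in_itv/= => /andP[t0 t1]; rewrite /gauss_clip min_l ?max_l//; first by lra.
by lra.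
Qed.

(** Each term integrates to a beta function, and their sum is again Gauss's series, now with lower
    parameter d + n + p. The terms are nonnegative, so each is its own majorant. *)
Lemma has_integral_gauss_profile n :
  has_integral unitI (fun s => gauss_profile s * s `^ (d + n%:R - 1)) (gauss_moment n).
Proof.
pose f k s := term k s * s `^ (d + n%:R - 1).
pose I k := gauss_weight * q k *
  (Gamma (d + n%:R) * Gamma (p + k%:R) / Gamma (d + n%:R + (p + k%:R))).
have dn0 : 0 < d + n%:R by rewrite ltr_wpDr.
have pk0 k : 0 < p + k%:R by rewrite ltr_wpDr.
have fI k : has_integral unitI (f k) (I k).
  have h : has_integral unitI (fun t => t `^ (d + n%:R - 1) * (1 - t) `^ (p + k%:R - 1))
      (Gamma (d + n%:R) * Gamma (p + k%:R) / Gamma (d + n%:R + (p + k%:R))).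
    apply: has_integral_ge0E => //; last exact: integral_Beta.
    - exact: measurable_powR_powR1B.
    - by move=> t _; nonneg.
  have := has_integralZ (gauss_weight * q k) (measurable_itv _) h.
  apply: eq_has_integral => // t tI; rewrite /f /term clipE//.
  move: tI; rewrite /= in_itv/= => /andP[t0 t1].
  by rewrite (@powRDn _ p (1 - t) k) ?subr_gt0//; ring.
have Il : series I @ \oo --> gauss_moment n.
  have P : be - al + (ga - al) < d + n%:R + p.
    by have := al0; have := ler0n R n; rewrite /p; lra.
  have := cvg_seriesZ (k := gauss_weight * Gamma p * Gamma (d + n%:R)) (cvg_Gauss_series a0 b0 P).
  rewrite (_ : d + n%:R + p - (be - al) - (ga - al) = al + n%:R); last by rewrite /p; ring.
  rewrite (_ : d + n%:R + p - (be - al) = ga + n%:R); last by rewrite /p; ring.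
  rewrite (_ : d + n%:R + p - (ga - al) = be + n%:R); last by rewrite /p; ring.
  rewrite [X in _ --> X](_ : _ = gauss_moment n); last first.
    by rewrite /gauss_moment [Gamma (be + _) * _]mulrC -!mulrA.
  apply: eq_cvg_series => k; rewrite /I /q (@GammaDn _ p k)// (addrA (d + n%:R) p).
  have Gn : Gamma (d + n%:R + p + k%:R) != 0.
    by rewrite gt_eqF// Gamma_gt0// -addrA addr_gt0.
  move: (poch_neq0 k p0) (@fact_neq0 R k) Gn.
  move: (Gamma (d + n%:R + p + k%:R)) (Gamma p) (Gamma (d + n%:R)) gauss_weight (poch p k).
  by move=> x y z u v h1 h2 h3; field; rewrite h1 h2 h3.
have [l h Il'] : exists2 l, has_integral unitI (fun s => gauss_profile s * s `^ (d + n%:R - 1)) l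
    & series I @ \oo --> l.
  apply: (@has_integral_series _ unitI f I I) => //.
  - move=> k; exists (f k); split => // t tI; rewrite ger0_norm//.
    by rewrite /f mulr_ge0// powR_ge0.
  - by apply/cvg_ex; exists (gauss_moment n).
  - move=> t _; have := cvg_seriesZ (k := t `^ (d + n%:R - 1)) (@cvg_term t).
    by rewrite mulrC; apply: eq_cvg_series => k; rewrite mulrC.
by rewrite (cvg_unique _ Il Il').
Qed.

(** Since Gamma(d + n) = Gamma(d) (d)_n, the moments cancel (d)_n, and the three other shifted Gamma
    values become the parameters of the 1F2. *)
Lemma gauss_profile_transform t :
  series (fun n => gauss_moment n * (- t) ^+ n / (n`!%:R * poch d n)) @ \oo -->
  gauss_spectral * hyp1F2 al be ga t.
Proof.
have alb : 0 < al <= be by rewrite al0 ltW.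
have := cvg_seriesZ (k := gauss_spectral) (cvg_hyp1F2 (z := t) alb ga0).
apply: eq_cvg_series => n; rewrite /gauss_moment /gauss_spectral /gauss_weight -/p !GammaDn//.
have G (x : R) : 0 < x -> Gamma x != 0 by move=> x0; rewrite gt_eqF// Gamma_gt0.
move: (G _ be0) (G _ ga0) (G _ p0) (G _ dal0) (@fact_neq0 R n).
move: (poch_neq0 n d0) (poch_neq0 n be0) (poch_neq0 n ga0).
move: (Gamma p) (Gamma be) (Gamma ga) (Gamma al) (Gamma d) (Gamma (al - d)) (Gamma (be - d))
  (Gamma (ga - d)) (poch d n) (poch be n) (poch ga n) => x1 x2 x3 x4 x5 x6 x7 x8 x9 x10 x11.
by move=> h1 h2 h3 h4 h5 h6 h7 h8; field; rewrite h1 h2 h3 h4 h5 h6 h7 h8.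
Qed.

End GaussCovariance.

(** * Bivariate kernels *)

Section Bivariate.
Context {R : realType}.

(** The last condition makes the exponent of the clipped factor positive, so that the profile is
    continuous at the edge s = 1 of its support. *)
Definition gauss_domain (d al be ga : R) : Prop :=
  [/\ d < al, al < be, al < ga & 1 < be - al + ga - d].

(** Two terms serve both uses: k' = 0 for the off-diagonal profile alone, and k' < 0 for a diagonal
    profile minus a multiple of it. *)
Lemma psd_gauss_combination (dim : nat) (al be ga al' be' ga' k k' : R) :
  let d := dim%:R / 2 in
  (0 < dim)%N -> gauss_domain d al be ga -> gauss_domain d al' be' ga' ->
  (forall t, 0 < t -> 0 <= k * (gauss_spectral d al be ga * hyp1F2 al be ga t) +
    k' * (gauss_spectral d al' be' ga' * hyp1F2 al' be' ga' t)) ->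
  psd_kernel (fun x y : nat -> R => k * gauss_profile d al be ga (sqdist dim x y) +
    k' * gauss_profile d al' be' ga' (sqdist dim x y)).
Proof.
move=> d dim0 [h1 h2 h3 h4] [h1' h2' h3' h4'] tr.
have d0 : 0 < d by rewrite divr_gt0// ltr0n.
have [M hM] := gauss_profile_bound h1 h2 h3 h4.
have [M' hM'] := gauss_profile_bound h1' h2' h3' h4'.
apply: (@psd_radial _ dim
  (fun s => k * gauss_profile d al be ga s + k' * gauss_profile d al' be' ga' s)
  (fun t => k * (gauss_spectral d al be ga * hyp1F2 al be ga t) +
    k' * (gauss_spectral d al' be' ga' * hyp1F2 al' be' ga' t))
  (`|k| * M + `|k'| * M')
  (fun n => k * gauss_moment d al be ga n + k' * gauss_moment d al' be' ga' n)) => //.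
- by move=> t; apply: le_trans (ler_normD _ _) _; rewrite (normrM k) (normrM k') lerD// ler_wpM2l.
- move=> s; apply: cvgD; apply: cvgMr.
    exact: (continuous_gauss_profile h1 h2 h3 h4).
  exact: (continuous_gauss_profile h1' h2' h3' h4').
- by move=> t t1; rewrite !gauss_profile_out// !mulr0 addr0.
- move=> n; have := has_integralD (measurable_itv _)
    (has_integralZ k (measurable_itv _) (has_integral_gauss_profile d0 h1 h2 h3 h4 n))
    (has_integralZ k' (measurable_itv _) (has_integral_gauss_profile d0 h1' h2' h3' h4' n)).
  by apply: eq_has_integral => // t _; rewrite /d; ring.
- move=> t t0; have := cvg_seriesD
    (cvg_seriesZ (k := k) (gauss_profile_transform d0 h1 h2 h3 h4 (t := t)))
    (cvg_seriesZ (k := k') (gauss_profile_transform d0 h1' h2' h3' h4' (t := t))).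
  apply: eq_cvg_series => n; rewrite -/d.
  move: (gauss_moment d al be ga n) (gauss_moment d al' be' ga' n) => m m'; ring.
Qed.

Lemma psd_bivariate (T : Type) (K11 K12 K22 : T -> T -> R) (s1 s2 rho : R) :
  0 < s1 -> rho ^+ 2 <= s1 * s2 -> psd_kernel K12 ->
  psd_kernel (fun x y => K11 x y - s1 * K12 x y) ->
  psd_kernel (fun x y => K22 x y - s2 * K12 x y) ->
  forall n (x : 'I_n -> T) (u v : 'I_n -> R),
  0 <= \sum_(k < n) \sum_(l < n)
    (u k * u l * K11 (x k) (x l) + rho * (u k * v l + v k * u l) * K12 (x k) (x l) +
     v k * v l * K22 (x k) (x l)).
Proof.
move=> s10 rs h12 h11 h22 n x u v; have s1n : s1 != 0 by rewrite gt_eqF.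
have s20 : 0 <= s2 - rho ^+ 2 / s1 by rewrite subr_ge0 ler_pdivrMr// mulrC.
(* Completing the square: the form with rows (s1, rho) and (rho, s2) is s1 (u + (rho / s1) v)^2 +
   (s2 - rho^2 / s1) v^2. *)
have e : \sum_(k < n) \sum_(l < n)
    (u k * u l * K11 (x k) (x l) + rho * (u k * v l + v k * u l) * K12 (x k) (x l) +
     v k * v l * K22 (x k) (x l)) =
  \sum_(k < n) \sum_(l < n) u k * u l * (K11 (x k) (x l) - s1 * K12 (x k) (x l)) +
  \sum_(k < n) \sum_(l < n) v k * v l * (K22 (x k) (x l) - s2 * K12 (x k) (x l)) +
  s1 * (\sum_(k < n) \sum_(l < n)
    (u k + rho / s1 * v k) * (u l + rho / s1 * v l) * K12 (x k) (x l)) +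
  (s2 - rho ^+ 2 / s1) * (\sum_(k < n) \sum_(l < n) v k * v l * K12 (x k) (x l)).
  rewrite !mulr_sumr -!big_split/=; apply: eq_bigr => k _.
  rewrite !mulr_sumr -!big_split/=; apply: eq_bigr => l _.
  by field.
rewrite e; do 3?[apply: addr_ge0]; [exact: h11|exact: h22| |].
- by apply: mulr_ge0; [exact: ltW|exact: (h12 n x (fun k => u k + rho / s1 * v k))].
- by apply: mulr_ge0 => //; exact: h12.
Qed.

Lemma gauss_hypergeometric_covE (d : nat) (h : 'rV[R]_d) (a al be ga : R) :
  gauss_hypergeometric_cov h a al be ga =
  gauss_profile (d%:R / 2) al be ga (euclidean_norm h ^+ 2 / a ^+ 2).
Proof.
rewrite /gauss_hypergeometric_cov /gauss_profile /gauss_weight /gauss_clip /pos_part.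
by rewrite (@min_l _ _ (1 - _))// gerBl divr_ge0 ?sqr_ge0.
Qed.

(** Padding with zeros turns a row vector into a sequence; dividing by [a] here moves the scale from
    the profile to the points. *)
Definition scaled_coordinates (d : nat) (a : R) (x : 'rV[R]_d) (i : nat) : R :=
  if insub i is Some j then x ord0 j / a else 0.

Lemma sqdist_scaled_coordinates (d : nat) (a : R) (x y : 'rV[R]_d) :
  sqdist d (scaled_coordinates a x) (scaled_coordinates a y) =
  euclidean_norm (x - y) ^+ 2 / a ^+ 2.
Proof.
rewrite /euclidean_norm sqr_sqrtr; last by apply: sumr_ge0 => i _; rewrite sqr_ge0.
rewrite /sqdist mulr_suml; apply: eq_bigr => i _.
by rewrite /scaled_coordinates valK !mxE -mulrBl expr_div_n.
Qed.

Theorem valid_bivariate_gauss (d : nat)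
    (a rho al1 al12 al2 be1 be12 be2 ga1 ga12 ga2 : R) :
  let hd := d%:R / 2 in
  (0 < d)%N ->
  gauss_domain hd al1 be1 ga1 -> gauss_domain hd al12 be12 ga12 ->
  gauss_domain hd al2 be2 ga2 ->
  (forall t, 0 <= t -> 0 <= hyp1F2 al12 be12 ga12 t) ->
  (forall t, 0 <= t -> hyp1F2 al12 be12 ga12 t <= hyp1F2 al1 be1 ga1 t) ->
  (forall t, 0 <= t -> hyp1F2 al12 be12 ga12 t <= hyp1F2 al2 be2 ga2 t) ->
  rho ^+ 2 * gauss_spectral hd al12 be12 ga12 ^+ 2 <=
    gauss_spectral hd al1 be1 ga1 * gauss_spectral hd al2 be2 ga2 ->
  valid_matrix_cov (@bivariate_gauss_hypergeometric R d
    (sym_mx2 1 rho 1) (sym_mx2 a a a) (sym_mx2 al1 al12 al2)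
    (sym_mx2 be1 be12 be2) (sym_mx2 ga1 ga12 ga2)).
Proof.
move=> hd d0 D1 D12 D2 F12 F1 F2 rs n x w.
have hd0 : 0 < hd by rewrite divr_gt0// ltr0n.
have S0 al be ga : gauss_domain hd al be ga -> 0 < gauss_spectral hd al be ga.
  by case=> h1 h2 h3 h4; exact: gauss_spectral_gt0.
have S1 := S0 _ _ _ D1; have S2 := S0 _ _ _ D2; have S12 := S0 _ _ _ D12.
set c1 := gauss_spectral hd al1 be1 ga1 in rs S1.
set c2 := gauss_spectral hd al2 be2 ga2 in rs S2.
set c12 := gauss_spectral hd al12 be12 ga12 in rs S12.
pose K al be ga (x y : nat -> R) := gauss_profile hd al be ga (sqdist d x y).
have c12n : c12 != 0 by rewrite gt_eqF.
have K12 : psd_kernel (K al12 be12 ga12).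
  have := @psd_gauss_combination d al12 be12 ga12 al12 be12 ga12 1 0 d0 D12 D12.
  move=> h; apply: eq_psd_kernel (h _) => [y z|t t0]; first by rewrite mul1r mul0r addr0.
  by rewrite mul1r mul0r addr0; apply: mulr_ge0; [exact: ltW|apply: F12; exact: ltW].
have Kd al be ga c : gauss_domain hd al be ga -> c = gauss_spectral hd al be ga -> 0 < c ->
    (forall t, 0 <= t -> hyp1F2 al12 be12 ga12 t <= hyp1F2 al be ga t) ->
    psd_kernel (fun x y => K al be ga x y - c / c12 * K al12 be12 ga12 x y).
  move=> D cE c0 F.
  have := @psd_gauss_combination d al be ga al12 be12 ga12 1 (- (c / c12)) d0 D D12.
  move=> h; apply: eq_psd_kernel (h _) => [y z|t t0]; first by rewrite mul1r mulNr.
  rewrite mul1r -/hd -cE -/c12 (_ : _ + _ = c * (hyp1F2 al be ga t - hyp1F2 al12 be12 ga12 t)).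
    by apply: mulr_ge0; [exact: ltW|rewrite subr_ge0; apply: F; exact: ltW].
  by field.
(* The weights in [psd_bivariate] are k_ii / k_12, the ratios of the transforms at 0. *)
have s10 : 0 < c1 / c12 := divr_gt0 S1 S12.
have rs' : rho ^+ 2 <= c1 / c12 * (c2 / c12).
  by rewrite mulrACA -invfM -expr2 (ler_pdivlMr _ _ (exprn_gt0 _ S12)).
have := psd_bivariate s10 rs' K12 (Kd _ _ _ _ D1 erefl S1 F1) (Kd _ _ _ _ D2 erefl S2 F2)
  (fun k => scaled_coordinates a (x k)) (fun k => w k ord0 ord0)
  (fun k => w k (lift ord0 ord0) ord0).
congr (0 <= _); apply: eq_bigr => k _; apply: eq_bigr => l _.
rewrite !mxE !big_ord_recl !big_ord0 !mxE !big_ord_recl !big_ord0 !mxE/= !addr0.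
rewrite !gauss_hypergeometric_covE /K !sqdist_scaled_coordinates -/hd.
ring.
Qed.

End Bivariate.

(** The square of a Bessel function of order al - 1/2. Parameters tied by equations let it apply to
    be - 1/2, be, 2 be - 1 as well. *)
Lemma hyp1F2_ge0 (R : realType) (al be ga x : R) :
  1 / 2 < al -> be = al + 1 / 2 -> ga = 2 * al -> 0 <= hyp1F2 al be ga x.
Proof.
move=> h -> ->; have nu0 : 0 < al - 1 / 2 by rewrite subr_gt0.
have := hyp1F2_sqr_ge0 x nu0.
have -> : al - 1 / 2 + 1 / 2 = al by ring.
have -> : al - 1 / 2 + 1 = al + 1 / 2 by field.
by have -> : 2 * (al - 1 / 2) + 1 = 2 * al by field.
Qed.

Unset Implicit Arguments.

Theorem mainTheorem17 (R : realType) (d : nat) (hd : (1 <= d)%N)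
    (a rho : R) (ha : 0 < a) :
  (forall alpha beta1 beta2 : R,
     d%:R / 2 < alpha ->
     alpha + 1 / 2 < beta1 -> beta1 <= 2 * alpha ->
     alpha + 1 / 2 < beta2 -> beta2 <= 2 * alpha ->
     rho ^+ 2 <=
       (Gamma (alpha + 1 / 2) ^+ 2 * Gamma (2 * alpha) ^+ 2
        * Gamma (beta1 - d%:R / 2) * Gamma (beta2 - d%:R / 2)
        * Gamma (3 * alpha - beta1 + (1 - d%:R) / 2)
        * Gamma (3 * alpha - beta2 + (1 - d%:R) / 2))
       / (Gamma (alpha + (1 - d%:R) / 2) ^+ 2
          * Gamma (2 * alpha - d%:R / 2) ^+ 2
          * Gamma beta1 * Gamma beta2
          * Gamma (3 * alpha - beta1 + 1 / 2)
          * Gamma (3 * alpha - beta2 + 1 / 2)) ->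
     valid_matrix_cov
       (@bivariate_gauss_hypergeometric R d
          (sym_mx2 1 rho 1)
          (sym_mx2 a a a)
          (sym_mx2 alpha alpha alpha)
          (sym_mx2 beta1 (alpha + 1 / 2) beta2)
          (sym_mx2 (3 * alpha + 1 / 2 - beta1)
                   (2 * alpha)
                   (3 * alpha + 1 / 2 - beta2))))
  /\
  (forall alpha1 alpha2 beta : R,
     d%:R / 2 < alpha1 -> d%:R / 2 < alpha2 ->
     Num.max alpha1 alpha2 + 1 / 2 <= beta ->
     rho ^+ 2 <=
       (Gamma alpha1 * Gamma alpha2
        * Gamma (alpha1 + beta - (d%:R + 1) / 2)
        * Gamma (alpha2 + beta - (d%:R + 1) / 2)
        * Gamma (beta - (d%:R + 1) / 2) ^+ 2 * Gamma (2 * beta - 1) ^+ 2)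
       / (Gamma (alpha1 - d%:R / 2) * Gamma (alpha2 - d%:R / 2)
          * Gamma (alpha1 + beta - 1 / 2) * Gamma (alpha2 + beta - 1 / 2)
          * Gamma (beta - 1 / 2) ^+ 2
          * Gamma (2 * beta - 1 - d%:R / 2) ^+ 2) ->
     valid_matrix_cov
       (@bivariate_gauss_hypergeometric R d
          (sym_mx2 1 rho 1)
          (sym_mx2 a a a)
          (sym_mx2 alpha1 (beta - 1 / 2) alpha2)
          (sym_mx2 beta beta beta)
          (sym_mx2 (alpha1 + beta - 1 / 2)
                   (2 * beta - 1)
                   (alpha2 + beta - 1 / 2))))
  /\
  (forall alpha1 alpha2 beta : R,
     d%:R / 2 < alpha1 -> d%:R / 2 < alpha2 ->
     Num.max alpha1 alpha2 + 1 / 2 <= beta ->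
     rho ^+ 2 <=
       (Gamma alpha1 * Gamma alpha2
        * Gamma (2 * alpha1 - d%:R / 2) * Gamma (2 * alpha2 - d%:R / 2)
        * Gamma (beta - (d%:R + 1) / 2) ^+ 2 * Gamma (2 * beta - 1) ^+ 2)
       / (Gamma (alpha1 - d%:R / 2) * Gamma (alpha2 - d%:R / 2)
          * Gamma (2 * alpha1) * Gamma (2 * alpha2)
          * Gamma (beta - 1 / 2) ^+ 2
          * Gamma (2 * beta - 1 - d%:R / 2) ^+ 2) ->
     valid_matrix_cov
       (@bivariate_gauss_hypergeometric R d
          (sym_mx2 1 rho 1)
          (sym_mx2 a a a)
          (sym_mx2 alpha1 (beta - 1 / 2) alpha2)
          (sym_mx2 beta beta beta)
          (sym_mx2 (2 * alpha1) (2 * beta - 1) (2 * alpha2)))).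
Proof.
(* Since d >= 1, every alpha exceeds 1/2, which makes the Bessel orders positive. *)
have hd2 : 1 / 2 <= d%:R / 2 :> R by rewrite ler_pM2r// ler1n.
have hd0 : 0 < d%:R / 2 :> R by lra.
have G0 (x : R) : 0 < x -> Gamma x != 0 by move=> x0; rewrite gt_eqF// Gamma_gt0.
have bound (s s1 s2 s12 : R) : 0 < s12 -> s = s1 * s2 / s12 ^+ 2 -> rho ^+ 2 <= s ->
    rho ^+ 2 * s12 ^+ 2 <= s1 * s2.
  by move=> s0 -> h; rewrite -(ler_pdivlMr _ _ (exprn_gt0 _ s0)).
split; [|split].
- move=> al be1 be2 hal h1 h1' h2 h2'.
  (* The arguments of Gamma get the shape they have in [gauss_spectral], because the final [field]
     sees each Gamma value as an atom. *)
  have -> : al + (1 - d%:R) / 2 = al + 1 / 2 - d%:R / 2 by field.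
  have -> : 3 * al - be1 + (1 - d%:R) / 2 = 3 * al + 1 / 2 - be1 - d%:R / 2 by field.
  have -> : 3 * al - be2 + (1 - d%:R) / 2 = 3 * al + 1 / 2 - be2 - d%:R / 2 by field.
  have -> : 3 * al - be1 + 1 / 2 = 3 * al + 1 / 2 - be1 by ring.
  have -> : 3 * al - be2 + 1 / 2 = 3 * al + 1 / 2 - be2 by ring.
  have D1 : gauss_domain (d%:R / 2) al be1 (3 * al + 1 / 2 - be1) by split; lra.
  have D2 : gauss_domain (d%:R / 2) al be2 (3 * al + 1 / 2 - be2) by split; lra.
  have D12 : gauss_domain (d%:R / 2) al (al + 1 / 2) (2 * al) by split; lra.
  have := G0 (al + 1 / 2) ltac:(lra).
  have := G0 (al + 1 / 2 - d%:R / 2) ltac:(lra).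
  have := G0 (2 * al) ltac:(lra).
  have := G0 (2 * al - d%:R / 2) ltac:(lra).
  have := G0 be1 ltac:(lra).
  have := G0 be2 ltac:(lra).
  have := G0 (3 * al + 1 / 2 - be1) ltac:(lra).
  have := G0 (3 * al + 1 / 2 - be2) ltac:(lra).
  have := G0 al ltac:(lra).
  have := G0 (al - d%:R / 2) ltac:(lra).
  have := G0 (d%:R / 2) ltac:(lra).
  have al2 : 1 / 2 < al by lra.
  move=> g11 g10 g9 g8 g7 g6 g5 g4 g3 g2 g1 hrho.
  have S12 := D12; case: S12 => s1 s2 s3 s4.
  have {s1 s2 s3 s4}S12 := gauss_spectral_gt0 hd0 s1 s2 s3.
  apply: (valid_bivariate_gauss a hd D1 D12 D2).
  + by move=> t _; apply: hyp1F2_ge0.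
  + by move=> t; exact: hyp1F2_le_case1.
  + by move=> t; exact: hyp1F2_le_case1.
  (* With a common alpha, Gamma(d/2) Gamma(al) / Gamma(al - d/2) drops out of k_11 k_22 / k_12^2. *)
  apply: bound S12 _ hrho; rewrite /gauss_spectral.
  move: g1 g2 g3 g4 g5 g6 g7 g8 g9 g10 g11.
  move: (Gamma (al + 1 / 2)) (Gamma (al + 1 / 2 - d%:R / 2)) (Gamma (2 * al))
    (Gamma (2 * al - d%:R / 2)) (Gamma be1) (Gamma be2) (Gamma (3 * al + 1 / 2 - be1))
    (Gamma (3 * al + 1 / 2 - be2)) (Gamma al) (Gamma (al - d%:R / 2)) (Gamma (d%:R / 2))
    (Gamma (be1 - d%:R / 2)) (Gamma (be2 - d%:R / 2)) (Gamma (3 * al + 1 / 2 - be1 - d%:R / 2))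
    (Gamma (3 * al + 1 / 2 - be2 - d%:R / 2)).
  move=> x1 x2 x3 x4 x5 x6 x7 x8 x9 x10 x11 x12 x13 x14 x15.
  move=> n1 n2 n3 n4 n5 n6 n7 n8 n9 n10 n11.
  by field; rewrite n1 n2 n3 n4 n5 n6 n7 n8 n9 n10 n11.
- move=> al1 al2 be h1 h2.
  rewrite -lerBrDr ge_max => /andP[h1' h2'].
  have {}h1' : al1 + 1 / 2 <= be by lra.
  have {}h2' : al2 + 1 / 2 <= be by lra.
  have -> : be - (d%:R + 1) / 2 = be - 1 / 2 - d%:R / 2 by field.
  have -> : al1 + be - (d%:R + 1) / 2 = al1 + be - 1 / 2 - d%:R / 2 by field.
  have -> : al2 + be - (d%:R + 1) / 2 = al2 + be - 1 / 2 - d%:R / 2 by field.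
  have D1 : gauss_domain (d%:R / 2) al1 be (al1 + be - 1 / 2) by split; lra.
  have D2 : gauss_domain (d%:R / 2) al2 be (al2 + be - 1 / 2) by split; lra.
  have D12 : gauss_domain (d%:R / 2) (be - 1 / 2) be (2 * be - 1) by split; lra.
  have := G0 (be - 1 / 2) ltac:(lra).
  have := G0 (be - 1 / 2 - d%:R / 2) ltac:(lra).
  have := G0 be ltac:(lra).
  have := G0 (be - d%:R / 2) ltac:(lra).
  have := G0 (2 * be - 1) ltac:(lra).
  have := G0 (2 * be - 1 - d%:R / 2) ltac:(lra).
  have := G0 (al1 - d%:R / 2) ltac:(lra).
  have := G0 (al2 - d%:R / 2) ltac:(lra).
  have := G0 (al1 + be - 1 / 2) ltac:(lra).
  have := G0 (al2 + be - 1 / 2) ltac:(lra).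
  have := G0 (d%:R / 2) ltac:(lra).
  have al12 : 1 / 2 < al1 by lra.
  have al22 : 1 / 2 < al2 by lra.
  have nn (t : R) : 0 <= hyp1F2 (be - 1 / 2) be (2 * be - 1) t by apply: hyp1F2_ge0; lra.
  move=> g13 g12 g11 g10 g9 g6 g5 g4 g3 g2 g1 hrho.
  have S12 := D12; case: S12 => s1 s2 s3 s4.
  have {s1 s2 s3 s4}S12 := gauss_spectral_gt0 hd0 s1 s2 s3.
  apply: (valid_bivariate_gauss a hd D1 D12 D2).
  + by move=> t _; exact: nn.
  + by move=> t; exact: hyp1F2_le_case2.
  + by move=> t; exact: hyp1F2_le_case2.
  (* With a common beta, Gamma(d/2) Gamma(be - d/2) / Gamma(be) drops out instead; likewise in case
     (iii). *)
  apply: bound S12 _ hrho; rewrite /gauss_spectral.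
  move: g1 g2 g3 g4 g5 g6 g9 g10 g11 g12 g13.
  move: (Gamma (be - 1 / 2)) (Gamma (be - 1 / 2 - d%:R / 2)) (Gamma be) (Gamma (be - d%:R / 2))
    (Gamma (2 * be - 1)) (Gamma (2 * be - 1 - d%:R / 2)) (Gamma al1) (Gamma al2)
    (Gamma (al1 - d%:R / 2)) (Gamma (al2 - d%:R / 2)) (Gamma (al1 + be - 1 / 2))
    (Gamma (al2 + be - 1 / 2)) (Gamma (d%:R / 2)) (Gamma (al1 + be - 1 / 2 - d%:R / 2))
    (Gamma (al2 + be - 1 / 2 - d%:R / 2)).
  move=> x1 x2 x3 x4 x5 x6 x7 x8 x9 x10 x11 x12 x13 x14 x15.
  move=> n1 n2 n3 n4 n5 n6 n9 n10 n11 n12 n13.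
  by field; rewrite n1 n2 n3 n4 n5 n6 n9 n10 n11 n12 n13.
- move=> al1 al2 be h1 h2.
  rewrite -lerBrDr ge_max => /andP[h1' h2'].
  have {}h1' : al1 + 1 / 2 <= be by lra.
  have {}h2' : al2 + 1 / 2 <= be by lra.
  have -> : be - (d%:R + 1) / 2 = be - 1 / 2 - d%:R / 2 by field.
  have D1 : gauss_domain (d%:R / 2) al1 be (2 * al1) by split; lra.
  have D2 : gauss_domain (d%:R / 2) al2 be (2 * al2) by split; lra.
  have D12 : gauss_domain (d%:R / 2) (be - 1 / 2) be (2 * be - 1) by split; lra.
  have := G0 (be - 1 / 2) ltac:(lra).
  have := G0 (be - 1 / 2 - d%:R / 2) ltac:(lra).
  have := G0 be ltac:(lra).
  have := G0 (be - d%:R / 2) ltac:(lra).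
  have := G0 (2 * be - 1) ltac:(lra).
  have := G0 (2 * be - 1 - d%:R / 2) ltac:(lra).
  have := G0 (al1 - d%:R / 2) ltac:(lra).
  have := G0 (al2 - d%:R / 2) ltac:(lra).
  have := G0 (2 * al1) ltac:(lra).
  have := G0 (2 * al2) ltac:(lra).
  have := G0 (d%:R / 2) ltac:(lra).
  have al12 : 1 / 2 < al1 by lra.
  have al22 : 1 / 2 < al2 by lra.
  have nn (t : R) : 0 <= hyp1F2 (be - 1 / 2) be (2 * be - 1) t by apply: hyp1F2_ge0; lra.
  move=> g13 g12 g11 g10 g9 g6 g5 g4 g3 g2 g1 hrho.
  have S12 := D12; case: S12 => s1 s2 s3 s4.
  have {s1 s2 s3 s4}S12 := gauss_spectral_gt0 hd0 s1 s2 s3.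
  apply: (valid_bivariate_gauss a hd D1 D12 D2).
  + by move=> t _; exact: nn.
  + by move=> t; exact: hyp1F2_le_case3.
  + by move=> t; exact: hyp1F2_le_case3.
  apply: bound S12 _ hrho; rewrite /gauss_spectral.
  move: g1 g2 g3 g4 g5 g6 g9 g10 g11 g12 g13.
  move: (Gamma (be - 1 / 2)) (Gamma (be - 1 / 2 - d%:R / 2)) (Gamma be) (Gamma (be - d%:R / 2))
    (Gamma (2 * be - 1)) (Gamma (2 * be - 1 - d%:R / 2)) (Gamma al1) (Gamma al2)
    (Gamma (al1 - d%:R / 2)) (Gamma (al2 - d%:R / 2)) (Gamma (2 * al1)) (Gamma (2 * al2))
    (Gamma (d%:R / 2)) (Gamma (2 * al1 - d%:R / 2)) (Gamma (2 * al2 - d%:R / 2)).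
  move=> x1 x2 x3 x4 x5 x6 x7 x8 x9 x10 x11 x12 x13 x14 x15.
  move=> n1 n2 n3 n4 n5 n6 n9 n10 n11 n12 n13.
  by field; rewrite n1 n2 n3 n4 n5 n6 n9 n10 n11 n12 n13.
Qed.
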